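(* Let $(M,\mathcal D,\mathbf g)$ be a sub-Riemannian structure with $\dim M=n$ and $\mathrm{rank}\,\mathcal D=k$. For any complement $\mathbf c$ and any volume form $\omega$, the macroscopic operator $\Delta_\omega$ and the microscopic operator $L^{\mathbf c}$ have the same principal symbol and no constant (zeroth-order) term. Moreover $L^{\mathbf c}=\Delta_\omega$ if and only if $$\chi^{(\mathbf c,\omega)}:=\Delta_\omega-L^{\mathbf c}=\sum_{i=1}^k\sum_{j=k+1}^nc_{ji}^jX_i+\mathrm{grad}(\theta)=0,$$ where $\theta=\log|\omega(X_1,\dots,X_n)|$ and $c_{ij}^\ell$ are the structural functions associated with an orthonormal frame $X_1,\dots,X_k$ for $\mathcal D$ and a frame $X_{k+1},\dots,X_n$ for $\mathbf c$.
   Context: A sub-Riemannian structure is a triple $(M,\mathcal D,\mathbf g)$ where $M$ is a smooth connected orientable $n$-manifold, $\mathcal D\subset TM$ is a smooth bracket-generating distribution of constant rank $k<n$, and $\mathbf g$ is a smooth scalar product on $\mathcal D$. A complement $\mathbf c$ is a smooth sub-bundle of $TM$ with $TM=\mathcal D\oplus\mathbf c$. Structural functions of a local frame: $[X_i,X_j]=\sum_{\ell=1}^nc_{ij}^\ell X_\ell$. Macroscopic Laplacian: $\Delta_\omega=\mathrm{div}_\omega\circ\mathrm{grad}$, where $\mathrm{grad}(f)\in\Gamma(\mathcal D)$ is defined by $\mathbf g(\mathrm{grad}(f),X)=df(X)$ for $X\in\Gamma(\mathcal D)$, and $\mathrm{div}_\omega(X)\,\omega=\mathcal L_X\omega$.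 In $\chi^{(\mathbf c,\omega)}$, $\mathrm{grad}(\theta)$ is regarded as a derivation. Microscopic Laplacian: let $H(\lambda)=\frac12\sum_{i=1}^k\langle\lambda,X_i\rangle^2$ on $T^*M$, $C_q=\{\lambda\in T^*_qM:2H(\lambda)=1\}$, and $\exp_q(t,\lambda)$ the projection to $M$ of the integral curve at time $t$ of the Hamiltonian vector field of $H$ starting at $\lambda$. Put $\mathbf h_q=\mathbf c_q^\perp$, $\mathbf v_q=\mathcal D_q^\perp$ (annihilators), so $C_q=\mathbb S_q^{k-1}\times\mathbf v_q$ with $\mathbb S_q^{k-1}=C_q\cap\mathbf h_q$ the unit sphere of $(\mathbf h_q,2H|_{\mathbf h_q})$. Then $$(L^{\mathbf c}\phi)(q)=\lim_{t\to0^+}\frac{2k}{t^2}\int_{C_q}\big(\phi(\exp_q(t,\lambda))-\phi(q)\big)\mu_q(\lambda),$$ where $\mu_q=\mu_{\mathbb S_q^{k-1}}\times\mu_{\mathbf v_q}$, with $\mu_{\mathbb S_q^{k-1}}$ the uniform probability measure and $\mu_{\mathbf v_q}$ a Borel probability measure on $\mathbf v_q$ for which linear functions are square-integrable and such that $q\mapsto\int_{C_q}f^2\mu_q$ is continuous for each continuous fiberwise linear $f:T^*M\to\mathbb R$ (e.g. $\mu_{\mathbf v_q}=\delta_0$). It is a fact that the limit exists, is independent of the choice of such measures, and in any local orthonormal frame $X_1,\dots,X_k$ of $\mathcal D$ completed by a local frame $X_{k+1},\dots,X_n$ of $\mathbf c$ equals $L^{\mathbf c}=\sum_{i=1}^kX_i^2+\sum_{i,j=1}^kc_{ji}^jX_i$.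 *)

(* Defs.v *)
From HB Require Import structures.
From mathcomp Require Import all_boot all_order all_algebra.
From mathcomp Require Import all_classical all_reals all_analysis.

Set Implicit Arguments.
Unset Strict Implicit.
Unset Printing Implicit Defensive.
Import Order.TTheory GRing.Theory Num.Theory.
Import numFieldNormedType.Exports.
Local Open Scope classical_set_scope.
Local Open Scope ring_scope.

(* MathComp-Analysis has no manifolds: here a manifold is a topological space
   with a smooth atlas, and tangent vectors are derivations acting on germs of
   smooth functions. *)

Section Smoothness.
Context {R : realType} {n : nat}.

Fixpoint differentiable_upto (m : nat) (A : set 'rV[R]_n)
    (f : 'rV[R]_n -> R^o) : Prop :=
  if m is m'.+1 then
    (forall x, A x -> differentiable f x) /\
    (forall v, differentiable_upto m' A ('D_v f))
  else forall x, A x -> {for x, continuous f}.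

(* C^oo on A; only used for open A. *)
Definition smoothV A f := forall m, differentiable_upto m A f.

End Smoothness.

Section Charts.
Context {R : realType} (n : nat) (M : topologicalType).

(* chart_map and param are total functions; only their restrictions to dom and
   to chart_map @` dom matter. *)
Record chart := Chart {
  dom : set M;
  chart_map : M -> 'rV[R]_n;
  param : 'rV[R]_n -> M }.

Definition is_chart (c : chart) : Prop :=
  [/\ open (dom c),
      open (chart_map c @` dom c),
      {in dom c, cancel (chart_map c) (param c)},
      (forall q, dom c q -> {for q, continuous (chart_map c)}) &
      (forall q, dom c q -> {for chart_map c q, continuous (param c)})].

Definition transition (c1 c2 : chart) : 'rV[R]_n -> 'rV[R]_n :=
  chart_map c2 \o param c1.

Definition compatible (c1 c2 : chart) : Prop :=
  forall i : 'I_n,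
    smoothV (chart_map c1 @` (dom c1 `&` dom c2))
            (fun x => transition c1 c2 x 0 i) /\
    smoothV (chart_map c2 @` (dom c1 `&` dom c2))
            (fun x => transition c2 c1 x 0 i).

End Charts.

Record manifold (R : realType) (n : nat) := Manifold {
  carrier :> topologicalType;
  atlas : set (@chart R n carrier);
  manifold_hausdorff : hausdorff_space carrier;
  manifold_second_countable : @second_countable carrier;
  atlas_chart : forall c, atlas c -> is_chart c;
  atlas_cover : forall q, exists2 c, atlas c & dom c q;
  atlas_compatible : forall c1 c2, atlas c1 -> atlas c2 -> compatible c1 c2 }.

Section Manifold.
Context {R : realType} {n : nat} {M : manifold R n}.
Implicit Types (q p : M) (U : set M) (f phi : M -> R).

Definition orientable : Prop :=
  exists A : set (@chart R n M),
    [/\ forall c, A c ->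
          is_chart c /\ forall c', atlas c' -> compatible c c',
        forall q, exists2 c, A c & dom c q &
        forall c1 c2 q, A c1 -> A c2 -> dom c1 q -> dom c2 q ->
          0 < \det ('J (transition c1 c2) (chart_map c1 q))].

Definition smooth_on U f : Prop :=
  forall c, atlas c -> smoothV (chart_map c @` (dom c `&` U)) (f \o param c).

Definition smooth_at q f : Prop :=
  exists2 U, open_nbhs q U & smooth_on U f.

Definition smooth f : Prop := smooth_on setT f.

(* Tangent vectors act on germs of smooth functions. To make the action a
   total function, it is set to 0 on functions that are not smooth near the
   base point; this keeps T_q M a linear space for the pointwise operations. *)
Definition tvec : Type := (M -> R) -> R^o.
HB.instance Definition _ := GRing.Lmodule.copy tvec ((M -> R) -> R^o).

Definition coord_vec (c : @chart R n M) (i : 'I_n) q : tvec :=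
  fun f => if `[< smooth_at q f >]
           then 'D_(delta_mx 0 i) (f \o param c : _ -> R^o) (chart_map c q)
           else 0.

Definition tangent q : set tvec :=
  [set v | exists c, [/\ atlas c, dom c q &
     exists a : 'rV[R]_n, v = \sum_i a 0 i *: coord_vec c i q]].

Definition vector_field U (X : M -> tvec) : Prop :=
  (forall q, U q -> tangent q (X q)) /\
  (forall V f, open V -> V `<=` U -> smooth_on V f ->
     smooth_on V (fun q => X q f)).

Definition bracket (X Y : M -> tvec) (q : M) : tvec :=
  fun f => if `[< smooth_at q f >]
           then X q (fun p => Y p f) - Y q (fun p => X p f)
           else 0.

(* The subfamily (e_i), i such that P i, is a basis of W. *)
Definition is_basis (I : finType) (P : pred I) (W : set tvec)
    (e : I -> tvec) : Prop :=
  (forall v, W v <->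
     exists a : I -> R, v = \sum_(i | P i) a i *: e i) /\
  (forall a : I -> R, \sum_(i | P i) a i *: e i = 0 ->
     forall i, P i -> a i = 0).

Definition is_frame (I : finType) (P : pred I) U (W : M -> set tvec)
    (X : I -> M -> tvec) : Prop :=
  (forall i, P i -> vector_field U (X i)) /\
  (forall q, U q -> is_basis P (W q) (X^~ q)).

Definition smooth_subbundle (r : nat) (W : M -> set tvec) : Prop :=
  (forall q, W q `<=` tangent q) /\
  (forall q, exists U, open_nbhs q U /\
     exists X : 'I_r -> M -> tvec, is_frame predT U W X).

Definition local_section U (W : M -> set tvec) (X : M -> tvec) : Prop :=
  vector_field U X /\ forall q, U q -> W q (X q).

Inductive iterated_bracket U (W : M -> set tvec) : (M -> tvec) -> Prop :=
| iterated_bracket_section X :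
    local_section U W X -> iterated_bracket U W X
| iterated_bracket_bracket X Y :
    iterated_bracket U W X -> iterated_bracket U W Y ->
    iterated_bracket U W (bracket X Y).

Definition bracket_generating (W : M -> set tvec) : Prop :=
  forall q v, tangent q v ->
    exists (U : set M) (m : nat) (a : 'I_m -> R) (Z : 'I_m -> M -> tvec),
      [/\ open_nbhs q U, forall i, iterated_bracket U W (Z i) &
          v = \sum_i a i *: Z i q].

Definition smooth_scalar_product (W : M -> set tvec)
    (g : M -> tvec -> tvec -> R) : Prop :=
  [/\ forall q u v w (a : R), W q u -> W q v -> W q w ->
        g q (a *: u + v) w = a * g q u w + g q v w,
      forall q u v, W q u -> W q v -> g q u v = g q v u,
      forall q u, W q u -> u <> 0 -> 0 < g q u u &
      forall U X Y, open U -> local_section U W X -> local_section U W Y ->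
        smooth_on U (fun q => g q (X q) (Y q))].

(* A smooth nowhere vanishing alternating n-form. *)
Definition volume_form (w : M -> ('I_n -> tvec) -> R) : Prop :=
  [/\ forall q (e : 'I_n -> tvec) i u v (a : R),
        (forall j, tangent q (e j)) -> tangent q u -> tangent q v ->
        w q [eta e with i |-> a *: u + v] =
        a * w q [eta e with i |-> u] + w q [eta e with i |-> v],
      forall q (e : 'I_n -> tvec) i j,
        (forall l, tangent q (e l)) -> i != j -> e i = e j -> w q e = 0,
      forall U (Y : 'I_n -> M -> tvec), open U ->
        (forall i, vector_field U (Y i)) ->
        smooth_on U (fun q => w q (Y^~ q)) &
      forall q, exists2 e : 'I_n -> tvec,
        (forall i, tangent q (e i)) & w q e != 0].

(* The Lie derivative of a covariant tensor:
   (L_X w)(Y_1, ..., Y_n) =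
     X (w (Y_1, ..., Y_n)) - \sum_i w (Y_1, ..., [X, Y_i], ..., Y_n). *)
Definition lie_derivative (w : M -> ('I_n -> tvec) -> R) (X : M -> tvec)
    (Y : 'I_n -> M -> tvec) (q : M) : R :=
  X q (fun p => w p (Y^~ p)) -
  \sum_i w q [eta Y^~ q with i |-> bracket X (Y i) q].

Definition divergence (w : M -> ('I_n -> tvec) -> R) (X : M -> tvec)
    (q : M) : R :=
  xget 0 [set h : R | forall U (Y : 'I_n -> M -> tvec), open_nbhs q U ->
    (forall i, vector_field U (Y i)) ->
    h * w q (Y^~ q) = lie_derivative w X Y q].

Section Cotangent.
Variable q : M.

Definition cotangent_pred : {pred tvec -> R^o} := fun l =>
  `[< (forall (a : R) u v, tangent q u -> tangent q v ->
         l (a *: u + v) = a * l u + l v) /\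
      (forall v, ~ tangent q v -> l v = 0) >].

Fact cotangent_submod_closed : submod_closed cotangent_pred.
Proof.
split=> [|a l m].
  by apply/asboolP; split=> [b u v _ _|//]; rewrite [RHS]addr0 mulr0.
move=> /asboolP[l1 l0] /asboolP[m1 m0].
have E u : (a *: l + m) u = a * l u + m u by [].
apply/asboolP; split=> [b u v Tu Tv|v Tv]; rewrite !E.
  by rewrite l1 // m1 // !mulrDr addrACA mulrCA.
by rewrite l0 // m0 // mulr0 addr0.
Qed.

HB.instance Definition _ :=
  GRing.isSubmodClosed.Build R (tvec -> R^o) cotangent_pred
    cotangent_submod_closed.

(* T*_q M; the value outside T_q M is normalized to 0. *)
Record cotangent : Type := Cotangent {
  cov :> tvec -> R^o;
  cov_cotangent : cov \in cotangent_pred }.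

HB.instance Definition _ := [isSub for cov].
HB.instance Definition _ := [Choice of cotangent by <:].
HB.instance Definition _ := [SubChoice_isSubLmodule of cotangent by <:].
HB.instance Definition _ := isPointed.Build cotangent 0.

Definition cotangent_cylinders : set (set cotangent) :=
  [set A | exists (v : tvec) (B : set R),
     measurable B /\ A = [set l | B (cov l v)]].

(* The Borel sigma-algebra of the finite-dimensional space T*_q M. *)
Definition cotangentB := g_sigma_algebraType cotangent_cylinders.

End Cotangent.

Definition cotangent_bundle : Type := {q : M & cotangent q}.

(* Continuity for the topology of T*M given by the bundle charts. *)
Definition bundle_continuous (f : forall q, cotangent q -> R) : Prop :=
  forall q (l : cotangent q) c, atlas c -> dom c q ->
  forall e : R, 0 < e -> exists2 d : R, 0 < d &
  forall p (m : cotangent p), dom c p ->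
    `|chart_map c p - chart_map c q| < d ->
    (forall i, `|m (coord_vec c i p) - l (coord_vec c i q)| < d) ->
    `|f p m - f q l| < e.

Definition annihilator (W : M -> set tvec) q : set (cotangent q) :=
  [set l | forall v, W q v -> l v = 0].

Definition order2_expr (P : (M -> R) -> M -> R) (c : @chart R n M)
    (a : 'I_n -> 'I_n -> M -> R) (b : 'I_n -> M -> R) (z : M -> R) : Prop :=
  [/\ forall i j, smooth_on (dom c) (a i j),
      forall i, smooth_on (dom c) (b i),
      smooth_on (dom c) z,
      forall i j q, a i j q = a j i q &
      forall phi, smooth phi -> forall q, dom c q ->
        P phi q =
          \sum_i \sum_j a i j q *
             coord_vec c i q (fun p => coord_vec c j p phi) +
          \sum_i b i q * coord_vec c i q phi + z q * phi q].

(* P is a linear differential operator of order at most 2 and sigma is its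
   principal symbol: sigma (xi) = \sum_ij a_ij xi_i xi_j in every chart. *)
Definition principal_symbol (P : (M -> R) -> M -> R)
    (sigma : forall q, cotangent q -> R) : Prop :=
  forall c, atlas c -> exists a b z, order2_expr P c a b z /\
    forall q (l : cotangent q), dom c q ->
      sigma q l =
        \sum_i \sum_j a i j q * l (coord_vec c i q) * l (coord_vec c j q).

Definition no_zeroth_order_term (P : (M -> R) -> M -> R) : Prop :=
  forall c, atlas c -> exists a b, order2_expr P c a b (fun=> 0).

End Manifold.

Arguments tvec {R n} M.
Arguments orientable {R n} M.

Record sub_riemannian (R : realType) (n k : nat) (M : manifold R n) :=
  SubRiemannian {
  distribution : M -> set (tvec M);
  metric : M -> tvec M -> tvec M -> R;
  sr_rank : (k < n)%N;
  sr_connected : connected [set: M];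
  sr_orientable : orientable M;
  sr_subbundle : smooth_subbundle k distribution;
  sr_bracket_generating : bracket_generating distribution;
  sr_metric : smooth_scalar_product distribution metric }.

Section SubRiemannian.
Context {R : realType} {n k : nat} {M : manifold R n}.
Variable S : sub_riemannian k M.
Implicit Types (q p : M) (U : set M) (phi : M -> R).
Local Notation D := (distribution S).
Local Notation g := (metric S).

(* A complement necessarily has rank n - k. *)
Definition complement (C : M -> set (tvec M)) : Prop :=
  smooth_subbundle (n - k) C /\
  (forall q v, tangent q v ->
     exists u w, [/\ D q u, C q w & v = u + w]) /\
  (forall q v, D q v -> C q v -> v = 0).

(* X_i with i < k is an orthonormal frame of D, X_i with k <= i a frame of C. *)
Definition adapted_frame (C : M -> set (tvec M)) U
    (X : 'I_n -> M -> tvec M) : Prop :=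
  [/\ is_frame (fun i : 'I_n => (i < k)%N) U D X,
      is_frame (fun i : 'I_n => (k <= i)%N) U C X &
      forall q (i j : 'I_n), U q -> (i < k)%N -> (j < k)%N ->
        g q (X i q) (X j q) = (i == j)%:R].

Definition structural_functions U (X : 'I_n -> M -> tvec M)
    (cs : 'I_n -> 'I_n -> 'I_n -> M -> R) : Prop :=
  forall i j q, U q ->
    bracket (X i) (X j) q = \sum_l cs i j l q *: X l q.

Definition gradient (f : M -> R) q : tvec M :=
  xget 0 [set v | D q v /\ forall u, D q u -> g q v u = u f].

Definition macro_laplacian (w : M -> ('I_n -> tvec M) -> R) (phi : M -> R) :
    M -> R :=
  divergence w (gradient phi).

Definition orthonormal_basis q (e : 'I_k -> tvec M) : Prop :=
  is_basis predT (D q) e /\ forall i j, g q (e i) (e j) = (i == j)%:R.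

(* H (l) = 1/2 \sum_i <l, X_i>^2 for any orthonormal basis X_i of D_q. *)
Definition hamiltonian q (l : tvec M -> R) : R :=
  xget 0 [set h | exists2 e, orthonormal_basis q e &
                    h = 2^-1 * \sum_i l (e i) ^+ 2].

(* H in the canonical coordinates (x, p) of T*M, where p stands for the
   covector \sum_i p_i dx^i. *)
Definition hamiltonian_chart (c : @chart R n M) (x p : 'rV[R]_n) : R^o :=
  hamiltonian (param c x)
    (fun v => \sum_i p 0 i * v (fun r => chart_map c r 0 i)).

(* Hamilton's equations x_i' = dH/dp_i, p_i' = - dH/dx_i, in canonical
   coordinates around each point of the curve. *)
Definition integral_curve (I : set R) (G : R -> @cotangent_bundle R n M) :
    Prop :=
  forall t, I t ->
    {for t, continuous (fun s => tag (G s))} /\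
    exists c, [/\ atlas c, dom c (tag (G t)) &
      let x := chart_map c (tag (G t)) in
      let p := \row_i tagged (G t) (coord_vec c i (tag (G t))) in
      forall i : 'I_n,
        is_derive (t : R^o) 1 (fun s : R^o => chart_map c (tag (G s)) 0 i : R^o)
          ('D_(delta_mx 0 i) (hamiltonian_chart c x) p) /\
        is_derive (t : R^o) 1
          (fun s : R^o => tagged (G s) (coord_vec c i (tag (G s))) : R^o)
          (- 'D_(delta_mx 0 i) (hamiltonian_chart c ^~ p) x)].

(* exp_q (t, l) for 0 <= t, with value q if the integral curve starting at l
   does not exist up to time t. Covectors in C_q have unit speed, so for fixed
   q and all small t the curve exists for every l in C_q; the default value is
   thus invisible in the limit defining the microscopic Laplacian. *)
Definition sr_exp q (t : R) (l : cotangent q) : M :=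
  xget q [set p | exists e : R, 0 < e /\
    exists G, [/\ integral_curve `]- e, t + e[%classic G,
                  G 0 = Tagged cotangent l & tag (G t) = p]].

Section MicroLaplacian.
Variable C : M -> set (tvec M).
(* The measures on the two factors of C_q = S_q x v_q, both seen as measures
   on T*_q M. *)
Variables (muS muV : forall q : M, probability (cotangentB q) R).

Definition unit_sphere q : set (cotangent q) :=
  [set l | annihilator C l /\ 2 * hamiltonian q l = 1].

(* Invariance under the linear isometries of (h_q, 2H), each extended to a
   linear endomorphism of T*_q M. *)
Definition uniform_on_sphere : Prop :=
  forall q, muS q (unit_sphere (q := q)) = 1%E /\
    forall F : {linear cotangent q -> cotangent q},
      (forall l, annihilator C l ->
         annihilator C (F l) /\ hamiltonian q (F l) = hamiltonian q l) ->
      forall B : set (cotangentB q), measurable B ->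
        muS q (F @^-1` B) = muS q B.

(* Integral over C_q against the product measure, (s, v) standing for the
   covector s + v. *)
Definition integral_Cq q (f : cotangent q -> R) : R :=
  \int[(muS q \x muV q)%E]_z f ((z.1 : cotangent q) + (z.2 : cotangent q)).

Definition admissible_vertical : Prop :=
  [/\ forall q, muV q (annihilator D (q := q)) = 1%E,
      forall q (v : tvec M), tangent q v ->
        (muV q).-integrable setT (fun l : cotangentB q =>
           (((l : cotangent q) v : R) ^+ 2)%:E) &
      forall f : forall q, {linear cotangent q -> R^o},
        bundle_continuous (fun q => f q) ->
        continuous (fun q => integral_Cq (fun l : cotangent q => f q l ^+ 2))].

Definition micro_laplacian (phi : M -> R) q : R :=
  lim ((fun t : R => (2 * k)%:R / t ^+ 2 *
          integral_Cq (fun l : cotangent q => phi (sr_exp t l) - phi q))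
       @ 0^'+).

End MicroLaplacian.

(* \sum_(i <= k) \sum_(j > k) c_ji^j X_i + grad (log |w (X_1, ..., X_n)|). *)
Definition chi_frame (w : M -> ('I_n -> tvec M) -> R)
    (X : 'I_n -> M -> tvec M) (cs : 'I_n -> 'I_n -> 'I_n -> M -> R) q :
    tvec M :=
  \sum_(i < n | (i < k)%N) \sum_(j < n | (k <= j)%N)
     cs j i j q *: X i q +
  gradient (fun p => ln `|w p (X^~ p)|) q.

End SubRiemannian.

(* Main.v *)
Require Import Defs.
From mathcomp Require Import all_boot all_order all_algebra fingroup perm.
From mathcomp Require Import all_classical all_reals all_analysis.
From mathcomp Require Import measurable_realfun ring lra.
From HB Require Import structures.

(** Both Laplacians are computed in a local frame X_1, ..., X_n that is adapted
    to the complement: X_1, ..., X_k is orthonormal in the distribution and the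
    other fields span the complement. Gram-Schmidt provides such frames, and their
    structural functions are smooth (exists_regular_frame).

    Macroscopic side. The Lie derivative of the volume form is tensorial, so the
    divergence of a field Z is Z (log |w (X_1, ..., X_n)|) minus the trace of the
    brackets [Z, X_j] in the frame (divergence_frame). For Z = grad phi this yields
    sum_(i <= k) X_i^2 phi + sum_(i, j <= k) c_ji^j X_i phi plus the derivative of phi
    along chi (macro_laplacianE).

    Microscopic side. Along a Hamiltonian curve with momenta h_j = <lambda, X_j>, the
    derivative of a function f is sum_(i <= k) h_i X_i f, and that of h_j is
    sum_(i <= k) sum_m c_ij^m h_i h_m. Hence phi (exp_q (t, lambda)) - phi (q) is
    t sum_i h_i X_i phi + t^2/2 sum_(j, m) B_jm h_j h_m with an explicit matrix B whose
    index j is horizontal (flow_hessian), up to an error at most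
    K |lambda|^2 t^3 that is uniform over the unit covectors (flow_expansion). The
    uniformity comes from the conservation of H: horizontal momenta are at most 1, so
    the projected curves have bounded speed and remain in a chart, and the vertical
    momenta grow at most exponentially. The same bounds give an existence time common
    to all unit covectors (exists_flow). By invariance under isometries the horizontal
    momenta have mean 0 and second moments delta_ij / k (sphere_moment1,
    sphere_moment2), and the mixed moments of the product measure vanish; integration
    kills the linear term, and the t^2 term leaves the trace sum_(j <= k) B_jj / k
    (integral_Cq_estimate). The integrand is defined by choice and possibly not
    measurable; its integral is squeezed between integrals of polynomials in the
    momenta (has_integral_dist). The limit is thus the trace of B, which is
    sum_(i <= k) X_i^2 phi + sum_(i, j <= k) c_ji^j X_i phi (micro_laplacianE).

    The difference of the two expressions is chi, whence the last two assertions.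
    Both operators are sums of squares X_i^2 plus first-order terms. For such an
    operator P, the coefficients in a chart are b_i = P (x_i) and the values on
    coordinates of the carre du champ (P (f g) - f P g - g P f) / 2, which equals
    sum_(i <= k) (X_i f) (X_i g) for either operator; so the principal symbol is twice the
    Hamiltonian for both, and there is no zeroth-order term. *)

Import Order.TTheory GRing.Theory Num.Theory numFieldNormedType.Exports.
Set Implicit Arguments.
Unset Strict Implicit.
Unset Printing Implicit Defensive.
Local Open Scope classical_set_scope.
Local Open Scope ring_scope.

(** * Smooth functions on open sets of R^n *)

Section SmoothCalculus.
Context {R : realType}.

(** The difference g - f vanishes near x, so its differential there is 0. *)
Lemma near_eq_differentiable (V W : normedModType R) (f g : V -> W) (x : V) :
  (\near x, f x = g x) -> differentiable f x -> differentiable g x.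
Proof.
move=> fg df.
have -> : g = f + (g - f) by rewrite addrC subrK.
apply: differentiableD => //; set h := g - f.
have hx0 : h x = 0 by rewrite /h !fctE (nbhs_singleton fg) subrr.
have ho : h \o shift x = cst (h x) + (\0 : V -> W) +o_ 0 id.
  apply/eqaddoP => e e0; near=> y.
  change (`|h (y + x) - (h x + 0)| <= e * `|y|).
  rewrite hx0 addr0 subr0.
  have -> : h (y + x) = 0.
    near: y; move: fg; rewrite (near_shift 0 x) subr0; apply: filterS => y /= E.
    by rewrite /h !fctE E subrr.
  by rewrite normr0 mulr_ge0 // ltW.
have c0 : continuous (\0 : V -> W) by move=> y; exact: cst_continuous.
by apply/diff_locallyP; rewrite (diff_unique c0 ho); split.
Unshelve. all: by end_near. Qed.

Context {n : nat}.
Implicit Types (A B : set 'rV[R]_n) (f g : 'rV[R]_n -> R^o) (m : nat).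

Lemma near_open A (P : 'rV[R]_n -> Prop) x :
  open A -> A x -> (forall y, A y -> P y) -> \near x, P x.
Proof.
move=> oA Ax AP; near=> y; apply: AP; near: y; exact: open_nbhs_nbhs.
Unshelve. all: by end_near. Qed.

Lemma differentiable_upto_ext m A f g : open A ->
  (forall x, A x -> f x = g x) ->
  differentiable_upto m A f -> differentiable_upto m A g.
Proof.
move=> oA; elim: m f g => [|m IH] f g fg /=.
  move=> cf x Ax; change (g @ x --> g x); rewrite -(fg _ Ax).
  apply: (cvg_trans _ (cf _ Ax)); apply: (@near_eq_cvg _ _ (nbhs x)).
  exact: near_open oA Ax fg.
move=> [df Df]; split=> [x Ax|v].
  apply: near_eq_differentiable (df _ Ax); exact: near_open oA Ax fg.
apply: IH (Df v) => x Ax; apply: near_eq_derive.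
exact: near_open oA Ax fg.
Qed.

Lemma differentiable_upto_subset m A B f : B `<=` A ->
  differentiable_upto m A f -> differentiable_upto m B f.
Proof.
move=> BA; elim: m f => [|m IH] f /=; first by move=> cf x /BA /cf.
by move=> [df Df]; split=> [x /BA /df //|v]; exact: IH.
Qed.

Lemma differentiable_uptoW m A f :
  differentiable_upto m.+1 A f -> differentiable_upto m A f.
Proof.
elim: m f => [|m IH] f [df Df].
  by move=> x Ax; apply: differentiable_continuous; exact: df.
by split=> // v; apply: IH; exact: Df.
Qed.

Lemma differentiable_upto_cst m A (c : R) : differentiable_upto m A (fun=> c).
Proof.
elim: m c => [|m IH] c /=; first by move=> x _; exact: cst_continuous.
split=> [x _|v]; first exact: differentiable_cst.
rewrite (_ : 'D_v _ = fun=> 0); first exact: IH.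
by apply/funext => x; exact: derive_cst.
Qed.

Lemma derive_coord (v x : 'rV[R]_n) i :
  'D_v (fun x : 'rV[R]_n => x 0 i : R^o) x = v 0 i.
Proof.
rewrite (deriveE _ (differentiable_coord _ _ _)).
have L : linear (fun x : 'rV[R]_n => x 0 i : R^o).
  by move=> a u w; rewrite !mxE.
pose lm := GRing.isLinear.Build _ _ _ _ _ L.
pose lf : {linear 'rV[R]_n -> R^o} := HB.pack (fun x : 'rV[R]_n => x 0 i : R^o) lm.
by rewrite (@diff_lin _ _ _ lf) // => y; exact: coord_continuous.
Qed.

Lemma differentiable_upto_coord m A i :
  differentiable_upto m A (fun x => x 0 i).
Proof.
case: m => [|m] /=; first by move=> x _; exact: coord_continuous.
split=> [x _|v]; first exact: differentiable_coord.
rewrite (_ : 'D_v _ = fun=> v 0 i); first exact: differentiable_upto_cst.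
by apply/funext => x; exact: derive_coord.
Qed.

Lemma differentiable_uptoD m A f g : open A ->
  differentiable_upto m A f -> differentiable_upto m A g ->
  differentiable_upto m A (fun x => f x + g x).
Proof.
move=> oA; elim: m f g => [|m IH] f g /=.
  by move=> cf cg x Ax; apply: continuousD; [exact: cf|exact: cg].
move=> [df Df] [dg Dg]; split=> [x Ax|v].
  by apply: differentiableD; [exact: df|exact: dg].
apply: (differentiable_upto_ext oA _ (IH _ _ (Df v) (Dg v))) => x Ax.
by rewrite -[RHS]/('D_v (f + g) x) deriveD //;
  apply: diff_derivable; [exact: df|exact: dg].
Qed.

Lemma differentiable_uptoM m A f g : open A ->
  differentiable_upto m A f -> differentiable_upto m A g ->
  differentiable_upto m A (fun x => f x * g x).
Proof.
move=> oA; elim: m f g => [|m IH] f g.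
  by move=> cf cg x Ax; apply: continuousM; [exact: cf|exact: cg].
move=> sf sg; have [df Df] := sf; have [dg Dg] := sg; split=> [x Ax|v].
  by apply: differentiableM; [exact: df|exact: dg].
have := differentiable_uptoD oA (IH _ _ (differentiable_uptoW sf) (Dg v))
  (IH _ _ (differentiable_uptoW sg) (Df v)).
apply: differentiable_upto_ext => // x Ax.
by rewrite -[RHS]/('D_v (f * g) x) deriveM //;
  apply: diff_derivable; [exact: df|exact: dg].
Qed.

Lemma differentiable_uptoV m A f : open A -> (forall x, A x -> f x != 0) ->
  differentiable_upto m A f -> differentiable_upto m A (fun x => (f x)^-1).
Proof.
move=> oA f0; elim: m => [|m IH] sf.
  by move=> x Ax; apply: continuousV; [exact: f0|exact: sf].
have [df Df] := sf; split=> [x Ax|v].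
  by apply: differentiableV; [exact: df|exact: f0].
have iV := IH (differentiable_uptoW sf).
have := differentiable_uptoM oA (differentiable_upto_cst m A (- 1))
  (differentiable_uptoM oA (Df v) (differentiable_uptoM oA iV iV)).
apply: differentiable_upto_ext => // x Ax.
rewrite deriveV; [|exact: f0|by apply: diff_derivable; exact: df].
rewrite scaleNr mulN1r; congr (- _).
by rewrite expr2 invfM mulrC.
Qed.

Lemma derive_comp1 (u : R -> R) (du : R) f x v : differentiable f x ->
  is_derive (f x) 1 u du -> 'D_v (u \o f) x = du * 'D_v f x.
Proof.
move=> df [/derivable1_diffP du1 <-].
rewrite deriveE; last exact: differentiable_comp.
rewrite diff_comp //= -[X in 'd u _ X]mulr1 -[_ * 1]/(_ *: 1) linearZ /=.
by rewrite -(deriveE _ du1) -(deriveE _ df) mulrC.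
Qed.

Lemma differentiable_upto_sqrt m A f : open A -> (forall x, A x -> 0 < f x) ->
  differentiable_upto m A f -> differentiable_upto m A (fun x => Num.sqrt (f x)).
Proof.
move=> oA f0; elim: m => [|m IH] sf.
  move=> x Ax; apply: (@continuous_comp _ _ _ f Num.sqrt); first exact: sf.
  exact: sqrt_continuous.
have [df Df] := sf; split=> [x Ax|v].
  apply: (@differentiable_comp _ _ _ _ f Num.sqrt); first exact: df.
  by apply/derivable1_diffP; have [] := is_derive1_sqrt (f0 _ Ax).
have isf := IH (differentiable_uptoW sf).
have sn0 x : A x -> Num.sqrt (f x) != 0 by move=> Ax; rewrite gt_eqF // sqrtr_gt0 f0.
have := differentiable_uptoM oA (differentiable_upto_cst m A (2^-1))
  (differentiable_uptoM oA (differentiable_uptoV oA sn0 isf) (Df v)).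
apply: differentiable_upto_ext => // x Ax.
rewrite -[RHS]/('D_v (Num.sqrt \o f) x).
rewrite (derive_comp1 _ (df _ Ax) (is_derive1_sqrt (f0 _ Ax))).
by rewrite invfM mulrA.
Qed.

Lemma is_derive_ln_norm (x : R) : x != 0 ->
  is_derive x 1 (fun y : R => ln `|y|) x^-1.
Proof.
case: (ltgtP x 0) => // x0 _.
  have : is_derive x 1 (@ln R \o -%R) (x^-1).
    apply: is_derive_eq.
      apply: (@is_derive1_comp R (@ln R) -%R x (- x)^-1 (- 1)).
      by apply: is_derive1_ln; rewrite oppr_gt0.
    by rewrite invrN mulrNN mulr1.
  apply: near_eq_is_derive; near=> y => /=; rewrite ltr0_norm //.
  by near: y; exact: lt_nbhsl.
have : is_derive x 1 (@ln R) (x^-1) by exact: is_derive1_ln.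
apply: near_eq_is_derive; near=> y; rewrite gtr0_norm //.
by near: y; exact: lt_nbhsr.
Unshelve. all: by end_near. Qed.

Lemma differentiable_upto_ln_norm m A f : open A ->
  (forall x, A x -> f x != 0) ->
  differentiable_upto m A f -> differentiable_upto m A (fun x => ln `|f x|).
Proof.
move=> oA f0; case: m => [|m] sf.
  move=> x Ax; apply: (@continuous_comp _ _ _ f (fun y => ln `|y|)).
    exact: sf.
  apply: differentiable_continuous; apply/derivable1_diffP.
  by have [] := is_derive_ln_norm (f0 _ Ax).
have [df Df] := sf; split=> [x Ax|v].
  apply: (@differentiable_comp _ _ _ _ f (fun y => ln `|y|)); first exact: df.
  by apply/derivable1_diffP; have [] := is_derive_ln_norm (f0 _ Ax).
have := differentiable_uptoM oA
  (differentiable_uptoV oA f0 (differentiable_uptoW sf)) (Df v).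
apply: differentiable_upto_ext => // x Ax.
by rewrite -[RHS]/('D_v ((fun y => ln `|y|) \o f) x)
  (derive_comp1 _ (df _ Ax) (is_derive_ln_norm (f0 _ Ax))).
Qed.

Lemma derive_sum_delta f x v : differentiable f x ->
  'D_v f x = \sum_i v 0 i * 'D_(delta_mx 0 i) f x.
Proof.
move=> df; rewrite deriveE // {1}[v]row_sum_delta linear_sum /=.
by apply: eq_bigr => i _; rewrite linearZ /= -deriveE.
Qed.

End SmoothCalculus.

Section SmoothV.
Context {R : realType} {n : nat}.
Implicit Types (A B : set 'rV[R]_n) (f g : 'rV[R]_n -> R^o) (m : nat).

Lemma smoothV_ext A f g : open A -> (forall x, A x -> f x = g x) ->
  smoothV A f -> smoothV A g.
Proof. by move=> oA fg sf m; apply: differentiable_upto_ext fg (sf m). Qed.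

Lemma smoothV_subset A B f : B `<=` A -> smoothV A f -> smoothV B f.
Proof. by move=> BA sf m; apply: differentiable_upto_subset BA (sf m). Qed.

Lemma smoothV_cst A (c : R) : smoothV A (fun=> c).
Proof. by move=> m; exact: differentiable_upto_cst. Qed.

Lemma smoothV_coord A i : smoothV A (fun x : 'rV[R]_n => x 0 i).
Proof. by move=> m; exact: differentiable_upto_coord. Qed.

Lemma smoothVD A f g : open A -> smoothV A f -> smoothV A g ->
  smoothV A (fun x => f x + g x).
Proof. by move=> oA sf sg m; exact: differentiable_uptoD. Qed.

Lemma smoothVM A f g : open A -> smoothV A f -> smoothV A g ->
  smoothV A (fun x => f x * g x).
Proof. by move=> oA sf sg m; exact: differentiable_uptoM. Qed.

Lemma smoothVV A f : open A -> (forall x, A x -> f x != 0) ->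
  smoothV A f -> smoothV A (fun x => (f x)^-1).
Proof. by move=> oA f0 sf m; exact: differentiable_uptoV. Qed.

Lemma smoothV_sqrt A f : open A -> (forall x, A x -> 0 < f x) ->
  smoothV A f -> smoothV A (fun x => Num.sqrt (f x)).
Proof. by move=> oA f0 sf m; exact: differentiable_upto_sqrt. Qed.

Lemma smoothV_ln_norm A f : open A -> (forall x, A x -> f x != 0) ->
  smoothV A f -> smoothV A (fun x => ln `|f x|).
Proof. by move=> oA f0 sf m; exact: differentiable_upto_ln_norm. Qed.

Lemma smoothV_sum A (I : Type) (r : seq I) (P : pred I)
    (F : I -> 'rV[R]_n -> R) : open A -> (forall i, P i -> smoothV A (F i)) ->
  smoothV A (fun x => \sum_(i <- r | P i) F i x).
Proof.
move=> oA sF; elim: r => [|i r IH].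
  by apply: (smoothV_ext oA _ (smoothV_cst A 0)) => x _; rewrite big_nil.
case Pi: (P i).
  by apply: (smoothV_ext oA _ (smoothVD oA (sF _ Pi) IH)) => x _;
    rewrite big_cons Pi.
by apply: (smoothV_ext oA _ IH) => x _; rewrite big_cons Pi.
Qed.

Lemma smoothV_differentiable A f x : smoothV A f -> A x -> differentiable f x.
Proof. by move=> sf; have [df _] := sf 1%N; exact: df. Qed.

Lemma smoothV_derive A f v : smoothV A f -> smoothV A ('D_v f).
Proof. by move=> sf m; have [_ Df] := sf m.+1; exact: Df. Qed.

Lemma smoothV_continuous A f x : smoothV A f -> A x -> {for x, continuous f}.
Proof. by move=> sf Ax; exact: (sf 0%N). Qed.

End SmoothV.

Section Composition.
Context {R : realType} {n p : nat}.

Lemma differentiable_row (g : 'rV[R]_n -> 'rV[R]_p) x :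
  (forall i, differentiable (fun y => g y 0 i : R^o) x) -> differentiable g x.
Proof.
move=> dg.
have -> : g = (\sum_i (fun y => g y 0 i *: (delta_mx 0 i : 'rV[R]_p))).
  by apply/funext => y; rewrite fct_sumE -row_sum_delta.
by apply: differentiable_sum => i; exact: differentiableZl.
Qed.

Lemma derive_comp_row (f : 'rV[R]_p -> R^o) (g : 'rV[R]_n -> 'rV[R]_p) x v :
  differentiable f (g x) ->
  (forall i, differentiable (fun y => g y 0 i : R^o) x) ->
  'D_v (f \o g) x =
    \sum_i 'D_(delta_mx 0 i) f (g x) * 'D_v (fun y => g y 0 i : R^o) x.
Proof.
move=> df dg; have dgx := differentiable_row dg.
rewrite deriveE; last exact: differentiable_comp.
rewrite diff_comp //= -(deriveE _ df) derive_sum_delta //.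
apply: eq_bigr => i _; rewrite mulrC; congr (_ * _).
rewrite -deriveE // derive_mx; last exact: diff_derivable.
by rewrite mxE.
Qed.

Lemma smoothV_comp (A : set 'rV[R]_n) (B : set 'rV[R]_p) (f : 'rV[R]_p -> R^o)
    (g : 'rV[R]_n -> 'rV[R]_p) : open A -> open B ->
  (forall x, A x -> B (g x)) -> smoothV B f ->
  (forall i, smoothV A (fun x => g x 0 i)) -> smoothV A (f \o g).
Proof.
move=> oA oB gAB sf sg m; elim: m f sf => [|m IH] f sf.
  move=> x Ax; apply: continuous_comp; last exact: smoothV_continuous sf (gAB _ Ax).
  apply: differentiable_continuous; apply: differentiable_row => i.
  exact: smoothV_differentiable (sg i) Ax.
have dg i x : A x -> differentiable (fun y => g y 0 i : R^o) x.
  by move=> Ax; exact: smoothV_differentiable (sg i) Ax.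
split=> [x Ax|v].
  apply: differentiable_comp; first by apply: differentiable_row => i; exact: dg.
  exact: smoothV_differentiable sf (gAB _ Ax).
have H (r : seq 'I_p) : differentiable_upto m A
    (fun x => \sum_(i <- r) 'D_(delta_mx 0 i) f (g x) *
                            'D_v (fun y => g y 0 i : R^o) x).
  elim: r => [|i r IHr].
    by apply: (differentiable_upto_ext oA _ (differentiable_upto_cst m A 0)) => x _;
      rewrite big_nil.
  have := differentiable_uptoD oA (differentiable_uptoM oA
    (IH _ (smoothV_derive (delta_mx 0 i) sf)) (smoothV_derive v (sg i) m)) IHr.
  by apply: differentiable_upto_ext => // x _; rewrite big_cons.
apply: (differentiable_upto_ext oA _ (H _)) => x Ax; apply: esym.
by apply: derive_comp_row => [|i]; [exact: smoothV_differentiable sf (gAB _ Ax)|exact: dg].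
Qed.

End Composition.

Section Curves.
Context {R : realType} {n : nat}.

Lemma is_derive_curve (f : 'rV[R]_n -> R^o) (g : R -> 'rV[R]_n)
    (dg : 'I_n -> R) (t : R) : differentiable f (g t) ->
  (forall i, is_derive (t : R^o) 1 (fun s : R^o => g s 0 i : R^o) (dg i)) ->
  is_derive (t : R^o) 1 (fun s : R^o => f (g s) : R^o)
    (\sum_i dg i * 'D_(delta_mx 0 i) f (g t)).
Proof.
move=> df Dg.
have dgt : derivable (g : R^o -> 'rV[R]_n) t 1.
  by apply/derivable_mxP => i j; rewrite ord1; have [] := Dg j.
have dg1 : differentiable (g : R^o -> 'rV[R]_n) t by apply/derivable1_diffP.
have dfg := differentiable_comp dg1 df.
split; first exact: diff_derivable.
rewrite -[LHS]/('D_1 (f \o g) (t : R^o)) deriveE // diff_comp //=.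
rewrite -(deriveE _ df) derive_sum_delta //; apply: eq_bigr => i _.
by congr (_ * _); rewrite -deriveE // derive_mx // mxE; have [_ ->] := Dg i.
Qed.

Lemma is_derive_line (f : 'rV[R]_n -> R^o) (x v : 'rV[R]_n) (t : R) :
  differentiable f (x + t *: v) ->
  is_derive (t : R^o) 1 (fun s : R^o => f (x + s *: v) : R^o)
    ('D_v f (x + t *: v)).
Proof.
move=> df; rewrite derive_sum_delta //.
apply: (@is_derive_curve f (fun s => x + s *: v)) => // i.
have -> : (fun s : R^o => (x + s *: v) 0 i : R^o) =
  cst (x 0 i) + (v 0 i) \*: (id : R^o -> R^o).
  by apply/funext => s; rewrite !fctE !mxE mulrC.
by apply: is_derive_eq; rewrite add0r -[LHS]/(v 0 i * 1) mulr1.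
Qed.

(** The mean value theorem on the segment from x to y, which lies in K. *)
Lemma smoothV_lipschitz (A K : set 'rV[R]_n) (f : 'rV[R]_n -> R^o) (b : R) :
  smoothV A f -> K `<=` A ->
  (forall x y (t : R), K x -> K y -> 0 <= t <= 1 -> K (x + t *: (y - x))) ->
  (forall x i, K x -> `|'D_(delta_mx 0 i) f x| <= b) ->
  forall x y, K x -> K y -> `|f y - f x| <= n%:R * b * `|y - x|.
Proof.
move=> sf KA cK fb x y Kx Ky.
pose g (t : R) : R := f (x + t *: (y - x)).
have Dg t : 0 <= t <= 1 ->
    is_derive (t : R) 1 g ('D_(y - x) f (x + t *: (y - x))).
  move=> t01; apply: is_derive_line; apply: smoothV_differentiable sf _.
  by apply: KA; exact: cK.
have [t||t t01] := @MVT R g (fun t => 'D_(y - x) f (x + t *: (y - x))) 0 1 ltr01.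
- by rewrite in_itv /= => /andP[t0 t1]; apply: Dg; rewrite !ltW.
- apply: continuous_in_subspaceT => t; rewrite inE /= in_itv /= => t01.
  apply: differentiable_continuous; apply/derivable1_diffP.
  by have [] := Dg _ t01.
rewrite /g scale0r scale1r addr0 subrKC subr0 mulr1 => ->.
have t01' : 0 <= t <= 1 by move: t01; rewrite in_itv /= => /andP[? ?]; rewrite !ltW.
have Kz := cK _ _ _ Kx Ky t01'.
rewrite derive_sum_delta; last by apply: smoothV_differentiable sf _; exact: KA.
rewrite (le_trans (ler_norm_sum _ _ _)) //.
apply: (@le_trans _ _ (\sum_(i < n) b * `|y - x|)); last first.
  by rewrite sumr_const card_ord -[leLHS]mulr_natl mulrA.
apply: ler_sum => i _; rewrite normrM mulrC ler_pM //; first exact: fb.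
by rewrite [leRHS]/Num.Def.normr /= mx_normrE (le_bigmax _ _ (0, i)).
Qed.

End Curves.

Lemma dist_half_le (R : realType) (e a b c : R) :
  `|a - c| < e / 2 -> `|b - c| < e / 2 -> `|a - b| <= e.
Proof.
move=> ac bc; rewrite -(subrKA c) (le_trans (ler_normD _ _)) //.
by rewrite (splitr e) lerD // ltW // distrC.
Qed.

Section Clairaut.
Context {R : realType} {n : nat}.
Variables (A : set 'rV[R]_n) (f : 'rV[R]_n -> R^o).
Hypotheses (oA : open A) (sf : smoothV A f).

(** Two applications of the mean value theorem, first along u to the difference
    of f in the direction v, then along v to the derivative along u. *)
Lemma second_difference (x u v : 'rV[R]_n) (s t : R) : 0 < s -> 0 < t ->
  (forall a b, 0 <= a <= s -> 0 <= b <= t -> A (x + a *: u + b *: v)) ->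
  exists a b, [/\ 0 <= a <= s, 0 <= b <= t &
    f (x + s *: u + t *: v) - f (x + s *: u) - f (x + t *: v) + f x =
    s * t * 'D_v ('D_u f) (x + a *: u + b *: v)].
Proof.
move=> s0 t0 AP.
pose g (a : R) : R := f ((x + t *: v) + a *: u) - f (x + a *: u).
pose dg (a : R) : R := 'D_u f ((x + t *: v) + a *: u) - 'D_u f (x + a *: u).
have Ax a : 0 <= a <= s -> A (x + a *: u).
  by move=> aP; rewrite -[_ + _]addr0 -[0](scale0r v); apply: AP => //; rewrite lexx ltW.
have Ay a : 0 <= a <= s -> A (x + t *: v + a *: u).
  by move=> aP; rewrite addrAC; apply: AP => //; rewrite lexx ltW.
have Dg a : 0 <= a <= s -> is_derive (a : R) 1 g (dg a).
  move=> aP; apply: is_deriveB; apply: is_derive_line;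
    apply: smoothV_differentiable sf _; [exact: Ay|exact: Ax].
have [a||a] := @MVT R g dg 0 s s0.
- by rewrite in_itv /= => /andP[a0 a1]; apply: Dg; rewrite !ltW.
- apply: continuous_in_subspaceT => a; rewrite inE /= in_itv /= => aP.
  by apply: differentiable_continuous; apply/derivable1_diffP; have [] := Dg _ aP.
rewrite in_itv /= => /andP[a0 a1] E1.
have aP : 0 <= a <= s by rewrite !ltW.
pose h (b : R) : R := 'D_u f ((x + a *: u) + b *: v).
have Dh b : 0 <= b <= t ->
    is_derive (b : R) 1 h ('D_v ('D_u f) ((x + a *: u) + b *: v)).
  move=> bP; apply: is_derive_line.
  by apply: smoothV_differentiable (smoothV_derive u sf) _; exact: AP.
have [b||b] := @MVT R h (fun b => 'D_v ('D_u f) ((x + a *: u) + b *: v)) 0 t t0.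
- by rewrite in_itv /= => /andP[b0 b1]; apply: Dh; rewrite !ltW.
- apply: continuous_in_subspaceT => b; rewrite inE /= in_itv /= => bP.
  by apply: differentiable_continuous; apply/derivable1_diffP; have [] := Dh _ bP.
rewrite in_itv /= => /andP[b0 b1] E2.
exists a, b; split; rewrite ?ltW //.
move: E1; rewrite /g scale0r !addr0 subr0 => E1.
move: E2; rewrite /h scale0r addr0 subr0 => E2.
rewrite [s * t]mulrC -mulrA [s * _]mulrC mulrA mulrC [t * _]mulrC -E2.
move: E1; rewrite /dg [x + t *: v + a *: u]addrAC [_ * s]mulrC => <-.
rewrite [x + t *: v + s *: u]addrAC; ring.
Qed.

(** The second difference of f over the parallelogram spanned by s u and s v is
    symmetric in u and v, and equals s^2 times either mixed derivative at some
    point of it. The parallelogram shrinks to x, and both are continuous. *)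
Lemma derive_commute (x u v : 'rV[R]_n) : A x ->
  'D_u ('D_v f) x = 'D_v ('D_u f) x.
Proof.
move=> Ax; apply/eqP; rewrite -subr_eq0 -normr_le0; apply/ler_addgt0Pr => e e0.
rewrite add0r.
have e20 : 0 < e / 2 by rewrite divr_gt0.
have near2 (F G : 'rV[R]_n -> R^o) :
    {for x, continuous F} -> {for x, continuous G} ->
    exists2 d : R, 0 < d & forall y, ball x d y ->
      [/\ A y, `|F x - F y| < e / 2 & `|G x - G y| < e / 2].
  move=> cF cG.
  suff /nbhs_ballP[d d0 dP] : \forall y \near x,
    [/\ A y, `|F x - F y| < e / 2 & `|G x - G y| < e / 2] by exists d.
  have N1 : \forall y \near x, A y by apply: open_nbhs_nbhs.
  have N2 : \forall y \near x, `|F x - F y| < e / 2.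
    by move/cvgrPdist_lt: cF => /(_ _ e20).
  have N3 : \forall y \near x, `|G x - G y| < e / 2.
    by move/cvgrPdist_lt: cG => /(_ _ e20).
  by near=> y; split; near: y.
have c1 := smoothV_continuous (smoothV_derive u (smoothV_derive v sf)) Ax.
have c2 := smoothV_continuous (smoothV_derive v (smoothV_derive u sf)) Ax.

have [d d0 dP] := near2 _ _ c1 c2.
pose s := d / (`|u| + `|v| + 1).
have c0 : 0 < `|u| + `|v| + 1 by rewrite ltr_wpDl // addr_ge0.
have s0 : 0 < s by rewrite divr_gt0.
have inball a b : 0 <= a <= s -> 0 <= b <= s -> ball x d (x + a *: u + b *: v).
  move=> /andP[a0 a1] /andP[b0 b1].
  rewrite -ball_normE /= -addrA opprD addNKr normrN.
  apply: (@le_lt_trans _ _ (s * (`|u| + `|v|))).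
    rewrite (le_trans (ler_normD _ _)) // mulrDr !normrZ (ger0_norm a0) (ger0_norm b0).
    by apply: lerD; apply: ler_wpM2r.
  by rewrite /s mulrAC ltr_pdivrMr // ltr_pM2l // ltrDl.
have [|a [b [aP bP E1]]] := @second_difference x u v s s s0 s0.
  by move=> a b aP bP; have [] := dP _ (inball _ _ aP bP).
have [|b' [a' [bP' aP' E2]]] := @second_difference x v u s s s0 s0.
  move=> a' b' aP' bP'; rewrite addrAC.
  by have [] := dP _ (inball _ _ bP' aP').
have E : 'D_v ('D_u f) (x + a *: u + b *: v) = 'D_u ('D_v f) (x + a' *: u + b' *: v).
  have K (P Q y1 y2 y3 y4 : R) : y1 - y2 - y3 + y4 = s * s * P ->
      y1 - y3 - y2 + y4 = s * s * Q -> P = Q.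
    move=> EP EQ; have ss0 : s * s != 0 by rewrite mulf_neq0 // gt_eqF.
    by apply: (mulfI ss0); rewrite -EP -EQ; ring.
  rewrite [x + s *: v + _]addrAC [x + b' *: v + _]addrAC in E2.
  exact: K E1 E2.
have [_ _ H1] := dP _ (inball _ _ aP bP).
have [_ H2 _] := dP _ (inball _ _ aP' bP').
rewrite -E in H2; exact: dist_half_le H2 H1.
Unshelve. all: by end_near. Qed.

End Clairaut.

(** * Smooth functions on a manifold *)

Lemma near_openP (T : topologicalType) (P : T -> Prop) (x : T) :
  (\near x, P x) -> exists V : set T, [/\ open V, V x & forall y, V y -> P y].
Proof.
change (nbhs x P -> exists V : set T, [/\ open V, V x & forall y, V y -> P y]).
by rewrite nbhsE => -[V [oV Vx] VP]; exists V.
Qed.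

Section ManifoldCalculus.
Context {R : realType} {n : nat} {M : manifold R n}.
Implicit Types (q p : M) (U V : set M) (f g : M -> R) (c : @chart R n M).
Local Notation coordf c i := (fun r : M => chart_map c r 0 i).

Lemma tvec_sumE (I : Type) (r : seq I) (P : pred I) (F : I -> tvec M) f :
  (\sum_(i <- r | P i) F i) f = \sum_(i <- r | P i) (F i f : R).
Proof. by apply: (big_morph (fun v : tvec M => v f : R)). Qed.

Lemma tvec_combE (I : Type) (r : seq I) (P : pred I) (a : I -> R)
    (F : I -> tvec M) f :
  (\sum_(i <- r | P i) a i *: F i) f = \sum_(i <- r | P i) a i * (F i f : R).
Proof. by rewrite tvec_sumE. Qed.

Lemma chart_open c : atlas c -> open (dom c).
Proof. by move=> /atlas_chart[]. Qed.

Lemma chartK c q : atlas c -> dom c q -> param c (chart_map c q) = q.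
Proof. by move=> /atlas_chart[_ _ K _ _] cq; apply: K; rewrite inE. Qed.

Lemma chart_continuous c q : atlas c -> dom c q ->
  {for q, continuous (chart_map c)}.
Proof. by move=> /atlas_chart[_ _ _ K _]; exact: K. Qed.

Lemma param_continuous c q : atlas c -> dom c q ->
  {for chart_map c q, continuous (param c)}.
Proof. by move=> /atlas_chart[_ _ _ _ K]; exact: K. Qed.

Lemma chart_image_open c U : atlas c -> open U ->
  open (chart_map c @` (dom c `&` U)).
Proof.
move=> Ac oU; rewrite openE => _ [q [cq Uq] <-].
have [_ oI _ _ _] := atlas_chart Ac.
have N1 : \forall y \near chart_map c q, (chart_map c @` dom c) y.
  by apply: open_nbhs_nbhs; split => //; exists q.
have N2 : \forall y \near chart_map c q, U (param c y).
  have := param_continuous Ac cq; apply.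
  by rewrite chartK //; exact: open_nbhs_nbhs.
rewrite /interior; near=> y.
have [r cr yE] : (chart_map c @` dom c) y by near: y.
exists r => //; split => //.
have : U (param c y) by near: y.
by rewrite -yE chartK.
Unshelve. all: by end_near. Qed.

Lemma chart_preimage_open c (W : set 'rV[R]_n) : atlas c -> open W ->
  open (dom c `&` chart_map c @^-1` W).
Proof.
move=> Ac oW; rewrite openE => q [cq Wq]; rewrite /interior.
have N1 : \near q, dom c q by apply: open_nbhs_nbhs; split => //; exact: chart_open.
have N2 : \near q, W (chart_map c q).
  by have := chart_continuous Ac cq; apply; exact: open_nbhs_nbhs.
by near=> r; split; near: r.
Unshelve. all: by end_near. Qed.

(** The iterated derivatives of f do not depend on A; they are only evaluated
    at its points. *)
Lemma smoothV_pointwise (A : set 'rV[R]_n) (f : 'rV[R]_n -> R^o) :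
  (forall x, A x -> smoothV [set x] f) -> smoothV A f.
Proof.
move=> sf m; elim: m f sf => [|m IH] f sf /=; first by move=> x Ax; exact: (sf _ Ax 0%N).
split=> [x Ax|v]; first by have [+ _] := sf _ Ax 1%N; exact.
by apply: IH => x Ax m'; have [_ +] := sf _ Ax m'.+1; exact.
Qed.

Lemma smooth_on_at U f q : open U -> U q -> smooth_on U f -> smooth_at q f.
Proof. by move=> oU Uq sf; exists U. Qed.

Lemma smooth_onP U f : (forall q, U q -> smooth_at q f) -> smooth_on U f.
Proof.
move=> sf c Ac; apply: smoothV_pointwise => _ [q [cq Uq] <-].
have [V [oV Vq] sV] := sf _ Uq; apply: smoothV_subset (sV _ Ac).
by move=> _ ->; exists q.
Qed.

Lemma smooth_on_subset U V f : V `<=` U -> smooth_on U f -> smooth_on V f.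
Proof.
move=> VU sf c Ac; apply: smoothV_subset (sf _ Ac) => _ [q [cq Vq] <-].
by exists q => //; split => //; exact: VU.
Qed.

Lemma smooth_at_near q f : smooth_at q f -> \near q, smooth_at q f.
Proof.
move=> [U [oU Uq] sf]; near=> p; exists U => //; split => //; near: p.
exact: open_nbhs_nbhs.
Unshelve. all: by end_near. Qed.

(** Changes of charts are smooth, so one chart is enough. *)
Lemma smooth_at_chart c q f (W : set 'rV[R]_n) : atlas c -> dom c q ->
  open W -> W (chart_map c q) -> smoothV W (f \o param c) -> smooth_at q f.
Proof.
move=> Ac cq oW Wq sf.
have oU := chart_preimage_open Ac oW.
exists (dom c `&` chart_map c @^-1` W) => // c' Ac'.
have oA := chart_image_open Ac' oU.
have tr := atlas_compatible Ac' Ac.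
apply: (@smoothV_ext _ _ _ ((f \o param c) \o transition c' c)) => //.
  move=> _ [r [c'r [cr Wr]] <-].
  by rewrite /transition /= (chartK Ac' c'r) chartK.
apply: smoothV_comp oA oW _ sf _ => [|i].
  by move=> _ [r [c'r [cr Wr]] <-]; rewrite /transition /= chartK.
have [st _] := tr i; apply: smoothV_subset st => _ [r [c'r [cr Wr]] <-].
by exists r.
Qed.

Lemma smooth_atE c q f : atlas c -> dom c q -> smooth_at q f ->
  exists W, [/\ open W, W (chart_map c q), W `<=` chart_map c @` dom c &
    smoothV W (f \o param c)].
Proof.
move=> Ac cq [U [oU Uq] sf]; exists (chart_map c @` (dom c `&` U)); split.
- exact: chart_image_open.
- by exists q.
- by move=> _ [r [cr _] <-]; exists r.
- exact: sf.
Qed.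

Lemma smooth_at_ext q f g : (\near q, f q = g q) -> smooth_at q f -> smooth_at q g.
Proof.
move=> fg [U [oU Uq] sf].
have [V [oV Vq VP]] := near_openP fg.
have oUV : open (U `&` V) by exact: openI.
exists (U `&` V) => // c Ac.
apply: (@smoothV_ext _ _ _ (f \o param c)); first exact: chart_image_open.
  by move=> _ [r [cr [Ur Vr]] <-] /=; rewrite chartK //; exact: VP.
apply: smoothV_subset (sf _ Ac) => _ [r [cr [Ur Vr]] <-].
by exists r.
Qed.

(** Closure properties of smooth functions on open sets of R^n pass to germs of
    smooth functions on M, through one chart. *)
Lemma smooth_at_lift1 (op : R -> R) (P : set R) q f :
  (forall W (h : 'rV[R]_n -> R^o), open W -> (forall x, W x -> P (h x)) ->
     smoothV W h -> smoothV W (op \o h)) ->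
  (\near q, P (f q)) -> smooth_at q f -> smooth_at q (op \o f).
Proof.
move=> oph Pf sf; have [c Ac cq] := atlas_cover q.
have [V [oV Vq VP]] := near_openP Pf.
have [W [oW Wq Wd sW]] := smooth_atE Ac cq sf.
have oI := chart_image_open Ac oV.
apply: (@smooth_at_chart c q _ (W `&` chart_map c @` (dom c `&` V))) => //.
- exact: openI.
- by split => //; exists q.
apply: oph; first exact: openI.
  by move=> _ [_ [r [cr Vr] <-]] /=; rewrite chartK //; exact: VP.
by apply: smoothV_subset sW => x [].
Qed.

Lemma smooth_at_lift2 (op : R -> R -> R) q f g :
  (forall W (h k : 'rV[R]_n -> R^o), open W -> smoothV W h -> smoothV W k ->
     smoothV W (fun x => op (h x) (k x))) ->
  smooth_at q f -> smooth_at q g -> smooth_at q (fun r => op (f r) (g r)).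
Proof.
move=> oph sf sg; have [c Ac cq] := atlas_cover q.
have [W [oW Wq Wd sW]] := smooth_atE Ac cq sf.
have [W' [oW' Wq' Wd' sW']] := smooth_atE Ac cq sg.
apply: (@smooth_at_chart c q _ (W `&` W')) => //; first exact: openI.
apply: (oph _ (f \o param c) (g \o param c)); first exact: openI.
  by apply: smoothV_subset sW => x [].
by apply: smoothV_subset sW' => x [].
Qed.

Lemma smooth_at_cst q (a : R) : smooth_at q (fun=> a : R).
Proof.
have [c Ac cq] := atlas_cover q.
by apply: (@smooth_at_chart c q _ setT) => //;
  [exact: openT|exact: smoothV_cst].
Qed.

Lemma smooth_atD q f g : smooth_at q f -> smooth_at q g ->
  smooth_at q (fun r => f r + g r).
Proof. by apply: smooth_at_lift2 => W h k; exact: smoothVD. Qed.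

Lemma smooth_atM q f g : smooth_at q f -> smooth_at q g ->
  smooth_at q (fun r => f r * g r).
Proof. by apply: smooth_at_lift2 => W h k; exact: smoothVM. Qed.

Lemma smooth_atN q f : smooth_at q f -> smooth_at q (fun r => - f r).
Proof.
move=> sf; have := smooth_atM (smooth_at_cst q (- 1)) sf.
by apply: smooth_at_ext; near=> r; rewrite mulN1r.
Unshelve. all: by end_near. Qed.

Lemma smooth_atB q f g : smooth_at q f -> smooth_at q g ->
  smooth_at q (fun r => f r - g r).
Proof. by move=> sf sg; apply: smooth_atD => //; exact: smooth_atN. Qed.

Lemma smooth_at_sum q (I : Type) (r : seq I) (P : pred I) (F : I -> M -> R) :
  (forall i, P i -> smooth_at q (F i)) ->
  smooth_at q (fun x => \sum_(i <- r | P i) F i x).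
Proof.
move=> sF; elim: r => [|i r IH].
  by apply: smooth_at_ext (smooth_at_cst q 0); near=> x; rewrite big_nil.
case Pi: (P i).
  by apply: smooth_at_ext (smooth_atD (sF _ Pi) IH); near=> x; rewrite big_cons Pi.
by apply: smooth_at_ext IH; near=> x; rewrite big_cons Pi.
Unshelve. all: by end_near. Qed.

Lemma smooth_at_prod q (I : Type) (r : seq I) (P : pred I) (F : I -> M -> R) :
  (forall i, P i -> smooth_at q (F i)) ->
  smooth_at q (fun x => \prod_(i <- r | P i) F i x).
Proof.
move=> sF; elim: r => [|i r IH].
  by apply: smooth_at_ext (smooth_at_cst q 1); near=> x; rewrite big_nil.
case Pi: (P i).
  by apply: smooth_at_ext (smooth_atM (sF _ Pi) IH); near=> x; rewrite big_cons Pi.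
by apply: smooth_at_ext IH; near=> x; rewrite big_cons Pi.
Unshelve. all: by end_near. Qed.

Lemma smooth_at_continuous q f : smooth_at q f -> {for q, continuous f}.
Proof.
move=> sf; have [c Ac cq] := atlas_cover q.
have [W [oW Wq Wd sW]] := smooth_atE Ac cq sf.
have C : {for q, continuous ((f \o param c) \o chart_map c)}.
  apply: continuous_comp; first exact: chart_continuous.
  exact: smoothV_continuous sW Wq.
have E : ((f \o param c) \o chart_map c) q = f q by rewrite /= chartK.
have C' : ((f \o param c) \o chart_map c) @ q --> f q by rewrite -E.
apply: cvg_trans C'.
apply: (@near_eq_cvg _ _ (nbhs q)).
near=> r => /=; rewrite chartK //; near: r.
by apply: open_nbhs_nbhs; split => //; exact: chart_open.
Unshelve. all: by end_near. Qed.

Lemma smooth_at_neq0 q f : smooth_at q f -> f q != 0 -> \near q, f q != 0.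
Proof.
move=> /smooth_at_continuous cf fq.
have : nbhs (f q) [set x | x != 0].
  by apply: open_nbhs_nbhs; split => //; exact: open_neq.
by move=> /cf.
Qed.

Lemma smooth_atV q f : smooth_at q f -> f q != 0 ->
  smooth_at q (fun r => (f r)^-1).
Proof.
move=> sf fq; apply: (@smooth_at_lift1 GRing.inv [set x | x != 0]) => //.
  by move=> W h oW h0 sh; exact: smoothVV.
exact: smooth_at_neq0.
Qed.

Lemma smooth_at_ln_norm q f : smooth_at q f -> f q != 0 ->
  smooth_at q (fun r => ln `|f r|).
Proof.
move=> sf fq; apply: (@smooth_at_lift1 (fun y => ln `|y|) [set x | x != 0]) => //.
  by move=> W h oW h0 sh; exact: smoothV_ln_norm.
exact: smooth_at_neq0.
Qed.

Lemma smooth_at_sqrt q f : smooth_at q f -> 0 < f q ->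
  smooth_at q (fun r => Num.sqrt (f r)).
Proof.
move=> sf fq; apply: (@smooth_at_lift1 Num.sqrt [set x | 0 < x]) => //.
  by move=> W h oW h0 sh; exact: smoothV_sqrt.
have /smooth_at_continuous cf := sf.
have : nbhs (f q) [set x | 0 < x].
  by apply: open_nbhs_nbhs; split => //; exact: open_gt.
by move=> /cf.
Qed.

Lemma smooth_at_coord c q i : atlas c -> dom c q -> smooth_at q (coordf c i).
Proof.
move=> Ac cq; have [_ oI _ _ _] := atlas_chart Ac.
have Wq : (chart_map c @` dom c) (chart_map c q) by exists q.
apply: (smooth_at_chart Ac cq oI Wq).
apply: (@smoothV_ext _ _ _ (fun x => x 0 i)) => //; last exact: smoothV_coord.
by move=> _ [r cr <-] /=; rewrite chartK.
Qed.

End ManifoldCalculus.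

(** * Tangent vectors and vector fields *)

Section TangentVectors.
Context {R : realType} {n : nat} {M : manifold R n}.
Implicit Types (q p : M) (U V : set M) (f g : M -> R) (c : @chart R n M)
  (v : tvec M) (X Y : M -> tvec M).
Local Notation coordf c i := (fun r : M => chart_map c r 0 i).

Lemma coord_vecE c i q f : smooth_at q f ->
  coord_vec c i q f = 'D_(delta_mx 0 i) (f \o param c : _ -> R^o) (chart_map c q).
Proof. by move=> sf; rewrite /coord_vec; case: asboolP. Qed.

Lemma coord_vec_nonsmooth c i q f : ~ smooth_at q f -> coord_vec c i q f = 0.
Proof. by move=> sf; rewrite /coord_vec; case: asboolP. Qed.

Lemma tangent_nonsmooth q v f : tangent q v -> ~ smooth_at q f -> v f = 0.
Proof.
move=> [c [Ac cq [a ->]]] sf; rewrite tvec_combE big1 // => i _.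
by rewrite coord_vec_nonsmooth // mulr0.
Qed.

Lemma smooth_at_differentiable c q f : atlas c -> dom c q -> smooth_at q f ->
  differentiable (f \o param c : 'rV[R]_n -> R^o) (chart_map c q).
Proof.
by move=> Ac cq /(smooth_atE Ac cq)[W [oW Wq _ sW]]; exact: smoothV_differentiable sW Wq.
Qed.

Lemma near_chart c q (P : M -> Prop) : atlas c -> dom c q -> (\near q, P q) ->
  \forall y \near chart_map c q, P (param c y) /\
    exists2 r, dom c r & y = chart_map c r.
Proof.
move=> Ac cq /near_openP[V [oV Vq VP]].
have : \forall y \near chart_map c q, (chart_map c @` (dom c `&` V)) y.
  by apply: open_nbhs_nbhs; split; [exact: chart_image_open|exists q].
apply: filterS => _ [r [cr Vr] <-]; split; last by exists r.
by rewrite chartK //; exact: VP.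
Qed.

(** The chain rule through the transition map; where f is not smooth, both sides
    vanish by the convention on tangent vectors. *)
Lemma coord_vec_change c c' i q f : atlas c -> dom c q -> atlas c' -> dom c' q ->
  coord_vec c' i q f = \sum_j coord_vec c' i q (coordf c j) * coord_vec c j q f.
Proof.
move=> Ac cq Ac' cq'; have [sf|sf] := pselect (smooth_at q f); last first.
  rewrite coord_vec_nonsmooth // big1 // => j _.
  by rewrite (coord_vec_nonsmooth c j sf) mulr0.
have sc j : smooth_at q (coordf c j) by exact: smooth_at_coord.
pose g : 'rV[R]_n -> 'rV[R]_n := chart_map c \o param c'.
have gq : g (chart_map c' q) = chart_map c q by rewrite /g /= chartK.
have -> : coord_vec c' i q f = 'D_(delta_mx 0 i) ((f \o param c : _ -> R^o) \o g) (chart_map c' q).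
  rewrite coord_vecE //; apply: near_eq_derive.
  have N : \near q, dom c q by apply: open_nbhs_nbhs; split => //; exact: chart_open.
  by have := near_chart Ac' cq' N; apply: filterS => y [cy _]; rewrite /g /= chartK.
rewrite derive_comp_row; first last.
- move=> j; exact: smooth_at_differentiable Ac' cq' (sc j).
- by rewrite gq; exact: smooth_at_differentiable.
by apply: eq_bigr => j _; rewrite mulrC gq !coord_vecE.
Qed.

Lemma tangent_coord c q v : atlas c -> dom c q -> tangent q v ->
  v = \sum_i (v (coordf c i) : R) *: coord_vec c i q.
Proof.
move=> Ac cq [c' [Ac' cq' [a ->]]]; apply/funext => f.
rewrite tvec_combE [RHS]tvec_combE.
under eq_bigr do rewrite (coord_vec_change _ _ Ac cq Ac' cq') mulr_sumr.
rewrite exchange_big /=; apply: eq_bigr => j _.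
by rewrite tvec_combE mulr_suml; apply: eq_bigr => i _; rewrite mulrA.
Qed.

(** Any chart at q may serve, not only the one that shows v to be tangent. *)
Lemma tangentE c q v f : atlas c -> dom c q -> tangent q v -> smooth_at q f ->
  v f = 'D_(\row_i (v (coordf c i) : R)) (f \o param c : _ -> R^o) (chart_map c q).
Proof.
move=> Ac cq tv sf; rewrite derive_sum_delta; last exact: smooth_at_differentiable.
rewrite {1}(tangent_coord Ac cq tv) tvec_combE.
by apply: eq_bigr => i _; rewrite mxE coord_vecE.
Qed.

Lemma tangent_sumE c q v f : atlas c -> dom c q -> tangent q v ->
  v f = \sum_i (v (coordf c i) : R) * coord_vec c i q f.
Proof. by move=> Ac cq tv; rewrite {1}(tangent_coord Ac cq tv) tvec_combE. Qed.

Lemma tangent_ext_fun q v f g : tangent q v -> (\near q, f q = g q) -> v f = v g.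
Proof.
move=> tv fg; have gf : \near q, g q = f q by apply: filterS fg => r ->.
have [sf|sf] := pselect (smooth_at q f); last first.
  rewrite !(tangent_nonsmooth tv) // => sg; apply: sf; exact: smooth_at_ext gf sg.
have sg := smooth_at_ext fg sf; have [c Ac cq] := atlas_cover q.
rewrite !(tangentE Ac cq tv) //; apply: near_eq_derive.
by have := near_chart Ac cq fg; apply: filterS => y [].
Qed.

Lemma tangent_derivable q v f c w : atlas c -> dom c q -> smooth_at q f ->
  derivable (f \o param c : 'rV[R]_n -> R^o) (chart_map c q) w.
Proof.
by move=> Ac cq sf; apply: diff_derivable; exact: smooth_at_differentiable.
Qed.

Lemma tangentD q v f g : tangent q v -> smooth_at q f -> smooth_at q g ->
  v (fun r => f r + g r) = v f + v g.
Proof.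
move=> tv sf sg; have [c Ac cq] := atlas_cover q.
rewrite !(tangentE Ac cq tv) //; last exact: smooth_atD.
by rewrite -deriveD //; exact: tangent_derivable.
Qed.

Lemma tangentM q v f g : tangent q v -> smooth_at q f -> smooth_at q g ->
  v (fun r => f r * g r) = f q * v g + g q * v f.
Proof.
move=> tv sf sg; have [c Ac cq] := atlas_cover q.
rewrite !(tangentE Ac cq tv) //; last exact: smooth_atM.
rewrite -[LHS]/('D_ _ ((f \o param c : _ -> R) * (g \o param c)) _).
rewrite deriveM; [|exact: tangent_derivable|exact: tangent_derivable].
by rewrite /= chartK.
Qed.

Lemma tangent_cst q v (a : R) : tangent q v -> v (fun=> a) = 0.
Proof.
move=> tv; have [c Ac cq] := atlas_cover q.
by rewrite (tangentE Ac cq tv) ?derive_cst //; exact: smooth_at_cst.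
Qed.

Lemma tangentZ q v f (a : R) : tangent q v -> smooth_at q f ->
  v (fun r => a * f r) = a * v f.
Proof.
move=> tv sf; rewrite (tangentM tv (smooth_at_cst q a) sf) (tangent_cst a tv).
by rewrite mulr0 addr0.
Qed.

Lemma tangent_big_sum q v (I : Type) (r : seq I) (P : pred I) (F : I -> M -> R) :
  tangent q v -> (forall i, P i -> smooth_at q (F i)) ->
  v (fun x => \sum_(i <- r | P i) F i x) = \sum_(i <- r | P i) v (F i).
Proof.
move=> tv sF; elim: r => [|i r IH].
  rewrite big_nil -[RHS](tangent_cst 0 tv); congr (v _); apply/funext => x.
  by rewrite big_nil.
rewrite big_cons; case: ifP => Pi; rewrite -IH.
  rewrite -(tangentD tv (sF _ Pi) (smooth_at_sum _ sF)).
  by congr (v _); apply/funext => x; rewrite big_cons Pi.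
by congr (v _); apply/funext => x; rewrite big_cons Pi.
Qed.

Lemma tangent_prod q v (I : finType) (F : I -> M -> R) :
  tangent q v -> (forall i, smooth_at q (F i)) ->
  v (fun x => \prod_i F i x) = \sum_i (v (F i) : R) * \prod_(j | j != i) F j q.
Proof.
move=> tv sF.
suff H (r : seq I) : uniq r -> v (fun x => \prod_(i <- r) F i x) =
    \sum_(i <- r) (v (F i) : R) * \prod_(j <- r | j != i) F j q.
  by apply: H; exact: index_enum_uniq.
elim: r => [_|i r IH /= /andP[ir ur]].
  rewrite big_nil -[RHS](tangent_cst 1 tv); congr (v _); apply/funext => x.
  by rewrite big_nil.
have -> : (fun x => \prod_(j <- i :: r) F j x) =
    (fun x => F i x * \prod_(j <- r) F j x) by apply/funext => x; rewrite big_cons.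
rewrite (tangentM tv (sF i) (smooth_at_prod _ (fun j _ => sF j))).
rewrite IH // big_cons addrC big_cons eqxx /=; congr (_ + _).
  rewrite mulrC; congr (_ * _); rewrite big_seq_cond [RHS]big_seq_cond.
  apply: eq_bigl => j; case jr: (j \in r) => //=.
  by apply/esym; apply: contraNneq ir => <-.
rewrite mulr_sumr big_seq [RHS]big_seq; apply: eq_bigr => j jr.
rewrite big_cons ifT; first by rewrite mulrCA.
by apply: contraNneq ir => ->.
Qed.

Lemma tangent_ln_norm q v f : tangent q v -> smooth_at q f -> f q != 0 ->
  v (fun r => ln `|f r|) = v f / f q.
Proof.
move=> tv sf f0; have [c Ac cq] := atlas_cover q.
rewrite !(tangentE Ac cq tv) //; last exact: smooth_at_ln_norm.
rewrite -[LHS]/('D_ _ ((fun y => ln `|y|) \o (f \o param c)) _).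
have dln : is_derive ((f \o param c) (chart_map c q)) 1 (fun y => ln `|y|) (f q)^-1.
  by rewrite /= chartK //; exact: is_derive_ln_norm.
by rewrite (derive_comp1 _ (smooth_at_differentiable Ac cq sf) dln) mulrC.
Qed.

Lemma tangent_lin q (a : R) u v : tangent q u -> tangent q v ->
  tangent q (a *: u + v).
Proof.
move=> tu tv; have [c Ac cq] := atlas_cover q; exists c; split => //.
exists (\row_i (a * u (coordf c i) + v (coordf c i))).
rewrite {1}(tangent_coord Ac cq tu) {1}(tangent_coord Ac cq tv).
rewrite scaler_sumr -big_split /=; apply: eq_bigr => i _.
by rewrite mxE scalerDl scalerA.
Qed.

Lemma tangent0 q : tangent q 0.
Proof.
have [c Ac cq] := atlas_cover q; exists c; split => //; exists 0.
by rewrite big1 // => i _; rewrite mxE scale0r.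
Qed.

Lemma tangent_scale q (a : R) v : tangent q v -> tangent q (a *: v).
Proof. by move=> tv; rewrite -[_ *: _]addr0; apply: tangent_lin => //; exact: tangent0. Qed.

Lemma tangent_add q u v : tangent q u -> tangent q v -> tangent q (u + v).
Proof. by move=> tu tv; rewrite -[u]scale1r; exact: tangent_lin. Qed.

Lemma tangent_sum q (I : Type) (r : seq I) (P : pred I) (F : I -> tvec M) :
  (forall i, P i -> tangent q (F i)) -> tangent q (\sum_(i <- r | P i) F i).
Proof. by move=> tF; elim/big_ind: _ => //; [exact: tangent0|exact: tangent_add]. Qed.

Lemma tangent_coord_vec c i q : atlas c -> dom c q -> tangent q (coord_vec c i q).
Proof.
move=> Ac cq; exists c; split => //; exists (delta_mx 0 i).
rewrite (bigD1 i) //= mxE !eqxx scale1r big1 ?addr0 // => j ji.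
by rewrite mxE (negbTE ji) andbF scale0r.
Qed.

Lemma coord_vec_coord c i j q : atlas c -> dom c q ->
  coord_vec c i q (coordf c j) = (i == j)%:R.
Proof.
move=> Ac cq; rewrite coord_vecE; last exact: smooth_at_coord.
have -> : 'D_(delta_mx 0 i) (coordf c j \o param c : _ -> R^o) (chart_map c q) =
  'D_(delta_mx 0 i) (fun x : 'rV[R]_n => x 0 j : R^o) (chart_map c q).
  apply: near_eq_derive.
  have N : \near q, dom c q by apply: open_nbhs_nbhs; split => //; exact: chart_open.
  by have := near_chart Ac cq N; apply: filterS => y [_ [r cr ->]] /=; rewrite chartK.
by rewrite derive_coord mxE eqxx eq_sym.
Qed.

Lemma vector_field_tangent U X q : vector_field U X -> U q -> tangent q (X q).
Proof. by case=> tX _; exact: tX. Qed.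

Lemma vector_field_smooth U X q f : open U -> vector_field U X -> U q ->
  smooth_at q f -> smooth_at q (fun p => X p f).
Proof.
move=> oU [_ sX] Uq [V [oV Vq] sf].
have oI : open (V `&` U) by exact: openI.
apply: (@smooth_on_at _ _ _ (V `&` U)) => //; apply: sX => //.
by apply: smooth_on_subset sf => x [].
Qed.

Lemma vector_fieldP U X : (forall q, U q -> tangent q (X q)) ->
  (forall q f, U q -> smooth_at q f -> smooth_at q (fun p => X p f)) ->
  vector_field U X.
Proof.
move=> tX sX; split => // V f oV VU sf; apply: smooth_onP => q Vq.
by apply: sX; [exact: VU|exact: smooth_on_at Vq sf].
Qed.

Lemma vector_field_subset U V X : V `<=` U -> vector_field U X -> vector_field V X.
Proof.
move=> VU [tX sX]; split=> [q /VU /tX //|W f oW WV]; apply: sX => //.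
exact: subset_trans VU.
Qed.

Lemma vector_field_lin U (a : M -> R) X Y : open U ->
  (forall q, U q -> smooth_at q a) -> vector_field U X -> vector_field U Y ->
  vector_field U (fun q => a q *: X q + Y q).
Proof.
move=> oU sa vX vY; apply: vector_fieldP => [q Uq|q f Uq sf].
  by apply: tangent_lin; apply: vector_field_tangent Uq.
apply: smooth_atD; last exact: vector_field_smooth vY Uq sf.
by apply: smooth_atM; [exact: sa|exact: vector_field_smooth vX Uq sf].
Qed.

Lemma vector_field0 U : vector_field U (fun=> 0 : tvec M).
Proof.
apply: vector_fieldP => [q _|q f _ _]; first exact: tangent0.
exact: smooth_at_cst.
Qed.

Lemma vector_field_scale U (a : M -> R) X : open U ->
  (forall q, U q -> smooth_at q a) -> vector_field U X ->
  vector_field U (fun q => a q *: X q).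
Proof.
move=> oU sa vX; have := vector_field_lin oU sa vX (vector_field0 U).
by congr vector_field; apply/funext => q; rewrite addr0.
Qed.

Lemma vector_field_sum U (I : Type) (r : seq I) (P : pred I) (a : I -> M -> R)
    (X : I -> M -> tvec M) : open U ->
  (forall i q, P i -> U q -> smooth_at q (a i)) ->
  (forall i, P i -> vector_field U (X i)) ->
  vector_field U (fun q => \sum_(i <- r | P i) a i q *: X i q).
Proof.
move=> oU sa vX; elim: r => [|i r IH].
  rewrite (_ : (fun q => _) = fun=> 0); first exact: vector_field0.
  by apply/funext => q; rewrite big_nil.
case Pi: (P i).
  have := vector_field_lin oU (fun q => sa i q Pi) (vX _ Pi) IH.
  by congr vector_field; apply/funext => q; rewrite big_cons Pi.
by move: IH; congr vector_field; apply/funext => q; rewrite big_cons Pi.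
Qed.

Lemma bracketE X Y q f : smooth_at q f ->
  bracket X Y q f = X q (fun p => Y p f) - Y q (fun p => X p f).
Proof. by move=> sf; rewrite /bracket; case: asboolP. Qed.

Lemma coord_vec_field c i : atlas c -> vector_field (dom c) (coord_vec c i).
Proof.
move=> Ac; apply: vector_fieldP => [q cq|q f cq sf]; first exact: tangent_coord_vec.
have [W [oW Wq Wd sW]] := smooth_atE Ac cq sf.
apply: (@smooth_at_chart _ _ _ c q _ W) => //.
apply: (smoothV_ext oW _ (smoothV_derive (delta_mx 0 i) sW)) => x Wx.
have [r cr xr] := Wd _ Wx; rewrite /= -xr chartK // coord_vecE //.
by apply: (@smooth_at_chart _ _ _ c r _ W) => //; rewrite xr.
Qed.

Lemma near_coord_vecE c i q f : atlas c -> dom c q -> smooth_at q f ->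
  \forall y \near chart_map c q, coord_vec c i (param c y) f =
    'D_(delta_mx 0 i) (f \o param c : _ -> R^o) y.
Proof.
move=> Ac cq sf; have := near_chart Ac cq (smooth_at_near sf).
apply: filterS => y [sfy [r cr yr]]; rewrite coord_vecE //.
by rewrite yr chartK.
Qed.

(** Partial derivatives commute in the chart. *)
Lemma coord_vec_commute c i j q f : atlas c -> dom c q -> smooth_at q f ->
  coord_vec c i q (fun p => coord_vec c j p f) =
  coord_vec c j q (fun p => coord_vec c i p f).
Proof.
move=> Ac cq sf; have oc := chart_open Ac.
have sD l : smooth_at q (fun p => coord_vec c l p f).
  exact: vector_field_smooth (coord_vec_field l Ac) cq sf.
have E k l : coord_vec c k q (fun p => coord_vec c l p f) =
    'D_(delta_mx 0 k) ('D_(delta_mx 0 l) (f \o param c : _ -> R^o)) (chart_map c q).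
  by rewrite coord_vecE //; apply: near_eq_derive; exact: near_coord_vecE.
have [W [oW Wq Wd sW]] := smooth_atE Ac cq sf.
by rewrite !E; exact: derive_commute oW sW _ _ _ Wq.
Qed.

(** In the chart Y is sum_j (Y x_j) d_j, and X differentiates both the
    coefficients Y x_j and the derivatives d_j f. The first-order coefficients
    are therefore the values of X Y on the coordinates. *)
Lemma vector_field_second_order U c X Y q f : open U -> vector_field U X ->
  vector_field U Y -> U q -> atlas c -> dom c q -> smooth_at q f ->
  X q (fun p => Y p f) =
  \sum_i \sum_j (X q (coordf c i) : R) * (Y q (coordf c j) : R) *
     (coord_vec c i q (fun p => coord_vec c j p f) : R) +
  \sum_j (X q (fun p => Y p (coordf c j)) : R) * (coord_vec c j q f : R).
Proof.
move=> oU vX vY Uq Ac cq sf; have tX := vector_field_tangent vX Uq.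
have oc := chart_open Ac.
have sYc j : smooth_at q (fun p => Y p (coordf c j)).
  by apply: vector_field_smooth vY Uq _ => //; exact: smooth_at_coord.
have sD j : smooth_at q (fun p => coord_vec c j p f).
  exact: vector_field_smooth (coord_vec_field j Ac) cq sf.
have -> : X q (fun p => Y p f) =
    X q (fun p => \sum_j (Y p (coordf c j) : R) * (coord_vec c j p f : R)).
  apply: (tangent_ext_fun tX).
  have : \near q, (U `&` dom c) q by apply: open_nbhs_nbhs; split => //; exact: openI.
  by apply: filterS => r [Ur cr]; apply: tangent_sumE => //; exact: vector_field_tangent vY Ur.
rewrite (tangent_big_sum _ tX) => [|j _]; last exact: smooth_atM.
under eq_bigr => j _ do rewrite (tangentM tX (sYc j) (sD j)).
rewrite big_split /=; congr (_ + _); last by apply: eq_bigr => j _; rewrite mulrC.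
rewrite exchange_big /=; apply: eq_bigr => j _.
rewrite (tangent_sumE _ Ac cq tX) mulr_sumr; apply: eq_bigr => i _.
by rewrite mulrCA mulrA.
Qed.

(** The second-order parts of X Y and Y X coincide, because partial derivatives
    commute, so their difference is a first-order operator. *)
Lemma bracket_vector_field U X Y : open U -> vector_field U X ->
  vector_field U Y -> vector_field U (bracket X Y).
Proof.
move=> oU vX vY; apply: vector_fieldP => [q Uq|q f Uq sf]; last first.
  apply: (@smooth_at_ext _ _ _ _ (fun p => X p (fun p => Y p f) - Y p (fun p => X p f))).
    by have := smooth_at_near sf; apply: filterS => r sr; rewrite bracketE.
  have sX := vector_field_smooth oU vX Uq sf.
  have sY := vector_field_smooth oU vY Uq sf.
  by apply: smooth_atB; [exact: vector_field_smooth vX Uq sY|exact: vector_field_smooth vY Uq sX].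
have [c Ac cq] := atlas_cover q; exists c; split => //.
exists (\row_i (bracket X Y q (coordf c i) : R)); apply/funext => f.
rewrite tvec_combE; have [sf|sf] := pselect (smooth_at q f); last first.
  rewrite /bracket; case: asboolP => // _; rewrite big1 // => i _.
  by rewrite coord_vec_nonsmooth // mulr0.
rewrite bracketE //.
rewrite (vector_field_second_order oU vX vY Uq Ac cq sf).
rewrite (vector_field_second_order oU vY vX Uq Ac cq sf).
set S := (X in X + _ - _); set S' := (X in _ - (X + _)).
have -> : S' = S.
  rewrite /S' exchange_big; apply: eq_bigr => i _; apply: eq_bigr => j _.
  by rewrite coord_vec_commute // [Y _ _ * _]mulrC.
rewrite opprD addrACA subrr add0r -sumrB; apply: eq_bigr => i _.
by rewrite mxE bracketE ?mulrBl //; exact: smooth_at_coord.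
Qed.

End TangentVectors.

(** * Frames *)

Section Frames.
Context {R : realType} {n : nat} {M : manifold R n}.
Implicit Types (q p : M) (U V : set M) (f g : M -> R) (c : @chart R n M)
  (v : tvec M) (Y Z : M -> tvec M).
Local Notation coordf c i := (fun r : M => chart_map c r 0 i).

Lemma smooth_at_det q m (A : M -> 'M[R]_m) :
  (forall i j, smooth_at q (fun r => A r i j)) -> smooth_at q (fun r => \det (A r)).
Proof.
move=> sA; apply: smooth_at_sum => s _; apply: smooth_atM; first exact: smooth_at_cst.
by apply: smooth_at_prod => i _; exact: sA.
Qed.

Lemma smooth_at_invmx q m (A : M -> 'M[R]_m) i j :
  (forall i j, smooth_at q (fun r => A r i j)) -> A q \in unitmx ->
  smooth_at q (fun r => invmx (A r) i j).
Proof.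
move=> sA uA; have sd := smooth_at_det sA.
have d0 : \det (A q) != 0 by rewrite -unitfE -unitmxE.
apply: (@smooth_at_ext _ _ _ _ (fun r => (\det (A r))^-1 * cofactor (A r) j i)).
  have := smooth_at_neq0 sd d0; apply: filterS => r dr.
  by rewrite /invmx unitmxE unitfE dr !mxE.
apply: smooth_atM; first exact: smooth_atV.
apply: smooth_atM; first exact: smooth_at_cst.
apply: smooth_at_det => k l.
apply: smooth_at_ext (sA (lift j k) (lift i l)); near=> r.
by rewrite !mxE.
Unshelve. all: by end_near. Qed.

Section TangentFrame.
Variables (U : set M) (X : 'I_n -> M -> tvec M).
Hypotheses (oU : open U) (fX : is_frame predT U tangent X).

Lemma frame_field i : vector_field U (X i).
Proof. by have [vX _] := fX; exact: vX. Qed.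

Lemma frame_unit c q : atlas c -> dom c q -> U q ->
  (\matrix_(i, j) (X i q (coordf c j) : R)) \in unitmx.
Proof.
move=> Ac cq Uq; have [_ /(_ q Uq)[bX _]] := fX.
have /choice[b bP] i : exists a : 'I_n -> R, coord_vec c i q = \sum_l a l *: X l q.
  by apply/bX; exact: tangent_coord_vec.
have : (\matrix_(i, l) b i l) *m (\matrix_(i, j) (X i q (coordf c j) : R)) = 1%:M.
  apply/matrixP => i j; rewrite !mxE -(coord_vec_coord _ _ Ac cq) bP tvec_combE.
  by apply: eq_bigr => l _; rewrite !mxE.
by move=> /mulmx1_unit[].
Qed.

(** In a chart the coefficients solve a linear system whose matrix, that of the
    components of the frame, is smooth and invertible. *)
Lemma frame_coefficients Y : vector_field U Y -> exists a : 'I_n -> M -> R,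
  (forall q, U q -> Y q = \sum_l a l q *: X l q) /\
  (forall l q, U q -> smooth_at q (a l)).
Proof.
move=> vY.
have /choice[b bP] q : exists a : 'I_n -> R, U q -> Y q = \sum_l a l *: X l q.
  have [Uq|nUq] := pselect (U q); last by exists (fun=> 0).
  have [_ /(_ q Uq)[bX _]] := fX.
  by have [a aP] := (bX _).1 (vector_field_tangent vY Uq); exists a.
exists (fun l q => b q l); split=> // l q Uq.
have [c Ac cq] := atlas_cover q; have oc := chart_open Ac.
pose A r := \matrix_(i, j) (X i r (coordf c j) : R).
have sX i j : smooth_at q (fun r => A r i j).
  apply: (@smooth_at_ext _ _ _ _ (fun r => X i r (coordf c j))).
    by apply: nearW => r; rewrite mxE.
  by apply: vector_field_smooth (frame_field i) Uq _ => //; exact: smooth_at_coord.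
apply: (@smooth_at_ext _ _ _ _
    (fun r => \sum_j (Y r (coordf c j) : R) * invmx (A r) j l)).
  have : \near q, (U `&` dom c) q by apply: open_nbhs_nbhs; split => //; exact: openI.
  apply: filterS => r [Ur cr].
  have uA := frame_unit Ac cr Ur.
  have : (\row_j (Y r (coordf c j) : R)) = (\row_l b r l) *m A r.
    apply/rowP => j; rewrite !mxE {1}(bP r Ur) tvec_combE.
    by apply: eq_bigr => i _; rewrite !mxE.
  move=> /(congr1 (mulmx^~ (invmx (A r)))); rewrite mulmxK //.
  by move=> /rowP/(_ l); rewrite !mxE => <-; apply: eq_bigr => j _; rewrite !mxE.
apply: smooth_at_sum => j _; apply: smooth_atM.
  by apply: vector_field_smooth vY Uq _ => //; exact: smooth_at_coord.
by apply: smooth_at_invmx => //; exact: frame_unit.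
Qed.

Lemma frame_coefficients_unique q (a b : 'I_n -> R) : U q ->
  \sum_l a l *: X l q = \sum_l b l *: X l q -> forall l, a l = b l.
Proof.
move=> Uq ab l; have [_ /(_ q Uq)[_ iX]] := fX.
apply/eqP; rewrite -subr_eq0; apply/eqP.
apply: (iX (fun l => a l - b l)) => //.
under eq_bigr do rewrite scalerBl.
by rewrite sumrB ab subrr.
Qed.

Lemma exists_structural_functions : exists cs, structural_functions U X cs /\
  forall i j l q, U q -> smooth_at q (cs i j l).
Proof.
have /choice[F FP] (ij : 'I_n * 'I_n) : exists a : 'I_n -> M -> R,
    (forall q, U q -> bracket (X ij.1) (X ij.2) q = \sum_l a l q *: X l q) /\
    (forall l q, U q -> smooth_at q (a l)).
  by apply: frame_coefficients; apply: bracket_vector_field => //; exact: frame_field.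
exists (fun i j => F (i, j)); split=> [i j q Uq|i j l q Uq].
  by have [+ _] := FP (i, j); apply.
by have [_ +] := FP (i, j); apply.
Qed.

Lemma structural_functions_unique cs cs' : structural_functions U X cs ->
  structural_functions U X cs' ->
  forall i j l q, U q -> cs i j l q = cs' i j l q.
Proof.
move=> h h' i j l q Uq.
apply: (@frame_coefficients_unique q (fun l => cs i j l q) (fun l => cs' i j l q)) => //.
by rewrite -h // -h'.
Qed.

End TangentFrame.

Section Basis.
Variables (I : finType).
Implicit Types (P : pred I) (W : set (tvec M)) (e : I -> tvec M).

Lemma is_basis_mem P W e i : is_basis P W e -> P i -> W (e i).
Proof.
move=> [sp _] Pi; apply/sp; exists (fun j => (j == i)%:R).
rewrite (bigD1 i) //= eqxx scale1r big1 ?addr0 // => j /andP[_ /negbTE ->].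
by rewrite scale0r.
Qed.

Lemma is_basis_lin P W e (a : R) u v : is_basis P W e -> W u -> W v -> W (a *: u + v).
Proof.
move=> [sp _] /sp[b ->] /sp[d ->]; apply/sp; exists (fun i => a * b i + d i).
rewrite scaler_sumr -big_split; apply: eq_bigr => i _.
by rewrite scalerDl scalerA.
Qed.

Lemma is_basis_zero P W e : is_basis P W e -> W 0.
Proof.
move=> [sp _]; apply/sp; exists (fun=> 0).
by rewrite big1 // => i _; rewrite scale0r.
Qed.

Lemma is_basis_neq0 P W e i : is_basis P W e -> P i -> e i <> 0.
Proof.
move=> [_ ind] Pi ei0.
have : (i == i)%:R = 0 :> R.
  apply: (ind (fun j => (j == i)%:R)) => //.
  rewrite (bigD1 i) //= eqxx scale1r ei0 big1 ?addr0 // => j /andP[_ /negbTE ->].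
  by rewrite scale0r.
by rewrite eqxx => /eqP; rewrite oner_eq0.
Qed.

(** The change of basis made at one stage of the Gram-Schmidt process. *)
Lemma basis_elementary W e e' (m : I) (a : R) (b : I -> R) : a != 0 ->
  e' m = a *: e m -> (forall j, j != m -> e' j = e j + b j *: e m) ->
  is_basis predT W e -> is_basis predT W e'.
Proof.
move=> a0 em ej [sp ind].
have E (d : I -> R) : \sum_j d j *: e' j =
    \sum_j (if j == m then a * d m + \sum_(l | l != m) d l * b l else d j) *: e j.
  rewrite (bigD1 m) //= [RHS](bigD1 m) //= eqxx em scalerDl !scalerA [d m * a]mulrC.
  rewrite -addrA; congr (_ + _); rewrite scaler_suml -big_split /=.
  apply: eq_bigr => j jm; rewrite (negbTE jm) ej // scalerDr scalerA addrC.
  by [].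
split=> [v|d]; last first.
  rewrite E => /ind H i _.
  have dj j : j != m -> d j = 0 by move=> jm; have := H j isT; rewrite (negbTE jm).
  have [->|/dj //] := eqVneq i m.
  have := H m isT; rewrite eqxx big1 ?addr0 => [/eqP|j /dj ->]; last by rewrite mul0r.
  by rewrite mulf_eq0 (negbTE a0) => /eqP.
split=> [/sp[d ->]|[d ->]]; last first.
  by rewrite E; apply/sp; eexists; reflexivity.
exists (fun j => if j == m then a^-1 * (d m - \sum_(l | l != m) d l * b l) else d j).
rewrite E; apply: eq_bigr => j _; have [->|//] := eqVneq j m.
rewrite !eqxx; congr (_ *: _).
rewrite mulVKf //; set T := \sum_(l | l != m) _; rewrite -[LHS](subrK T).
by congr (_ + _); apply: eq_bigr => l /negbTE ->.
Qed.

End Basis.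
End Frames.

Section SubRiemannianFrames.
Context {R : realType} {n k : nat} {M : manifold R n}.
Variable S : sub_riemannian k M.
Implicit Types (q p : M) (U : set M) (v : tvec M).
Local Notation D := (Defs.distribution S).
Local Notation g := (metric S).

Lemma distribution_tangent q v : D q v -> tangent q v.
Proof. by have [DT _] := sr_subbundle S; exact: DT. Qed.

Lemma distribution_basis q : exists e : 'I_k -> tvec M, is_basis predT (D q) e.
Proof.
have [_ /(_ q)[U [[_ Uq] [X [_ bX]]]]] := sr_subbundle S.
by exists (X^~ q); exact: bX.
Qed.

Lemma distribution_lin q (a : R) u v : D q u -> D q v -> D q (a *: u + v).
Proof. by have [e be] := distribution_basis q; exact: (is_basis_lin a be). Qed.

Lemma distribution0 q : D q 0.
Proof. by have [e be] := distribution_basis q; exact: is_basis_zero be. Qed.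

Lemma distribution_sum q (I : Type) (r : seq I) (P : pred I) (a : I -> R)
    (F : I -> tvec M) : (forall i, P i -> D q (F i)) ->
  D q (\sum_(i <- r | P i) a i *: F i).
Proof.
move=> DF; elim: r => [|i r IH]; first by rewrite big_nil; exact: distribution0.
by rewrite big_cons; case: ifP => // Pi; apply: distribution_lin => //; exact: DF.
Qed.

Lemma metric_linl q u v w (a : R) : D q u -> D q v -> D q w ->
  g q (a *: u + v) w = a * g q u w + g q v w.
Proof. by have [L _ _ _] := sr_metric S; exact: L. Qed.

Lemma metricC q u v : D q u -> D q v -> g q u v = g q v u.
Proof. by have [_ L _ _] := sr_metric S; exact: L. Qed.

Lemma metric_gt0 q u : D q u -> u <> 0 -> 0 < g q u u.
Proof. by have [_ _ L _] := sr_metric S; exact: L. Qed.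

Lemma metric_smooth U (X Y : M -> tvec M) q : open U -> local_section U D X ->
  local_section U D Y -> U q -> smooth_at q (fun p => g p (X p) (Y p)).
Proof.
have [_ _ _ L] := sr_metric S => oU sX sY Uq.
exact: smooth_on_at (L _ _ _ oU sX sY).
Qed.

Lemma metric0l q w : D q w -> g q 0 w = 0.
Proof.
move=> Dw; have := metric_linl 1 (distribution0 q) (distribution0 q) Dw.
rewrite scaler0 addr0 mul1r => /eqP.
by rewrite -subr_eq0 opprD addNKr oppr_eq0 => /eqP.
Qed.

Lemma metric_suml q (I : Type) (r : seq I) (P : pred I) (a : I -> R)
    (F : I -> tvec M) w : (forall i, P i -> D q (F i)) -> D q w ->
  g q (\sum_(i <- r | P i) a i *: F i) w = \sum_(i <- r | P i) a i * g q (F i) w.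
Proof.
move=> DF Dw; elim: r => [|i r IH]; first by rewrite !big_nil metric0l.
rewrite !big_cons; case: ifP => // Pi; rewrite metric_linl ?IH //; first exact: DF.
exact: distribution_sum.
Qed.

Lemma metric_linr q u v w (a : R) : D q u -> D q v -> D q w ->
  g q w (a *: u + v) = a * g q w u + g q w v.
Proof.
move=> Du Dv Dw; rewrite metricC //; last exact: distribution_lin.
by rewrite metric_linl // (metricC Dw Du) (metricC Dw Dv).
Qed.

Lemma metric_scale q u w (a : R) : D q u -> D q w -> g q (a *: u) w = a * g q u w.
Proof.
by move=> Du Dw; rewrite -[a *: u]addr0 metric_linl ?metric0l ?addr0 //; exact: distribution0.
Qed.

(** Stage m normalizes the m-th field and subtracts its component from the later
    ones; the first m fields are then orthonormal, and orthogonal to all the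
    others. All the coefficients are smooth because the metric is. *)
Lemma gram_schmidt q : exists U (e : 'I_k -> M -> tvec M),
  [/\ open U, U q, is_frame predT U D e &
    forall p i j, U p -> g p (e i p) (e j p) = (i == j)%:R].
Proof.
have [_ /(_ q)[U [[oU Uq] [X fX]]]] := sr_subbundle S.
suff : forall m, (m <= k)%N -> exists e : 'I_k -> M -> tvec M,
    is_frame predT U D e /\ forall p (i j : 'I_k), U p -> (i < m)%N ->
      g p (e i p) (e j p) = (i == j)%:R.
  by move=> /(_ k (leqnn k))[e [fe oe]]; exists U, e; split=> // p i j Up; apply: oe.
elim=> [_|m IH mk]; first by exists X.
have [e [fe oe]] := IH (ltnW mk).
have [ve be] := fe.
pose mo : 'I_k := Ordinal mk.
have De i p : U p -> D p (e i p) by move=> Up; apply: (is_basis_mem (be p Up)).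
have se i : local_section U D (e i) by split; [exact: ve|move=> p Up; exact: De].
pose N p := g p (e mo p) (e mo p).
have N0 p : U p -> 0 < N p.
  by move=> Up; apply: metric_gt0; [exact: De|exact: (is_basis_neq0 (be p Up))].
pose s p := (Num.sqrt (N p))^-1.
have ss p : U p -> smooth_at p s.
  move=> Up; apply: smooth_atV; last by rewrite gt_eqF // sqrtr_gt0 N0.
  by apply: smooth_at_sqrt; [exact: metric_smooth Up|exact: N0].
have s0 p : U p -> s p != 0.
  by move=> Up; rewrite invr_neq0 // gt_eqF // sqrtr_gt0 N0.
pose b (j : 'I_k) : M -> R :=
  if (j < m)%N then fun=> 0 else fun p => - (g p (e j p) (e mo p) / N p).
have sb j p : U p -> smooth_at p (b j).
  move=> Up; rewrite /b; case: ifP => _; first exact: smooth_at_cst.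
  apply: smooth_atN; apply: smooth_atM; first exact: metric_smooth Up.
  by apply: smooth_atV; [exact: metric_smooth Up|rewrite gt_eqF // N0].
pose e' (j : 'I_k) p := if j == mo then s p *: e mo p else b j p *: e mo p + e j p.
have De' j p : U p -> D p (e' j p).
  move=> Up; rewrite /e'; case: ifP => _; last by apply: distribution_lin; exact: De.
  by rewrite -[_ *: _]addr0; apply: distribution_lin; [exact: De|exact: distribution0].
exists e'; split.
  split=> [j _|p Up].
    case: (eqVneq j mo) => jm.
      have -> : e' j = fun p => s p *: e mo p by apply/funext => p; rewrite /e' jm eqxx.
      by apply: vector_field_scale => //; exact: ve.
    have -> : e' j = fun p => b j p *: e mo p + e j p.
      by apply/funext => p; rewrite /e' (negbTE jm).
    by apply: vector_field_lin => //; [exact: sb|exact: ve|exact: ve].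
  apply: (@basis_elementary _ _ _ _ (D p) (e^~ p) (e'^~ p) mo (s p) (b^~ p)).
  - exact: s0.
  - by rewrite /e' eqxx.
  - by move=> j jm; rewrite /e' (negbTE jm) addrC.
  - exact: be.
have NE p : U p -> s p * s p * N p = 1.
  move=> Up; rewrite /s -invfM -expr2 sqr_sqrtr ?ltW ?N0 // mulVf // gt_eqF //.
  exact: N0.
have ms p j : U p -> g p (e mo p) (e' j p) = if j == mo then s p * N p else 0.
  move=> Up; have Dm := De mo p Up; have Dj := De j p Up.
  rewrite /e'; case: eqVneq => [_|jm].
    rewrite metricC ?metric_scale //.
    by rewrite -[_ *: _]addr0; apply: distribution_lin => //; exact: distribution0.
  rewrite metric_linr // /b; case: ifP => jm' /=.
    rewrite mul0r add0r metricC // oe //.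
    by rewrite (negbTE jm).
  by rewrite mulNr divfK ?gt_eqF ?N0 // (metricC Dm Dj) addNr.
move=> p i j Up; rewrite ltnS leq_eqVlt => /orP[/eqP im|im].
  have -> : i = mo by apply/val_inj.
  rewrite {1}/e' eqxx metric_scale //; [|exact: De|exact: De'].
  by rewrite ms // eq_sym; case: eqP => _; rewrite ?mulr0 // mulrA NE.
have imo : i != mo by apply: contraTneq im => ->; rewrite ltnn.
have -> : e' i p = e i p by rewrite /e' (negbTE imo) /b im /= scale0r add0r.
rewrite /e'; case: eqVneq => [->|jm].
  rewrite (negbTE imo) metricC; [|exact: De|by rewrite -[_ *: _]addr0; apply: distribution_lin;
    [exact: De|exact: distribution0]].
  rewrite metric_scale; [|exact: De|exact: De].
  by rewrite (metricC (De mo p Up) (De i p Up)) oe // (negbTE imo) mulr0.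
rewrite metric_linr; [|exact: De|exact: De|exact: De].
by rewrite !oe // (negbTE imo) mulr0 add0r.
Qed.

End SubRiemannianFrames.

(** * Frames adapted to a complement *)

Section AdaptedFrames.
Context {R : realType} {n k : nat} {M : manifold R n}.
Variable S : sub_riemannian k M.
Implicit Types (q p : M) (U V : set M) (v : tvec M) (f : M -> R).
Local Notation D := (Defs.distribution S).
Local Notation g := (metric S).

Lemma rank_split : (k + (n - k) = n)%N.
Proof. by rewrite subnKC // ltnW // (sr_rank S). Qed.

(** An adapted frame is indexed by 'I_n, whereas the bases of the distribution
    and of the complement are indexed by 'I_k and 'I_(n - k); these embeddings
    translate between the two. *)
Definition hor_index (j : 'I_k) : 'I_n := cast_ord rank_split (lshift (n - k) j).
Definition ver_index (j : 'I_(n - k)) : 'I_n := cast_ord rank_split (rshift k j).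

Lemma ltn_hor_index j : (hor_index j < k)%N.
Proof. by rewrite /= ltn_ord. Qed.

Lemma hor_index_inj : injective hor_index.
Proof. by move=> i j /cast_ord_inj /lshift_inj. Qed.

Lemma big_hor (A : Type) (idx : A) (op : Monoid.com_law idx) (F : 'I_n -> A) :
  \big[op/idx]_(i < n | (i < k)%N) F i = \big[op/idx]_(j < k) F (hor_index j).
Proof.
rewrite (reindex (cast_ord rank_split)) /=; last first.
  by exists (cast_ord (esym rank_split)) => i _; rewrite ?cast_ordK ?cast_ordKV.
rewrite big_split_ord /= [X in op _ X]big_pred0 ?Monoid.mulm1; last first.
  by move=> j; rewrite ltnNge leq_addr.
by apply: eq_bigl => j; rewrite ltn_ord.
Qed.

Lemma big_ver (A : Type) (idx : A) (op : Monoid.com_law idx) (F : 'I_n -> A) :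
  \big[op/idx]_(i < n | (k <= i)%N) F i =
  \big[op/idx]_(j < n - k) F (ver_index j).
Proof.
rewrite (reindex (cast_ord rank_split)) /=; last first.
  by exists (cast_ord (esym rank_split)) => i _; rewrite ?cast_ordK ?cast_ordKV.
rewrite big_split_ord /= [X in op X _]big_pred0 ?Monoid.mul1m; last first.
  by move=> j; rewrite leqNgt ltn_ord.
by apply: eq_bigl => j; rewrite leq_addr.
Qed.

Definition glue_hv (A : Type) (e : 'I_k -> A) (f : 'I_(n - k) -> A) (i : 'I_n) : A :=
  match fintype.split (cast_ord (esym rank_split) i) with inl j => e j | inr j => f j end.

Lemma glue_hor (A : Type) (e : 'I_k -> A) (f : 'I_(n - k) -> A) j : glue_hv e f (hor_index j) = e j.
Proof.
by rewrite /glue_hv /hor_index cast_ordK -[lshift _ _]/(unsplit (inl j)) unsplitK.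
Qed.

Lemma glue_ver (A : Type) (e : 'I_k -> A) (f : 'I_(n - k) -> A) j : glue_hv e f (ver_index j) = f j.
Proof.
by rewrite /glue_hv /ver_index cast_ordK -[rshift _ _]/(unsplit (inr j)) unsplitK.
Qed.

Lemma hor_indexP (i : 'I_n) : (i < k)%N -> exists j, i = hor_index j.
Proof.
move=> ik; exists (Ordinal ik); exact/val_inj.
Qed.

Lemma ver_indexP (i : 'I_n) : (k <= i)%N -> exists j, i = ver_index j.
Proof.
move=> ki; have ik : (i - k < n - k)%N by rewrite ltn_sub2r // (leq_ltn_trans ki).
by exists (Ordinal ik); apply/val_inj; rewrite /= subnKC.
Qed.

Lemma is_basis_hor (W : set (tvec M)) (e : 'I_n -> tvec M) :
  is_basis predT W (fun j => e (hor_index j)) <->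
  is_basis (fun i : 'I_n => (i < k)%N) W e.
Proof.
split=> -[sp ind]; split.
- move=> v; rewrite sp; split=> -[a ->].
    exists (glue_hv a (fun=> 0)); rewrite big_hor.
    by apply: eq_bigr => j _; rewrite glue_hor.
  by exists (fun j => a (hor_index j)); rewrite big_hor.
- move=> a; rewrite big_hor => /ind H i /hor_indexP[j ->].
  exact: (H j).
- move=> v; rewrite sp; split=> -[a ->].
    by exists (fun j => a (hor_index j)); rewrite big_hor.
  exists (glue_hv a (fun=> 0)); rewrite big_hor.
  by apply: eq_bigr => j _; rewrite glue_hor.
- move=> a a0 j _; have := ind (glue_hv a (fun=> 0)); rewrite big_hor.
  under eq_bigr do rewrite glue_hor.
  by move=> /(_ a0 _ (ltn_hor_index j)); rewrite glue_hor.
Qed.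

Lemma is_basis_ver (W : set (tvec M)) (e : 'I_n -> tvec M) :
  is_basis predT W (fun j => e (ver_index j)) ->
  is_basis (fun i : 'I_n => (k <= i)%N) W e.
Proof.
move=> -[sp ind]; split.
- move=> v; rewrite sp; split=> -[a ->].
    exists (glue_hv (fun=> 0) a); rewrite big_ver.
    by apply: eq_bigr => j _; rewrite glue_ver.
  by exists (fun j => a (ver_index j)); rewrite big_ver.
- move=> a; rewrite big_ver => /ind H i /ver_indexP[j ->].
  exact: (H j).
Qed.

Lemma big_hor_ver (A : Type) (idx : A) (op : Monoid.com_law idx) (F : 'I_n -> A) :
  \big[op/idx]_i F i = op (\big[op/idx]_(i < n | (i < k)%N) F i)
                          (\big[op/idx]_(i < n | (k <= i)%N) F i).
Proof.
rewrite (bigID (fun i : 'I_n => (i < k)%N)) /=; congr (op _ _).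
by apply: eq_bigl => i; rewrite -leqNgt.
Qed.

Section Complement.
Variable C : M -> set (tvec M).
Hypothesis hC : complement S C.

Lemma adapted_tangent_frame U X : adapted_frame S C U X -> is_frame predT U tangent X.
Proof.
move=> [[vD bD] [vC bC] _]; split=> [i _|q Uq].
  by case: (ltnP i k) => ik; [exact: vD|exact: vC].
have [_ [sp dj]] := hC.
have [spD iD] := bD q Uq; have [spC iC] := bC q Uq.
split=> [v|a].
  split=> [/sp[u [w [/spD[a ->] /spC[b ->] ->]]]|[a ->]].
    exists (fun i : 'I_n => if (i < k)%N then a i else b i).
    rewrite big_hor_ver /=; congr (_ + _); apply: eq_bigr => i ik.
      by rewrite ik.
    by rewrite ltnNge ik.
  apply: tangent_sum => i _; apply: tangent_scale.
  by case: (ltnP i k) => ik; [apply: vector_field_tangent (vD _ ik) Uq|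
    apply: vector_field_tangent (vC _ ik) Uq].
rewrite big_hor_ver /=.
set u := (X in X + _); set w := (X in _ + X); move=> E i _.
have Du : D q u by apply/spD; exists a.
have uw : u = \sum_(i < n | (k <= i)%N) (- a i) *: X i q.
  move/eqP: E; rewrite addr_eq0 => /eqP ->; rewrite -sumrN.
  by apply: eq_bigr => j _; rewrite scaleNr.
have Cu : C q u by rewrite uw; apply/spC; eexists; reflexivity.
have u0 : u = 0 by exact: dj Du Cu.
have w0 : w = 0 by move: E; rewrite u0 add0r.
by case: (ltnP i k) => ik; [exact: iD u0 _ ik|exact: iC w0 _ ik].
Qed.

Lemma exists_adapted_frame q : exists U X, [/\ open U, U q & adapted_frame S C U X].
Proof.
have [U1 [e [oU1 U1q [ve be] oe]]] := gram_schmidt S q.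
have [[_ /(_ q)[U2 [[oU2 U2q] [f [vf bf]]]]] _] := hC.
exists (U1 `&` U2), (glue_hv e f); split; [exact: openI|by split|split].
- split=> [i /hor_indexP[j ->]|p [U1p U2p]].
    rewrite glue_hor; apply: vector_field_subset (ve j isT) => x [] //.
  apply/is_basis_hor; under [X in is_basis _ _ X]eq_fun do rewrite glue_hor.
  exact: be.
- split=> [i /ver_indexP[j ->]|p [U1p U2p]].
    rewrite glue_ver; apply: vector_field_subset (vf j isT) => x [] //.
  apply: is_basis_ver; under [X in is_basis _ _ X]eq_fun do rewrite glue_ver.
  exact: bf.
- move=> p i j [U1p _] /hor_indexP[i' ->] /hor_indexP[j' ->].
  by rewrite !glue_hor oe // (inj_eq hor_index_inj).
Qed.

(** Structural functions are only required to satisfy pointwise identities; their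
    smoothness is recorded here because they are differentiated along the flow. *)
Record regular_frame (U : set M) (X : 'I_n -> M -> tvec M)
    (cs : 'I_n -> 'I_n -> 'I_n -> M -> R) : Prop := RegularFrame {
  rf_open : open U;
  rf_adapted : adapted_frame S C U X;
  rf_structural : structural_functions U X cs;
  rf_smooth : forall i j l q, U q -> smooth_at q (cs i j l) }.

Lemma adapted_regular_frame U X : open U -> adapted_frame S C U X ->
  exists cs, regular_frame U X cs.
Proof.
move=> oU aX; have fX := adapted_tangent_frame aX.
by have [cs [h1 h2]] := exists_structural_functions oU fX; exists cs; split.
Qed.

Lemma exists_regular_frame q : exists U X cs, U q /\ regular_frame U X cs.
Proof.
have [U [X [oU Uq aX]]] := exists_adapted_frame q.
by have [cs rX] := adapted_regular_frame oU aX; exists U, X, cs.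
Qed.

Section Regular.
Variables (U : set M) (X : 'I_n -> M -> tvec M).
Hypotheses (aX : adapted_frame S C U X).

Lemma adapted_distribution (i : 'I_n) q : (i < k)%N -> U q -> D q (X i q).
Proof. by move=> ik Uq; have [[_ bD] _ _] := aX; by apply: (is_basis_mem (bD q Uq)). Qed.

Lemma adapted_complement (i : 'I_n) q : (k <= i)%N -> U q -> C q (X i q).
Proof. by move=> ik Uq; have [_ [_ bC] _] := aX; by apply: (is_basis_mem (bC q Uq)). Qed.

Lemma adapted_orthonormal q (i j : 'I_n) : U q -> (i < k)%N -> (j < k)%N ->
  g q (X i q) (X j q) = (i == j)%:R.
Proof. by have [_ _ o] := aX; exact: o. Qed.

Lemma adapted_field i : vector_field U (X i).
Proof. by have [vX _] := adapted_tangent_frame aX; exact: vX. Qed.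

Lemma adapted_orthonormal_basis q : U q ->
  orthonormal_basis S q (fun j => X (hor_index j) q).
Proof.
move=> Uq; split.
  have [[_ bD] _ _] := aX; apply: (is_basis_hor (D q) (X^~ q)).2.
  exact: bD.
move=> i j; by rewrite adapted_orthonormal ?ltn_hor_index.
Qed.

End Regular.
End Complement.

Lemma orthonormal_decomposition q (e : 'I_k -> tvec M) v :
  orthonormal_basis S q e -> D q v -> v = \sum_j g q v (e j) *: e j.
Proof.
move=> [be oe] Dv; have [sp _] := be; have [a va] := (sp v).1 Dv.
have De i : D q (e i) by apply: (is_basis_mem be).
rewrite {1}va; apply: eq_bigr => j _; congr (_ *: _).
rewrite va metric_suml // (bigD1 j) //= oe eqxx mulr1 big1 ?addr0 // => i ij.
by rewrite oe (negbTE ij) mulr0.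
Qed.

(** The two bases differ by an orthogonal matrix. This makes the Hamiltonian
    independent of the orthonormal basis. *)
Lemma orthonormal_bilinear_sum q (e f : 'I_k -> tvec M) (l m : tvec M -> R) :
  orthonormal_basis S q e -> orthonormal_basis S q f ->
  (forall (a : 'I_k -> R), l (\sum_j a j *: f j) = \sum_j a j * l (f j)) ->
  (forall (a : 'I_k -> R), m (\sum_j a j *: f j) = \sum_j a j * m (f j)) ->
  \sum_i l (e i) * m (e i) = \sum_i l (f i) * m (f i).
Proof.
move=> oe of_ ll lm.
have De i : D q (e i) by have [be _] := oe; by apply: (is_basis_mem be).
have Df i : D q (f i) by have [bf _] := of_; by apply: (is_basis_mem bf).
pose O := \matrix_(i, j) g q (e i) (f j).
have E i : e i = \sum_j O i j *: f j.
  rewrite {1}(orthonormal_decomposition of_ (De i)).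
  by apply: eq_bigr => j _; rewrite mxE.
have OO : O *m O^T = 1%:M.
  apply/matrixP => i j; rewrite !mxE; have [_ <-] := oe.
  rewrite {1}(E i) metric_suml //; apply: eq_bigr => a _.
  by rewrite !mxE (metricC (Df a) (De j)).
have OTO := mulmx1C OO.
transitivity ((\row_j l (f j) *m O^T *m (O *m \col_j m (f j))) 0 0).
  rewrite mxE; apply: eq_bigr => i _; rewrite !mxE (E i) ll lm.
  congr (_ * _); apply: eq_bigr => j _; rewrite !mxE //.
  by rewrite mulrC.
rewrite mulmxA -(mulmxA (\row_j l (f j))) OTO mulmx1 mxE.
by apply: eq_bigr => i _; rewrite !mxE.
Qed.

Definition tangent_linear q (l : tvec M -> R) : Prop :=
  forall (a : R) u v, tangent q u -> tangent q v -> l (a *: u + v) = a * l u + l v.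

Lemma tangent_linear_sum q l (I : Type) (r : seq I) (P : pred I) (a : I -> R)
    (F : I -> tvec M) : tangent_linear q l -> (forall i, P i -> tangent q (F i)) ->
  l (\sum_(i <- r | P i) a i *: F i) = \sum_(i <- r | P i) a i * l (F i).
Proof.
move=> ll tF; have l0 : l 0 = 0.
  have := ll 1 0 0 (tangent0 q) (tangent0 q).
  rewrite scaler0 addr0 mul1r => /eqP.
  by rewrite -subr_eq0 opprD addNKr oppr_eq0 => /eqP.
elim: r => [|i r IH]; first by rewrite !big_nil.
rewrite !big_cons; case: ifP => // Pi; rewrite ll ?IH //; first exact: tF.
by apply: tangent_sum => j Pj; apply: tangent_scale; exact: tF.
Qed.

Lemma hamiltonianE q (e : 'I_k -> tvec M) (l : tvec M -> R) :
  orthonormal_basis S q e -> tangent_linear q l ->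
  hamiltonian S q l = 2^-1 * \sum_i l (e i) ^+ 2.
Proof.
move=> oe ll; apply: xget_unique; first by exists e.
move=> _ [f of_ ->]; congr (_ * _).
under eq_bigr do rewrite expr2; under [RHS]eq_bigr do rewrite expr2.
have te i : tangent q (e i).
  by have [be _] := oe; apply: (@distribution_tangent _ _ _ _ S); by apply: (is_basis_mem be).
by apply: (orthonormal_bilinear_sum of_ oe) => a; rewrite (tangent_linear_sum _ _ ll).
Qed.

Lemma gradientE q (e : 'I_k -> tvec M) f : orthonormal_basis S q e ->
  gradient S f q = \sum_i (e i f : R) *: e i.
Proof.
move=> oe; have [be oo] := oe.
have De i : D q (e i) by apply: (is_basis_mem be).
have Dg : D q (\sum_i (e i f : R) *: e i) by exact: distribution_sum.
apply: xget_unique.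
  split=> // u Du; rewrite metricC // {2}(orthonormal_decomposition oe Du).
  rewrite {1}(orthonormal_decomposition oe Du) metric_suml // tvec_combE.
  apply: eq_bigr => i _; congr (_ * _).
  rewrite metricC // metric_suml // (bigD1 i) //= oo eqxx mulr1 big1 ?addr0 // => j ji.
  by rewrite oo (negbTE ji) mulr0.
move=> v [Dv vP]; rewrite (orthonormal_decomposition oe Dv).
by apply: eq_bigr => i _; rewrite vP.
Qed.

End AdaptedFrames.

(** * Determinants, volume forms and divergence *)

Section SetRow.
Context {R : comNzRingType} {n : nat}.

Definition set_row (i : 'I_n) (u : 'I_n -> R) (A : 'M[R]_n) : 'M[R]_n :=
  \matrix_(a, b) if a == i then u b else A a b.

Lemma det_set_row i u A : \det (set_row i u A) = \sum_j u j * cofactor A i j.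
Proof.
rewrite (expand_det_row _ i); apply: eq_bigr => j _; rewrite mxE eqxx.
congr (_ * (_ * \det _)); apply/matrixP => a b; rewrite !mxE.
by rewrite eq_sym (negbTE (neq_lift _ _)).
Qed.

Lemma det_set_row_delta i j A :
  \det (set_row i (fun b => (b == j)%:R) A) = cofactor A i j.
Proof.
rewrite det_set_row (bigD1 j) //= eqxx mul1r big1 ?addr0 // => b /negbTE ->.
by rewrite mul0r.
Qed.

Lemma det_set_row_leibniz i u A : \det (set_row i u A) =
  \sum_(s : 'S_n) (-1) ^+ s * (u (s i) * \prod_(j | j != i) A j (s j)).
Proof.
apply: eq_bigr => s _; congr (_ * _); rewrite (bigD1 i) //= mxE eqxx.
by congr (_ * _); apply: eq_bigr => j /negbTE ji; rewrite mxE ji.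
Qed.

(** Expanding each determinant along the row that was replaced gives the trace of
    c adj(A) A. Either side is the derivative of det at A in the direction A c. *)
Lemma sum_det_set_row_mul (A c : 'M[R]_n) :
  \sum_i \det (set_row i (fun m => (A *m c) i m) A) = \det A * \tr c.
Proof.
under eq_bigr do rewrite det_set_row.
transitivity (\sum_j \sum_m c j m * (\adj A *m A) m j).
  under eq_bigr do (under eq_bigr do rewrite mxE mulr_suml).
  under eq_bigr do rewrite exchange_big.
  rewrite exchange_big /=; apply: eq_bigr => j _.
  rewrite exchange_big /=; apply: eq_bigr => m _.
  rewrite mxE mulr_sumr; apply: eq_bigr => i _; rewrite mxE; ring.
rewrite mul_adj_mx mulr_sumr; apply: eq_bigr => j _.
rewrite (bigD1 j) //= mxE eqxx mulr1n mulrC big1 ?addr0 // => m /negbTE mj.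
by rewrite mxE mj mulr0n mulr0.
Qed.

End SetRow.

Section AlternatingForm.
Context {R : realType} {n : nat} {M : manifold R n}.
Variables (w : M -> ('I_n -> tvec M) -> R) (q : M).
Hypothesis w_lin : forall (e : 'I_n -> tvec M) i u v (a : R),
  (forall j, tangent q (e j)) -> tangent q u -> tangent q v ->
  w q [eta e with i |-> a *: u + v] =
  a * w q [eta e with i |-> u] + w q [eta e with i |-> v].
Hypothesis w_alt : forall (e : 'I_n -> tvec M) i j,
  (forall l, tangent q (e l)) -> i != j -> e i = e j -> w q e = 0.

Lemma form_tangent_linear (e : 'I_n -> tvec M) i : (forall j, tangent q (e j)) ->
  tangent_linear q (fun u => w q [eta e with i |-> u]).
Proof. by move=> te a u v tu tv; exact: w_lin. Qed.

(** Polarization: w vanishes when e_i + e_j stands in both places. *)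
Lemma form_swap (e : 'I_n -> tvec M) i j : (forall l, tangent q (e l)) -> i != j ->
  w q (e \o tperm i j) = - w q e.
Proof.
move=> te ij.
pose G a b := w q [eta [eta e with i |-> a] with j |-> b].
have tS (f : 'I_n -> tvec M) l x : (forall l, tangent q (f l)) -> tangent q x ->
    forall l', tangent q ([eta f with l |-> x] l').
  by move=> tf tx l' /=; case: ifP.
have Gdiag a : tangent q a -> G a a = 0.
  move=> ta; apply: (@w_alt _ i j) => //.
    by apply: (tS _ j a) => //; exact: (tS _ i a).
  by rewrite /= eqxx (negbTE ij) eqxx.
have Gr a b c : tangent q a -> tangent q b -> tangent q c ->
    G a (b + c) = G a b + G a c.
  move=> ta tb tc; rewrite /G -{1}[b]scale1r w_lin ?mul1r //; exact: tS.
have Gl a b c : tangent q a -> tangent q b -> tangent q c ->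
    G (b + c) a = G b a + G c a.
  have E x : w q [eta [eta e with i |-> x] with j |-> a] =
      w q [eta [eta e with j |-> a] with i |-> x].
    by congr (w q _); apply/funext => l /=; case: (eqVneq l j) => // ->; rewrite eq_sym (negbTE ij).
  move=> ta tb tc; rewrite /G !E -{1}[b]scale1r w_lin ?mul1r //; exact: tS.
have tij : tangent q (e i + e j) by exact: tangent_add.
have := Gdiag _ tij; rewrite Gr // !Gl // !Gdiag // add0r addr0.
have -> : w q (e \o tperm i j) = G (e j) (e i).
  congr (w q _); apply/funext => l /=; case: tpermP => [->|->|/eqP li /eqP lj].
  - by rewrite (negbTE ij) eqxx.
  - by rewrite eqxx.
  - by rewrite (negbTE lj) (negbTE li).
have -> : w q e = G (e i) (e j).
  congr (w q _); apply/funext => l /=.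
  by case: eqVneq => [->//|_]; case: eqVneq => [->|].
by move/eqP; rewrite addr_eq0 => /eqP.
Qed.

Lemma form_perm (e : 'I_n -> tvec M) (s : 'S_n) : (forall l, tangent q (e l)) ->
  w q (e \o s) = (-1) ^+ s * w q e.
Proof.
move=> te; have [ts -> dts] := prod_tpermP s.
elim: ts dts e te => [_|[i j] ts IH /= /andP[ij dts]] e te.
  rewrite big_nil odd_perm1 mul1r; congr (w q _).
  by apply/funext => l /=; rewrite perm1.
rewrite big_cons odd_permM odd_tperm ij signr_addb mulN1r mulNr -IH //.
rewrite -(form_swap _ ij); last by move=> l; exact: te.
by congr (w q _); apply/funext => l /=; rewrite permM.
Qed.

Definition row_vectors (A : 'M[R]_n) (e : 'I_n -> tvec M) (i : 'I_n) : tvec M :=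
  \sum_j A i j *: e j.

(** Linearity expands the rows one at a time until A is the matrix of a map of
    indices. If the map is a permutation, form_perm applies; otherwise two rows
    are equal and both sides vanish. *)
Lemma form_det (A : 'M[R]_n) (e : 'I_n -> tvec M) : (forall l, tangent q (e l)) ->
  w q (row_vectors A e) = \det A * w q e.
Proof.
move=> te.
have tA B i : tangent q (row_vectors B e i).
  by apply: tangent_sum => j _; exact: tangent_scale.
(* The rows of index at least m are already unit vectors. *)
suff H m : forall A : 'M[R]_n, forall sg : 'I_n -> 'I_n,
    (forall i j : 'I_n, (m <= i)%N -> A i j = (j == sg i)%:R) ->
    w q (row_vectors A e) = \det A * w q e.
  by apply: (H n A id) => i j; rewrite leqNgt ltn_ord.
elim: m => [|m IH] {}A sg sgP.
  have rE i : row_vectors A e i = e (sg i).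
    rewrite /row_vectors (bigD1 (sg i)) //= sgP // eqxx scale1r big1 ?addr0 //.
    by move=> j /negbTE ji; rewrite sgP // ji scale0r.
  have [/injectiveP sgI|nsg] := boolP (injectiveb sg); last first.
    have [i [j [ij sij]]] : exists i j, i != j /\ sg i = sg j.
      by case/injectivePn: nsg => i [j ij sij]; exists i, j.
    rewrite (@w_alt _ i j) //; last by rewrite !rE sij.
    by rewrite (determinant_alternate ij) ?mul0r // => l; rewrite !sgP // sij.
  have -> : A = perm_mx (perm sgI).
    by apply/matrixP => i j; rewrite sgP // !mxE permE eq_sym.
  rewrite det_perm -form_perm //; congr (w q _).
  apply/funext => i /=; rewrite permE -rE; congr (row_vectors _ e i).
  by apply/matrixP => a b; rewrite sgP // !mxE permE eq_sym.
have [nm|mn] := leqP n m.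
  by apply: (IH A sg) => i j mi; have := leq_trans nm mi; rewrite leqNgt ltn_ord.
pose i0 := Ordinal mn.
have rE : row_vectors A e = [eta row_vectors A e with i0 |-> \sum_j A i0 j *: e j].
  by apply/funext => l /=; case: eqVneq => // ->.
rewrite rE (tangent_linear_sum _ _ (form_tangent_linear i0 (tA A))) //.
rewrite (expand_det_row A i0) mulr_suml; apply: eq_bigr => j _.
rewrite -mulrA; congr (_ * _).
pose B := set_row i0 (fun b => (b == j)%:R) A.
have -> : w q [eta row_vectors A e with i0 |-> e j] = w q (row_vectors B e).
  congr (w q _); apply/funext => l /=; rewrite /row_vectors; case: eqVneq => [->|li].
    rewrite (bigD1 j) //= mxE !eqxx scale1r big1 ?addr0 // => b /negbTE bj.
    by rewrite mxE eqxx bj scale0r.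
  by apply: eq_bigr => b _; rewrite mxE (negbTE li).
rewrite (IH B (fun i => if i == i0 then j else sg i)) ?det_set_row_delta //.
move=> i b; rewrite mxE; case: eqVneq => // ii0 mi; apply: sgP.
rewrite ltn_neqAle mi andbT; apply: contraNneq ii0 => mi'.
by apply/eqP/val_inj.
Qed.

End AlternatingForm.

Section Divergence.
Context {R : realType} {n : nat} {M : manifold R n}.
Implicit Types (q p : M) (U V : set M) (f : M -> R).

(** The Leibniz rule on the expansion of the determinant over permutations,
    regrouped by the row that is differentiated. *)
Lemma tangent_det q (v : tvec M) (A : M -> 'M[R]_n) : tangent q v ->
  (forall i j, smooth_at q (fun r => A r i j)) ->
  v (fun r => \det (A r)) =
  \sum_i \det (set_row i (fun j => v (fun r => A r i j)) (A q)).
Proof.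
move=> tv sA; under [RHS]eq_bigr do rewrite det_set_row_leibniz.
rewrite (tangent_big_sum _ tv) => [|s _]; last first.
  apply: smooth_atM; first exact: smooth_at_cst.
  by apply: smooth_at_prod => i _; exact: sA.
rewrite exchange_big /=; apply: eq_bigr => s _.
rewrite (tangentZ _ tv); last by apply: smooth_at_prod => i _; exact: sA.
by rewrite (tangent_prod tv) ?mulr_sumr // => i; exact: sA.
Qed.

Variable w : M -> ('I_n -> tvec M) -> R.
Hypothesis hw : volume_form w.

Lemma volume_det q (A : 'M[R]_n) (e : 'I_n -> tvec M) : (forall l, tangent q (e l)) ->
  w q (row_vectors A e) = \det A * w q e.
Proof. by have [L1 L2 _ _] := hw; exact: (form_det (L1 q) (L2 q)). Qed.

Lemma volume_frame_neq0 U X q : is_frame predT U tangent X -> U q ->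
  w q (X^~ q) != 0.
Proof.
move=> fX Uq; have [_ /(_ q Uq)[bX _]] := fX.
have [_ _ _ /(_ q)[e te]] := hw; apply: contraNneq => w0.
have /choice[a aP] i : exists a : 'I_n -> R, e i = \sum_l a l *: X l q.
  by apply/bX.
have -> : e = row_vectors (\matrix_(i, l) a i l) (X^~ q).
  by apply/funext => i; rewrite /row_vectors aP; apply: eq_bigr => l _; rewrite mxE.
rewrite volume_det ?w0 ?mulr0 // => l.
exact: vector_field_tangent (frame_field fX l) Uq.
Qed.

Lemma volume_smooth U (X : 'I_n -> M -> tvec M) q : open U ->
  (forall i, vector_field U (X i)) -> U q -> smooth_at q (fun p => w p (X^~ p)).
Proof.
by move=> oU vX Uq; have [_ _ s _] := hw; exact: smooth_on_at oU Uq (s _ _ oU vX).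
Qed.

(** The Lie derivative of the volume form is tensorial: for fields Y = A X, the
    derivative of det A along Z cancels against the derivatives of A in the
    brackets [Z, Y_i]. Hence a single number h satisfies h w(Y) = L_Z w (Y) for
    all Y, and it may be computed on the frame X itself. *)
Lemma divergence_frame U X Z q (c : 'I_n -> 'I_n -> R) : open U ->
  is_frame predT U tangent X -> vector_field U Z -> U q ->
  (forall j, bracket Z (X j) q = \sum_m c j m *: X m q) ->
  divergence w Z q = Z q (fun p => w p (X^~ p)) / w q (X^~ q) - \sum_j c j j.
Proof.
move=> oU fX vZ Uq cP.
have vX := frame_field fX.
have tX i p : U p -> tangent p (X i p) by exact: vector_field_tangent (vX i).
have tZ := vector_field_tangent vZ Uq.
have wX0 := volume_frame_neq0 fX Uq.
have swX := volume_smooth oU vX Uq.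
have H V (Y : 'I_n -> M -> tvec M) : open_nbhs q V -> (forall i, vector_field V (Y i)) ->
    (Z q (fun p => w p (X^~ p)) / w q (X^~ q) - \sum_j c j j) * w q (Y^~ q) =
    lie_derivative w Z Y q.
  move=> [oV Vq] vY.
  have oUV : open (U `&` V) by exact: openI.
  have fX' : is_frame predT (U `&` V) tangent X.
    split=> [i _|p [Up _]]; last by have [_ +] := fX; apply.
    by apply: vector_field_subset (vX i) => p [].
  have /choice[a aP] i := frame_coefficients oUV fX'
    (vector_field_subset (@subIsetr _ _ _) (vY i)).
  pose A p := \matrix_(i, l) a i l p.
  have YE p : (U `&` V) p -> Y^~ p = row_vectors (A p) (X^~ p).
    move=> UVp; apply/funext => i; rewrite /row_vectors; have [-> // _] := aP i.
    by apply: eq_bigr => l _; rewrite mxE.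
  have sA i j : smooth_at q (fun p => A p i j).
    have [_ /(_ j q (conj Uq Vq))] := aP i; apply: smooth_at_ext.
    by apply: nearW => p; rewrite mxE.
  have N : \near q, (U `&` V) q by apply: open_nbhs_nbhs; split.
  rewrite /lie_derivative.
  have -> : Z q (fun p => w p (Y^~ p)) = Z q (fun p => \det (A p) * w p (X^~ p)).
    apply: (tangent_ext_fun tZ); apply: filterS N => p UVp.
    by rewrite YE // volume_det // => l; apply: tX; have [] := UVp.
  rewrite (tangentM tZ (smooth_at_det sA) swX) (tangent_det tZ sA).
  (* The components of [Z, Y_i]: Z differentiates those of Y_i and brackets X. *)
  pose C := \matrix_(j, m) c j m.
  pose b i m := Z q (fun r => A r i m) + (A q *m C) i m.
  have bE i : bracket Z (Y i) q = \sum_m b i m *: X m q.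
    apply/funext => f; rewrite tvec_combE.
    have tB j : tangent q (bracket Z (X j) q).
      exact: vector_field_tangent (bracket_vector_field oU vZ (vX j)) Uq.
    have [sf|sf] := pselect (smooth_at q f); last first.
      rewrite /bracket; case: asboolP => // _; rewrite big1 // => m _.
      by rewrite (tangent_nonsmooth (tX m q Uq) sf) mulr0.
    rewrite bracketE //.
    have sXf j : smooth_at q (fun p => X j p f) by exact: vector_field_smooth (vX j) Uq sf.
    have sZf : smooth_at q (fun p => Z p f) by exact: vector_field_smooth vZ Uq sf.
    have -> : Z q (fun p => Y i p f) = Z q (fun p => \sum_l A p i l * (X l p f : R)).
      apply: (tangent_ext_fun tZ); apply: filterS N => p UVp.
      by rewrite -[Y i p]/(Y^~ p i) YE // /row_vectors tvec_combE.
    rewrite (tangent_big_sum _ tZ) => [|l _]; last exact: smooth_atM.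
    under eq_bigr => l _ do rewrite (tangentM tZ (sA i l) (sXf l)).
    rewrite -[Y i q]/(Y^~ q i) YE // /row_vectors tvec_combE -sumrB.
    transitivity (\sum_l (A q i l * bracket Z (X l) q f + X l q f * Z q (fun r => A r i l))).
      by apply: eq_bigr => l _; rewrite bracketE // mulrBr addrAC.
    rewrite big_split /= addrC.
    under [RHS]eq_bigr do rewrite /b mulrDl.
    rewrite big_split /=; congr (_ + _); first by apply: eq_bigr => l _; rewrite mulrC.
    under [RHS]eq_bigr do rewrite mxE mulr_suml.
    rewrite exchange_big /=; apply: eq_bigr => l _; rewrite cP tvec_combE mulr_sumr.
    by apply: eq_bigr => m _; rewrite [C _ _]mxE mulrA.
  have wE i : w q [eta Y^~ q with i |-> bracket Z (Y i) q] =
      \det (set_row i (b i) (A q)) * w q (X^~ q).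
    rewrite -volume_det => [|l]; last exact: tX.
    congr (w q _); apply/funext => l /=; rewrite /row_vectors.
    case: eqVneq => [->|li]; first by rewrite bE; apply: eq_bigr => m _; rewrite [in RHS]mxE eqxx.
    rewrite -[Y l q]/(Y^~ q l) YE //; apply: eq_bigr => m _.
    by rewrite [in RHS]mxE (negbTE li).
  have -> : \sum_i w q [eta Y^~ q with i |-> bracket Z (Y i) q] =
      (\sum_i \sum_j b i j * cofactor (A q) i j) * w q (X^~ q).
    rewrite mulr_suml; apply: eq_bigr => i _; rewrite -det_set_row; exact: wE.
  have -> : \sum_i \sum_j b i j * cofactor (A q) i j =
      \sum_i \det (set_row i (fun j => Z q (fun r => A r i j)) (A q)) +
      \det (A q) * \tr C.
    rewrite -sum_det_set_row_mul -big_split /=; apply: eq_bigr => i _.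
    by rewrite !det_set_row -big_split /=; apply: eq_bigr => j _; rewrite mulrDl.
  have -> : \tr C = \sum_j c j j by apply: eq_bigr => j _; rewrite mxE.
  rewrite YE // volume_det => [|l]; last exact: tX.
  by field.
apply: (@xget_unique R) => [V Y|h /= hP]; first exact: H.
by apply: (mulIf wX0); rewrite (hP U X) // (H U X).
Qed.

End Divergence.

(** * The macroscopic Laplacian in an adapted frame *)

Section MacroLaplacian.
Context {R : realType} {n k : nat} {M : manifold R n}.
Variable S : sub_riemannian k M.
Variable C : M -> set (tvec M).
Hypothesis hC : complement S C.
Implicit Types (q p : M) (U V : set M) (f phi : M -> R).

Lemma adapted_gradientE U X f q : adapted_frame S C U X -> U q ->
  gradient S f q = \sum_(i < n | (i < k)%N) (X i q f : R) *: X i q.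
Proof.
move=> aX Uq; rewrite (gradientE f (adapted_orthonormal_basis aX Uq)).
by rewrite (big_hor S).
Qed.

Section Frame.
Variables (U : set M) (X : 'I_n -> M -> tvec M) (cs : 'I_n -> 'I_n -> 'I_n -> M -> R).
Hypothesis rX : regular_frame S C U X cs.

Let oU : open U := rf_open rX.
Let aX := rf_adapted rX.
Let fX := adapted_tangent_frame hC aX.
Let vX i : vector_field U (X i) := adapted_field hC aX i.
Let tX i q (Uq : U q) : tangent q (X i q) := vector_field_tangent (vX i) Uq.

Lemma frame_smooth i q f : U q -> smooth_at q f -> smooth_at q (fun p => X i p f).
Proof. by move=> Uq sf; exact: vector_field_smooth (vX i) Uq sf. Qed.

Lemma structural_antisym i j l q : U q -> cs i j l q = - cs j i l q.
Proof.
move=> Uq; apply: (frame_coefficients_unique fX (a := fun l => cs i j l q)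
  (b := fun l => - cs j i l q) Uq).
rewrite -(rf_structural rX i j Uq).
transitivity (- bracket (X j) (X i) q); last first.
  rewrite (rf_structural rX j i Uq) -sumrN; apply: eq_bigr => m _.
  by rewrite scaleNr.
apply/funext => f; rewrite -[(- _) f]/(- (bracket (X j) (X i) q f)) /bracket.
by case: ifP => _; rewrite ?opprB ?oppr0.
Qed.

Lemma structural_bracketE i j q f : U q -> smooth_at q f ->
  X i q (fun p => X j p f) - X j q (fun p => X i p f) =
  \sum_l cs i j l q * (X l q f : R).
Proof.
move=> Uq sf; transitivity (bracket (X i) (X j) q f : R); first by rewrite bracketE.
by rewrite (rf_structural rX i j Uq) tvec_combE.
Qed.

(** The expression in an adapted frame to which the microscopic Laplacian will be
    shown to be equal. *)
Definition micro_frame phi q : R :=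
  \sum_(i < n | (i < k)%N) (X i q (fun p => X i p phi) : R) +
  \sum_(i < n | (i < k)%N) (\sum_(j < n | (j < k)%N) cs j i j q) * (X i q phi : R).

(** The gradient is the field sum_(i < k) (X_i phi) X_i. Its derivative of
    theta = log |w (X_1, ..., X_n)| is the gradient of theta applied to phi, and
    minus the trace of its brackets with the frame is sum_(i < k) X_i^2 phi plus
    sum_(i < k) (sum_j c_ji^j) X_i phi. The part j < k of the last sum belongs
    to the microscopic operator and the part k <= j to chi. *)
Lemma macro_laplacianE w phi q : volume_form w -> U q -> smooth_at q phi ->
  macro_laplacian S w phi q = micro_frame phi q + chi_frame S w X cs q phi.
Proof.
move=> hw Uq sphi.
have [V [oV Vq] sV] := sphi.
have oUV : open (U `&` V) by exact: openI.
have UVq : (U `&` V) q by [].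
have sUV p : (U `&` V) p -> smooth_at p phi by move=> [_ Vp]; exact: smooth_on_at sV.
pose Z p := \sum_(i < n | (i < k)%N) (X i p phi : R) *: X i p.
have vZ : vector_field (U `&` V) Z.
  apply: vector_field_sum => //.
    by move=> i p _ UVp; apply: frame_smooth; [have [] := UVp|exact: sUV].
  by move=> i _; apply: vector_field_subset (vX i) => p [].
have gZ p : (U `&` V) p -> gradient S phi p = Z p.
  by move=> [Up _]; rewrite (adapted_gradientE _ aX).
have vG : vector_field (U `&` V) (gradient S phi).
  apply: vector_fieldP => [p UVp|p f UVp sf].
    by rewrite gZ //; exact: vector_field_tangent vZ UVp.
  apply: smooth_at_ext (vector_field_smooth oUV vZ UVp sf).
  have : \near p, (U `&` V) p by apply: open_nbhs_nbhs.
  by apply: filterS => r UVr; rewrite gZ.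
have fX' : is_frame predT (U `&` V) tangent X.
  split=> [i _|p [Up _]]; last by have [_ +] := fX; apply.
  by apply: vector_field_subset (vX i) => p [].
(* Row j holds the components of [grad phi, X_j] in the frame. *)
pose c j m := \sum_(i < n | (i < k)%N) (X i q phi : R) * cs i j m q -
  (if (m < k)%N then (X j q (fun p => X m p phi) : R) else 0).
have cP j : bracket (gradient S phi) (X j) q = \sum_m c j m *: X m q.
  apply/funext => f; rewrite tvec_combE.
  have [sf|sf] := pselect (smooth_at q f); last first.
    rewrite /bracket; case: asboolP => // _; rewrite big1 // => m _.
    by rewrite (tangent_nonsmooth (tX m Uq) sf) mulr0.
  rewrite bracketE // gZ // /Z tvec_combE.
  have sXf i : smooth_at q (fun p => X i p f) by exact: frame_smooth.
  have sXp i : smooth_at q (fun p => X i p phi) by exact: frame_smooth.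
  have -> : X j q (fun p => gradient S phi p f) =
      X j q (fun p => \sum_(i < n | (i < k)%N) (X i p phi : R) * (X i p f : R)).
    apply: (tangent_ext_fun (tX j Uq)).
    have : \near q, (U `&` V) q by apply: open_nbhs_nbhs.
    by apply: filterS => r UVr; rewrite gZ // /Z tvec_combE.
  rewrite (tangent_big_sum _ (tX j Uq)) => [|i _]; last exact: smooth_atM.
  rewrite -sumrB.
  under eq_bigr => i _ do
    rewrite (tangentM (tX j Uq) (sXp i) (sXf i)) opprD addrA -mulrBr structural_bracketE //.
  under [RHS]eq_bigr do rewrite mulrBl.
  rewrite big_split [RHS]big_split /=; congr (_ + _).
    under [RHS]eq_bigr do rewrite mulr_suml.
    rewrite [RHS]exchange_big; apply: eq_bigr => i _; rewrite mulr_sumr.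
    by apply: eq_bigr => m _; rewrite mulrA.
  rewrite big_mkcond; apply: eq_bigr => i _; case: ifP => _; first by rewrite mulrC.
  by rewrite mul0r oppr0.
rewrite /macro_laplacian (divergence_frame hw oUV fX' vG UVq cP).
have swX := volume_smooth hw oU vX Uq.
have wX0 := volume_frame_neq0 hw fX Uq.
rewrite gZ // /Z tvec_combE mulr_suml.
rewrite /chi_frame -[(_ + gradient _ _ _) phi]/(_ phi + gradient _ _ _ phi).
rewrite (adapted_gradientE _ aX) // tvec_combE tvec_sumE.
have E1 : \sum_(i < n | (i < k)%N) X i q phi * X i q (fun p => w p (X^~ p)) / w q (X^~ q) =
    \sum_(i < n | (i < k)%N) X i q (fun p => ln `|w p (X^~ p)|) * X i q phi.
  by apply: eq_bigr => i _; rewrite (tangent_ln_norm (tX i Uq)) // -mulrA mulrC.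
rewrite E1 addrC addrA; congr (_ + _).
have -> : - (\sum_j c j j) = \sum_(j < n | (j < k)%N) (X j q (fun p => X j p phi) : R) +
    \sum_(i < n | (i < k)%N) (\sum_j cs j i j q) * (X i q phi : R).
  rewrite -sumrN [X in _ = X + _]big_mkcond /=.
  under [X in _ = _ + X]eq_bigr do rewrite mulr_suml.
  rewrite exchange_big /= -big_split /=; apply: eq_bigr => j _.
  rewrite /c opprB; congr (_ + _); rewrite -sumrN; apply: eq_bigr => i _.
  by rewrite mulrC -mulNr -structural_antisym.
rewrite /micro_frame -addrA; congr (_ + _); rewrite -big_split /=.
apply: eq_bigr => i _; rewrite tvec_combE -mulr_suml -mulrDl.
by rewrite (big_hor_ver (k := k)).
Qed.

End Frame.
End MacroLaplacian.

(** * Estimates for functions of a real variable *)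

Section Derivatives.
Context {R : realType}.

Lemma is_derive_big_sum (V : normedModType R) (I : Type) (r : seq I) (P : pred I)
    (F : I -> V -> R^o) (dF : I -> R) (x v : V) :
  (forall i, P i -> is_derive x v (F i) (dF i)) ->
  is_derive x v (fun y => \sum_(i <- r | P i) F i y : R^o) (\sum_(i <- r | P i) dF i).
Proof.
move=> H; elim: r => [|i r IH].
  rewrite big_nil (_ : (fun y => _) = cst 0); first exact: is_derive_cst.
  by apply/funext => y; rewrite big_nil.
rewrite big_cons; case Pi: (P i).
  rewrite (_ : (fun y => _) = F i + (fun y => \sum_(i <- r | P i) F i y : R^o)).
    by apply: is_deriveD; exact: H.
  by apply/funext => y; rewrite big_cons Pi.
rewrite (_ : (fun y => _) = (fun y => \sum_(i <- r | P i) F i y : R^o)) //.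
by apply/funext => y; rewrite big_cons Pi.
Qed.

Lemma is_derive_conv (V : normedModType R) (f : V -> R^o) (x v : V) (a b : R) :
  is_derive x v f a -> a = b -> is_derive x v f b.
Proof. by move=> H <-. Qed.

Lemma is_derive_mul (V : normedModType R) (f g : V -> R^o) (df dg : R) (x v : V) :
  is_derive x v f df -> is_derive x v g dg ->
  is_derive x v (fun y => f y * g y : R^o) (f x * dg + g x * df).
Proof. by move=> hf hg; exact: is_deriveM. Qed.

Lemma is_derive_half_sum_sqr (V : normedModType R) (I : Type) (r : seq I) (P : pred I)
    (F : I -> V -> R^o) (dF : I -> R) (x v : V) :
  (forall i, P i -> is_derive x v (F i) (dF i)) ->
  is_derive x v (fun y => 2^-1 * \sum_(i <- r | P i) (F i y : R) ^+ 2 : R^o)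
    (\sum_(i <- r | P i) F i x * dF i).
Proof.
move=> H.
have H2 : is_derive x v (fun y => \sum_(i <- r | P i) (F i y : R) ^+ 2 : R^o)
    (\sum_(i <- r | P i) (F i x * dF i + F i x * dF i)).
  apply: is_derive_big_sum => i Pi; have := is_derive_mul (H i Pi) (H i Pi).
  by [].
apply: (is_derive_conv (is_derive_mul (is_derive_cst (2^-1 : R^o) x v) H2)).
rewrite mulr0 addr0 mulr_sumr; apply: eq_bigr => i _; rewrite /cst; lra.
Qed.

Lemma derive_bound_dist (f df : R -> R) (T K : R) : 0 <= T ->
  (forall u, 0 <= u <= T -> is_derive (u : R^o) 1 (f : R^o -> R^o) (df u)) ->
  (forall u, 0 <= u <= T -> `|df u| <= K) -> `|f T - f 0| <= K * T.
Proof.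
move=> T0 Df Kf.
have [u||u uT ->] := @MVT_segment R f df 0 T T0.
- by rewrite in_itv /= => /andP[u0 uT]; apply: Df; rewrite !ltW.
- apply: continuous_in_subspaceT => u; rewrite inE /= in_itv /= => uP.
  by apply: differentiable_continuous; apply/derivable1_diffP; have [] := Df _ uP.
rewrite subr0 normrM (ger0_norm T0) ler_wpM2r //; apply: Kf.
by move: uT; rewrite in_itv.
Qed.

Lemma derive0_constant (f : R -> R) (T : R) : 0 <= T ->
  (forall u, 0 <= u <= T -> is_derive (u : R^o) 1 (f : R^o -> R^o) 0) -> f T = f 0.
Proof.
move=> T0 Df; apply/eqP; rewrite -subr_eq0 -normr_le0 -[leRHS](mul0r T).
by apply: (derive_bound_dist T0 Df) => u _; rewrite normr0.
Qed.

(** The function u |-> f u * exp (- c u) is nonincreasing. *)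
Lemma gronwall (f df : R -> R) (T c : R) : 0 <= T ->
  (forall u, 0 <= u <= T -> is_derive (u : R^o) 1 (f : R^o -> R^o) (df u)) ->
  (forall u, 0 <= u <= T -> df u <= c * f u) -> f T <= f 0 * expR (c * T).
Proof.
move=> T0 Df cf.
pose g u := f u * expR (- c * u).
pose dg u := f u * (- c * expR (- c * u)) + expR (- c * u) * df u.
have De u : is_derive (u : R^o) 1 (fun u : R^o => expR (- c * u) : R^o) (- c * expR (- c * u)).
  have H : is_derive (u : R^o) 1 (fun u : R^o => - c * u : R^o) (- c).
    have := is_derive_mul (is_derive_cst (- c : R^o) (u : R^o) 1) (is_derive_id (u : R^o) 1).
    by rewrite mulr0 addr0 mulr1.
  apply: (is_derive_conv (@is_derive1_comp R expR (fun u : R^o => - c * u) u _ _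
    (is_derive_expR _) H)).
  by rewrite -[LHS]/(expR (- c * u) * - c) mulrC.
have Dg u : 0 <= u <= T -> is_derive (u : R^o) 1 (g : R^o -> R^o) (dg u).
  by move=> uT; exact: is_derive_mul (Df u uT) (De u).
have [u||u uT E] := @MVT_segment R g dg 0 T T0.
- by rewrite in_itv /= => /andP[u0 uT]; apply: Dg; rewrite !ltW.
- apply: continuous_in_subspaceT => u; rewrite inE /= in_itv /= => uP.
  by apply: differentiable_continuous; apply/derivable1_diffP; have [] := Dg _ uP.
have dg0 : dg u <= 0.
  have uT' : 0 <= u <= T by move: uT; rewrite in_itv.
  have -> : dg u = expR (- c * u) * (df u - c * f u) by rewrite /dg; ring.
  by rewrite pmulr_rle0 ?expR_gt0 // subr_le0 cf.
have : g T <= g 0 by rewrite -subr_le0 E subr0 mulr_le0_ge0.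
rewrite /g mulr0 expR0 mulr1 mulNr expRN ler_pdivrMr ?expR_gt0 //.
Qed.

(** The mean value bound is applied to f2, then to f1 and to f after subtracting
    their Taylor polynomials. *)
Lemma taylor3_bound (f f1 f2 f3 : R -> R) (T K : R) : 0 <= T ->
  (forall u, 0 <= u <= T -> is_derive (u : R^o) 1 (f : R^o -> R^o) (f1 u)) ->
  (forall u, 0 <= u <= T -> is_derive (u : R^o) 1 (f1 : R^o -> R^o) (f2 u)) ->
  (forall u, 0 <= u <= T -> is_derive (u : R^o) 1 (f2 : R^o -> R^o) (f3 u)) ->
  (forall u, 0 <= u <= T -> `|f3 u| <= K) ->
  `|f T - f 0 - T * f1 0 - T ^+ 2 / 2 * f2 0| <= K * T ^+ 3.
Proof.
move=> T0 D1 D2 D3 K3.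
have K0 : 0 <= K by apply: le_trans (K3 0 _); rewrite ?lexx.
have sub u s : 0 <= s <= T -> 0 <= u <= s -> 0 <= u <= T.
  by move=> /andP[s0 sT] /andP[u0 us]; rewrite u0 (le_trans us).
have B2 s : 0 <= s <= T -> `|f2 s - f2 0| <= K * T.
  move=> sT; have /andP[s0 s1] := sT.
  apply: (@le_trans _ _ (K * s)); last exact: ler_wpM2l.
  by apply: (derive_bound_dist s0) => u us; [apply: D3; exact: sub us|apply: K3; exact: sub us].
have Did (a u : R) : is_derive (u : R^o) 1 (fun u : R^o => a * u : R^o) a.
  have := is_derive_mul (is_derive_cst (a : R^o) (u : R^o) 1) (is_derive_id (u : R^o) 1).
  by rewrite mulr0 addr0 mulr1.
pose g1 u := f1 u - f2 0 * u.
have G1 s : 0 <= s <= T -> `|g1 s - g1 0| <= K * T * T.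
  move=> sT; have /andP[s0 s1] := sT.
  apply: (@le_trans _ _ (K * T * s)); last by apply: ler_wpM2l => //; exact: mulr_ge0.
  apply: (@derive_bound_dist _ (fun u => f2 u - f2 0)) => // u us.
    by apply: (is_deriveB (D2 u _) (Did _ u)); exact: sub us.
  by apply: B2; exact: sub us.
pose g0 u := f u - f1 0 * u - f2 0 / 2 * (u * u).
have G0 : `|g0 T - g0 0| <= K * T * T * T.
  apply: (@derive_bound_dist g0 (fun u => g1 u - g1 0) T (K * T * T) T0) => u us;
    last exact: (G1 u us).
  have H1 : is_derive (u : R^o) 1 (fun u => f u - f1 0 * u : R^o) (f1 u - f1 0).
    by apply: (is_deriveB (D1 u _) (Did _ u)).
  have H2 : is_derive (u : R^o) 1 (fun u : R^o => f2 0 / 2 * (u * u) : R^o) (f2 0 * u).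
    apply: (is_derive_conv (is_derive_mul (is_derive_cst (f2 0 / 2 : R^o) (u : R^o) 1)
      (is_derive_mul (is_derive_id (u : R^o) 1) (is_derive_id (u : R^o) 1)))).
    by rewrite mulr0 addr0 /cst; lra.
  apply: (is_derive_conv (is_deriveB H1 H2)).
  by rewrite -[LHS]/(f1 u - f1 0 - f2 0 * u) /g1; lra.
have -> : f T - f 0 - T * f1 0 - T ^+ 2 / 2 * f2 0 = g0 T - g0 0 by rewrite /g0; lra.
by have -> : K * T ^+ 3 = K * T * T * T by ring.
Qed.

End Derivatives.

(** * Hamilton's equations in an adapted frame *)

Section HamiltonianFlow.
Context {R : realType} {n k : nat} {M : manifold R n}.
Variable S : sub_riemannian k M.
Variable C : M -> set (tvec M).
Hypothesis hC : complement S C.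
Variables (U : set M) (X : 'I_n -> M -> tvec M) (cs : 'I_n -> 'I_n -> 'I_n -> M -> R).
Hypothesis rX : regular_frame S C U X cs.
Implicit Types (q p : M) (f phi : M -> R) (G : R -> @cotangent_bundle R n M).
Local Notation coordf c i := (fun r : M => chart_map c r 0 i).

Let oU : open U := rf_open rX.
Let aX := rf_adapted rX.
Let vX i : vector_field U (X i) := adapted_field hC aX i.

Lemma cotangent_linear q (l : cotangent q) : tangent_linear q (cov l).
Proof. by have /asboolP[] := cov_cotangent l. Qed.

(** The fiberwise linear function of the field Y along the curve; for the fields
    of a frame these are coordinates on the fibers, denoted by h below. *)
Definition momentum (Y : M -> tvec M) G (s : R) : R := tagged (G s) (Y (tag (G s))).

Lemma tangent_vectorE c q (v : tvec M) : atlas c -> dom c q -> tangent q v ->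
  forall l : tvec M -> R, tangent_linear q l ->
  l v = \sum_m l (coord_vec c m q) * (v (coordf c m) : R).
Proof.
move=> Ac cq tv l ll; rewrite {1}(tangent_coord Ac cq tv).
rewrite (tangent_linear_sum _ _ ll) => [|i _]; last exact: tangent_coord_vec.
by apply: eq_bigr => i _; rewrite mulrC.
Qed.

(** The condition that integral_curve imposes at a single time. *)
Definition flow_at G (t : R) : Prop :=
  {for t, continuous (fun s => tag (G s))} /\
  exists c, [/\ atlas c, dom c (tag (G t)) &
    let x := chart_map c (tag (G t)) in
    let p := \row_i tagged (G t) (coord_vec c i (tag (G t))) in
    forall i : 'I_n,
      is_derive (t : R^o) 1 (fun s : R^o => chart_map c (tag (G s)) 0 i : R^o)
        ('D_(delta_mx 0 i) (hamiltonian_chart S c x) p) /\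
      is_derive (t : R^o) 1
        (fun s : R^o => tagged (G s) (coord_vec c i (tag (G s))) : R^o)
        (- 'D_(delta_mx 0 i) (hamiltonian_chart S c ^~ p) x)].

Section Derivative.
Variables (G : R -> @cotangent_bundle R n M) (t : R).
Hypotheses (Gt : flow_at G t) (Ut : U (tag (G t))).
Let q := tag (G t).

Lemma hamiltonian_chartE c : atlas c ->
  forall y (p : 'rV[R]_n), (exists2 r, dom c r & y = chart_map c r) -> U (param c y) ->
  hamiltonian_chart S c y p = 2^-1 * \sum_(j < k)
    (\sum_i p 0 i * (X (hor_index S j) (param c y) (coordf c i) : R)) ^+ 2.
Proof.
move=> Ac y p [r cr yr] Uy; rewrite /hamiltonian_chart.
rewrite (hamiltonianE (adapted_orthonormal_basis aX Uy)) // => a u v _ _.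
rewrite mulr_sumr -big_split /=; apply: eq_bigr => i _.
by rewrite -[(a *: u + v) _]/(a * u _ + v _) mulrDr mulrCA.
Qed.

Let h j := momentum (X j) G t.

(** The Hamiltonian is half the sum of the squares of the horizontal momenta,
    which are linear in p with the components of the fields as coefficients. *)
Lemma flow_derivatives c : atlas c -> dom c q ->
  let x := chart_map c q in let p := \row_i tagged (G t) (coord_vec c i q) in
  forall i,
  'D_(delta_mx 0 i) (hamiltonian_chart S c x) p =
    \sum_(j < n | (j < k)%N) h j * (X j q (coordf c i) : R) /\
  'D_(delta_mx 0 i) (hamiltonian_chart S c ^~ p) x =
    \sum_(j < n | (j < k)%N) h j * \sum_m tagged (G t) (coord_vec c m q) *
       (coord_vec c i q (fun r => X j r (coordf c m)) : R).
Proof.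
move=> Ac cq x p i; rewrite !(big_hor S).
have hE j : h j = \sum_m p 0 m * (X j q (coordf c m) : R).
  rewrite /h /momentum (tangent_vectorE Ac cq (vector_field_tangent (vX j) Ut)
    (cotangent_linear (tagged (G t)))).
  by apply: eq_bigr => m _; rewrite mxE.
have xq : param c x = q by rewrite /x chartK.
have sXc j m : smooth_at q (fun r => X j r (coordf c m)).
  by apply: vector_field_smooth (vX j) Ut _ => //; exact: smooth_at_coord.
split.
  have -> : hamiltonian_chart S c x = fun p : 'rV[R]_n => 2^-1 * \sum_(j < k)
      (\sum_i p 0 i * (X (hor_index S j) q (coordf c i) : R)) ^+ 2 : R^o.
    apply/funext => p'; rewrite hamiltonian_chartE ?xq //; by exists q.
  have H : is_derive p (delta_mx 0 i : 'rV[R]_n) (fun p : 'rV[R]_n => 2^-1 * \sum_(j < k)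
      (\sum_i p 0 i * (X (hor_index S j) q (coordf c i) : R)) ^+ 2 : R^o)
      (\sum_(j < k) (\sum_i p 0 i * (X (hor_index S j) q (coordf c i) : R)) *
         (X (hor_index S j) q (coordf c i) : R)).
    apply: is_derive_half_sum_sqr => j _.
    have : is_derive p (delta_mx 0 i : 'rV[R]_n) (fun y : 'rV[R]_n =>
        \sum_m y 0 m * (X (hor_index S j) q (coordf c m) : R) : R^o)
        (\sum_m (p 0 m * 0 + (X (hor_index S j) q (coordf c m) : R) * (m == i)%:R)).
      apply: is_derive_big_sum => m _.
      have H : is_derive p (delta_mx 0 i : 'rV[R]_n) (fun y : 'rV[R]_n => y 0 m : R^o)
          (m == i)%:R.
        split; first by apply: diff_derivable; exact: differentiable_coord.
        by rewrite derive_coord mxE eqxx.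
      exact: (is_derive_mul H (is_derive_cst _ _ _)).
    move/is_derive_conv; apply; rewrite (bigD1 i) //= eqxx mulr0 add0r mulr1 big1 ?addr0 //.
    by move=> m /negbTE ->; rewrite !mulr0 addr0.
  have [_ ->] := H; by apply: eq_bigr => j _; rewrite hE.
have N : \near q, U q by apply: open_nbhs_nbhs.
have NE : \forall y \near x, 2^-1 * (\sum_(j < k)
    (\sum_m p 0 m * (X (hor_index S j) (param c y) (coordf c m) : R)) ^+ 2) =
    hamiltonian_chart S c y p :> R^o.
  have := near_chart Ac cq N; apply: filterS => y [Uy yE].
  by rewrite hamiltonian_chartE.
rewrite -(near_eq_derive _ NE).
have H : is_derive x (delta_mx 0 i : 'rV[R]_n) (fun y : 'rV[R]_n => 2^-1 * (\sum_(j < k)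
    (\sum_m p 0 m * (X (hor_index S j) (param c y) (coordf c m) : R)) ^+ 2) : R^o)
    (\sum_(j < k) (\sum_m p 0 m * (X (hor_index S j) (param c x) (coordf c m) : R)) *
      \sum_m p 0 m * (coord_vec c i q (fun r => X (hor_index S j) r (coordf c m)) : R)).
  apply: is_derive_half_sum_sqr => j _; apply: is_derive_big_sum => m _.
  have H : is_derive x (delta_mx 0 i : 'rV[R]_n)
      ((fun r => X (hor_index S j) r (coordf c m)) \o param c : _ -> R^o)
      (coord_vec c i q (fun r => X (hor_index S j) r (coordf c m)) : R).
    split; last by rewrite coord_vecE.
    by apply: diff_derivable; exact: smooth_at_differentiable.
  have := is_derive_mul (is_derive_cst (p 0 m : R^o) x (delta_mx 0 i : 'rV[R]_n)) H.
  by rewrite mulr0 addr0.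
have [_ ->] := H; apply: eq_bigr => j _; rewrite hE xq; congr (_ * _).
by apply: eq_bigr => m _; rewrite [in LHS]mxE.
Qed.

(** The first half of Hamilton's equations says that the projected curve has
    velocity sum_(j < k) h_j X_j. *)
Lemma flow_function f : smooth_at q f ->
  is_derive (t : R^o) 1 (fun s : R^o => f (tag (G s)) : R^o)
    (\sum_(j < n | (j < k)%N) h j * (X j q f : R)).
Proof.
move=> sf; have [cG [c [Ac cq /= Hc]]] := Gt.
have D1 i : is_derive (t : R^o) 1 (fun s : R^o => chart_map c (tag (G s)) 0 i : R^o)
    (\sum_(j < n | (j < k)%N) h j * (X j q (coordf c i) : R)).
  exact: (is_derive_conv (Hc i).1 (flow_derivatives Ac cq i).1).
have N : \forall s \near t, dom c (tag (G s)).
  have : nbhs (tag (G t)) (dom c) by apply: open_nbhs_nbhs; split => //; exact: chart_open.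
  by move=> /cG.
have H := is_derive_curve (smooth_at_differentiable Ac cq sf) D1.
apply: (near_eq_is_derive (f := fun s : R^o => (f \o param c) (chart_map c (tag (G s))) : R^o)).
  by apply: filterS N => s cs' /=; rewrite chartK.
apply: (is_derive_conv H); rewrite -/q.
transitivity (\sum_i \sum_(j < n | (j < k)%N)
    h j * (X j q (coordf c i) : R) * (coord_vec c i q f : R)).
  by apply: eq_bigr => i _; rewrite coord_vecE //; exact: mulr_suml.
rewrite exchange_big /=; apply: eq_bigr => j _.
rewrite (tangent_sumE _ Ac cq (vector_field_tangent (vX j) Ut)) mulr_sumr.
by apply: eq_bigr => i _; rewrite mulrA.
Qed.

(** The Poisson bracket of 1/2 sum_(j < k) h_j^2 with the momentum of Y is
    sum_(j < k) h_j {h_j, h_Y}, and {h_j, h_Y} is the momentum of [X_j, Y]. *)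
Lemma flow_momentum Y : vector_field U Y ->
  is_derive (t : R^o) 1 (momentum Y G : R^o -> R^o)
    (\sum_(j < n | (j < k)%N) h j * tagged (G t) (bracket (X j) Y q)).
Proof.
move=> vY; have [cG [c [Ac cq /= Hc]]] := Gt.
have D2 i := (Hc i).2.
have N1 : nbhs (tag (G t)) (dom c `&` U).
  by apply: open_nbhs_nbhs; split => //; apply: openI => //; exact: chart_open.
have sYc m : smooth_at q (fun r => Y r (coordf c m)).
  by apply: vector_field_smooth vY Ut _ => //; exact: smooth_at_coord.
have tY := vector_field_tangent vY Ut.
have ll := cotangent_linear (tagged (G t)).
apply: (near_eq_is_derive (f := fun s : R^o => \sum_m
    tagged (G s) (coord_vec c m (tag (G s))) * (Y (tag (G s)) (coordf c m) : R) : R^o)).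
  have : \forall s \near t, (dom c `&` U) (tag (G s)) by move: N1 => /cG.
  apply: filterS => s [cs' Us]; rewrite /momentum.
  by rewrite (tangent_vectorE Ac cs' (vector_field_tangent vY Us) (cotangent_linear _)).
have H : is_derive (t : R^o) 1 (fun s : R^o => \sum_m
    tagged (G s) (coord_vec c m (tag (G s))) * (Y (tag (G s)) (coordf c m) : R) : R^o)
    (\sum_m (tagged (G t) (coord_vec c m q) *
        (\sum_(j < n | (j < k)%N) h j * (X j q (fun r => Y r (coordf c m)) : R)) +
      (Y q (coordf c m) : R) * - \sum_(j < n | (j < k)%N) h j *
        \sum_m' tagged (G t) (coord_vec c m' q) *
          (coord_vec c m q (fun r => X j r (coordf c m')) : R))).
  apply: is_derive_big_sum => m _; apply: is_derive_mul; last exact: flow_function.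
  apply: (is_derive_conv (D2 m)); congr (- _); exact: (flow_derivatives Ac cq m).2.
apply: (is_derive_conv H).
rewrite big_split /=.
under eq_bigr do rewrite mulr_sumr.
rewrite exchange_big /=.
under [X in _ + X]eq_bigr do rewrite mulrN mulr_sumr.
rewrite sumrN [X in _ - X]exchange_big /= -sumrB; apply: eq_bigr => j _.
have tB : tangent q (bracket (X j) Y q).
  exact: vector_field_tangent (bracket_vector_field oU (vX j) vY) Ut.
rewrite (tangent_vectorE Ac cq tB ll).
under eq_bigr do rewrite mulrCA.
rewrite -mulr_sumr.
under [X in _ - X]eq_bigr do rewrite mulrCA.
rewrite -mulr_sumr -mulrBr; congr (_ * _).
have -> : \sum_m tagged (G t) (coord_vec c m q) * (bracket (X j) Y q (coordf c m) : R) =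
   \sum_m (tagged (G t) (coord_vec c m q) * (X j q (fun p => Y p (coordf c m)) : R) -
     tagged (G t) (coord_vec c m q) * (Y q (fun p => X j p (coordf c m)) : R)).
  by apply: eq_bigr => m _; rewrite bracketE ?mulrBr //; exact: smooth_at_coord.
rewrite sumrB; congr (_ - _).
under eq_bigr do rewrite mulr_sumr.
rewrite exchange_big /=; apply: eq_bigr => m _.
rewrite (tangent_sumE _ Ac cq tY) mulr_sumr.
by apply: eq_bigr => i _; rewrite mulrCA.
Qed.

Lemma flow_frame_momentum l :
  is_derive (t : R^o) 1 (momentum (X l) G : R^o -> R^o)
    (\sum_(j < n | (j < k)%N) h j * \sum_m cs j l m q * h m).
Proof.
apply: (is_derive_conv (flow_momentum (vX l))); apply: eq_bigr => j _.
rewrite (rf_structural rX j l Ut) (tangent_linear_sum _ _ (cotangent_linear _)) //.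
by move=> m _; exact: vector_field_tangent (vX m) Ut.
Qed.

(** The Hamiltonian is conserved: the sum over the two horizontal indices j and l
    is antisymmetric, like c_jl^m. *)
Lemma flow_hamiltonian :
  is_derive (t : R^o) 1
    (fun s : R^o => \sum_(j < n | (j < k)%N) momentum (X j) G s * momentum (X j) G s : R^o) 0.
Proof.
have H : is_derive (t : R^o) 1
    (fun s : R^o => \sum_(j < n | (j < k)%N) momentum (X j) G s * momentum (X j) G s : R^o)
    (\sum_(l < n | (l < k)%N)
      (h l * (\sum_(j < n | (j < k)%N) h j * \sum_m cs j l m q * h m) +
       h l * (\sum_(j < n | (j < k)%N) h j * \sum_m cs j l m q * h m))).
  by apply: is_derive_big_sum => l _; apply: is_derive_mul; exact: flow_frame_momentum.
apply: (is_derive_conv H).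
rewrite big_split /=; set T := (X in X + _).
suff TN : T = - T by rewrite {1}TN addNr.
suff : \sum_(l < n | (l < k)%N) h l * (\sum_(j < n | (j < k)%N) h j * \sum_m cs j l m q * h m) =
  - \sum_(l < n | (l < k)%N) h l * (\sum_(j < n | (j < k)%N) h j * \sum_m cs j l m q * h m) by [].
  rewrite -sumrN.
  under eq_bigr do rewrite mulr_sumr.
  rewrite exchange_big /=; apply: eq_bigr => j _; rewrite -mulrN -sumrN mulr_sumr.
  apply: eq_bigr => l _; rewrite mulrCA; congr (_ * _); rewrite -mulrN; congr (_ * _).
  rewrite -sumrN; apply: eq_bigr => m _.
  by rewrite (structural_antisym hC rX j l m Ut) mulNr.
Qed.

End Derivative.
End HamiltonianFlow.

(** * Uniform Taylor expansion along the flow *)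

(** lra does not look inside boolean conjunctions. *)
Ltac itv_lra :=
  repeat match goal with H : is_true (?a && _) |- _ =>
    lazymatch goal with _ : is_true a |- _ => fail | _ => case/andP: (H) => ? ? end
  end;
  try (apply/andP; split); lra.

Section Bounds.
Context {R : realType}.

Lemma norm_sum_le (n : nat) (P : pred 'I_n) (F : 'I_n -> R) (b : R) : 0 <= b ->
  (forall i, P i -> `|F i| <= b) -> `|\sum_(i < n | P i) F i| <= n%:R * b.
Proof.
move=> b0 Fb; rewrite (le_trans (ler_norm_sum _ _ _)) //.
apply: (@le_trans _ _ (\sum_(i < n) b)); last first.
  by rewrite sumr_const card_ord -[leLHS]mulr_natl.
by rewrite big_mkcond /=; apply: ler_sum => i _; case: ifP => // /Fb.
Qed.

Lemma rV_norm_lt (n : nat) (y : 'rV[R]_n) (r : R) : 0 < r ->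
  (forall j, `|y 0 j| < r) -> `|y| < r.
Proof.
move=> r0 yr; rewrite [ltLHS]/Num.Def.normr /= mx_normrE; apply: bigmax_lt => // -[i j] _.
by rewrite (ord1 i).
Qed.

Lemma rV_norm_coord (n : nat) (y : 'rV[R]_n) j : `|y 0 j| <= `|y|.
Proof. by rewrite [leRHS]/Num.Def.normr /= mx_normrE (le_bigmax _ _ (0, j)). Qed.

(** The supremum of the times up to which P holds throughout is t. *)
Lemma interval_induction (P : R -> Prop) (t : R) : 0 <= t ->
  (forall s, 0 <= s <= t -> (forall u, 0 <= u < s -> P u) -> P s) ->
  (forall s, 0 <= s < t -> P s ->
     exists2 d : R, 0 < d & forall u, s < u < s + d -> P u) ->
  forall s, 0 <= s <= t -> P s.
Proof.
move=> t0 Pleft Pright.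
pose E := [set s | 0 <= s <= t /\ forall u, 0 <= u <= s -> P u].
have E0 : E 0.
  split; rewrite ?lexx //= => u u0; apply: Pleft; last by move=> v ?; itv_lra.
  by itv_lra.
have ubE : ubound E t by move=> s [/andP[]].
have supE : has_sup E by split; [exists 0|exists t].
have s0 : 0 <= sup E by exact: (ub_le_sup supE.2).
have st : sup E <= t by apply: ge_sup => //; exists 0.
have Pbelow u : 0 <= u < sup E -> P u.
  move=> /andP[u0 us]; have : 0 < sup E - u by rewrite subr_gt0.
  move=> /(sup_adherent)/(_ supE)[s [_ Ps] us']; apply: Ps.
  by rewrite u0 /= ltW //; move: us'; lra.
have Psup : P (sup E) by apply: Pleft => //; rewrite s0.
have [tE|/eqP sne] := eqVneq (sup E) t.
  move=> s /andP[sg0 sl]; have [->|sne] := eqVneq s t; first by rewrite -tE.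
  by apply: Pbelow; rewrite sg0 /= tE lt_neqAle sne.
have slt : sup E < t by rewrite lt_neqAle st andbT; apply/eqP.
have [|d d0 dP] := Pright _ _ Psup; first by rewrite s0.
pose s := Num.min (sup E + d / 2) t.
have : E s.
  split=> [|u /andP[u0 us]]; first by rewrite /s le_min ge_min lexx orbT t0 !andbT; itv_lra.
  have [ule|ugt] := leP u (sup E).
    have [->//|une] := eqVneq u (sup E).
    by apply: Pbelow; rewrite u0 /= lt_neqAle une.
  apply: dP; rewrite ugt /=; apply: le_lt_trans us _.
  by rewrite /s gt_min; apply/orP; left; lra.
move=> /(ub_le_sup supE.2); rewrite leNgt => /negP[].
by rewrite /s lt_min slt andbT; lra.
Qed.

End Bounds.

Section NearBounds.
Context {R : realType} {n : nat} {M : manifold R n}.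
Implicit Types (q p : M) (c : @chart R n M).

Lemma near_bounded (I : finType) (F : I -> M -> R) q : (forall i, smooth_at q (F i)) ->
  exists2 B : R, 0 <= B & \forall p \near q, forall i, `|F i p| <= B.
Proof.
move=> sF; exists (\sum_i (`|F i q| + 1)); first by apply: sumr_ge0 => i _; rewrite addr_ge0.
apply: filter_forall => i.
have /smooth_at_continuous/cvgrPdist_lt/(_ 1 ltr01) := sF i.
apply: filterS => p Fp.
apply: (@le_trans _ _ (`|F i q| + 1)).
  rewrite -[F i p](subrK (F i q)) addrC (le_trans (ler_normD _ _)) // lerD2l ltW //.
  by rewrite distrC.
by rewrite (bigD1 i) //= lerDl sumr_ge0 // => j _; rewrite addr_ge0.
Qed.

Lemma near_chart_ball c q (P : M -> Prop) : atlas c -> dom c q -> (\near q, P q) ->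
  exists2 r : R, 0 < r & forall y, `|y - chart_map c q| < r ->
    exists p, [/\ dom c p, y = chart_map c p & P p].
Proof.
move=> Ac cq NP; have /nbhs_ballP[r r0 rP] := near_chart Ac cq NP.
exists r => // y yr.
have [|Py [p cp yp]] := rP y; first by rewrite -ball_normE /= distrC.
by exists p; split => //; rewrite yp chartK in Py.
Qed.

End NearBounds.

Section FlowExpansion.
Context {R : realType} {n k : nat} {M : manifold R n}.
Variable S : sub_riemannian k M.
Variable C : M -> set (tvec M).
Hypothesis hC : complement S C.
Variables (U : set M) (X : 'I_n -> M -> tvec M) (cs : 'I_n -> 'I_n -> 'I_n -> M -> R).
Hypothesis rX : regular_frame S C U X cs.
Implicit Types (q p : M) (f phi : M -> R) (G : R -> @cotangent_bundle R n M).
Local Notation coordf c i := (fun r : M => chart_map c r 0 i).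

Section Stay.
Variables (q : M) (c : @chart R n M) (r B : R).
Hypotheses (Ac : atlas c) (cq : dom c q) (r0 : 0 < r) (B0 : 0 <= B).
Hypothesis ballP : forall y, `|y - chart_map c q| < r -> exists p,
  [/\ dom c p, y = chart_map c p & U p /\ forall i j, `|X i p (coordf c j) : R| <= B].

Definition chart_ball p := dom c p /\ `|chart_map c p - chart_map c q| < r.

Lemma chart_ballP p : chart_ball p -> U p /\ forall i j, `|X i p (coordf c j) : R| <= B.
Proof.
move=> [cp /ballP[p' [cp' E H]]].
by have -> : p = p' by rewrite -(chartK Ac cp) E chartK.
Qed.

Variables (l : cotangent q) (t e : R) (G : R -> @cotangent_bundle R n M).
Hypotheses (l1 : \sum_(j < n | (j < k)%N) l (X j q) * l (X j q) = 1).
Hypotheses (t0 : 0 <= t) (tr : n%:R * B * t < r) (e0 : 0 < e).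
Hypotheses (FG : forall s, - e < s < t + e -> flow_at S G s).
Hypotheses (G0 : G 0 = Tagged cotangent l).

Let FG' s : 0 <= s <= t -> flow_at S G s.
Proof. by have e0' := e0; move=> st; apply: FG; itv_lra. Qed.

Lemma momentum0 j : momentum (X j) G 0 = l (X j q).
Proof. by rewrite /momentum G0. Qed.

Section UpTo.
Variable T : R.
Hypotheses (T0 : 0 <= T <= t) (GT : forall s, 0 <= s <= T -> chart_ball (tag (G s))).

Let sub s : 0 <= s <= T -> 0 <= s <= t.
Proof. by have T0' := T0; move=> ?; itv_lra. Qed.

Lemma unit_momentum s : 0 <= s <= T ->
  \sum_(j < n | (j < k)%N) momentum (X j) G s * momentum (X j) G s = 1.
Proof.
move=> sT; have sge : 0 <= s by case/andP: sT.
pose f s := \sum_(j < n | (j < k)%N) momentum (X j) G s * momentum (X j) G s.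
have -> : 1 = f 0 by rewrite -l1; apply: eq_bigr => j _; rewrite momentum0.
apply: (@derive0_constant _ f s sge) => u us.
have uT : 0 <= u <= T by itv_lra.
have [Uu _] := chart_ballP (GT uT).
exact: (flow_hamiltonian hC rX (FG' (sub uT)) Uu).
Qed.

Lemma horizontal_momentum_le1 s (j : 'I_n) : 0 <= s <= T -> (j < k)%N ->
  `|momentum (X j) G s| <= 1.
Proof.
move=> sT jk; rewrite -(@ler_pXn2r _ 2) ?nnegrE // expr1n real_normK ?num_real //.
rewrite -(unit_momentum sT) (bigD1 j) //= expr2 lerDl.
by apply: sumr_ge0 => i _; rewrite -expr2 sqr_ge0.
Qed.

Lemma flow_displacement s j : 0 <= s <= T ->
  `|chart_map c (tag (G s)) 0 j - chart_map c q 0 j| <= n%:R * B * s.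
Proof.
move=> sT; have sge : 0 <= s by case/andP: sT.
have -> : chart_map c q 0 j = chart_map c (tag (G 0)) 0 j by rewrite G0.
pose f s := chart_map c (tag (G s)) 0 j.
apply: (@derive_bound_dist _ f (fun u => \sum_(i < n | (i < k)%N)
  momentum (X i) G u * (X i (tag (G u)) (coordf c j) : R)) s _ sge) => u us;
  have uT : 0 <= u <= T by itv_lra.
- have [cu _] := GT uT; have [Uu _] := chart_ballP (GT uT).
  apply: (flow_function hC rX (FG' (sub uT)) Uu (f := coordf c j)).
  exact: smooth_at_coord.
- apply: norm_sum_le => // i ik; rewrite normrM -[B]mul1r.
  have [_ Bu] := chart_ballP (GT uT).
  by apply: ler_pM => //; exact: horizontal_momentum_le1.
Qed.

End UpTo.

(** Unit covectors move with speed at most n B, however large their vertical part,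
    so all the integral curves remain in the coordinate ball for a common time. *)
Lemma flow_stays s : 0 <= s <= t -> chart_ball (tag (G s)).
Proof.
apply: (@interval_induction _ (fun s => chart_ball (tag (G s))) t t0) => {}s.
  move=> st Hs; have [s0|sn0] := eqVneq s 0.
    by rewrite s0 G0 /=; split => //; rewrite subrr normr0.
  have sgt : 0 < s by rewrite lt_neqAle eq_sym sn0; case/andP: st.
  (* Before s the curve runs in the compact image of a smaller box, which is closed
     because M is Hausdorff; so the curve cannot leave the chart at s. *)
  pose rho := n%:R * B * t.
  pose K0 : set 'rV[R]_n := [set y | forall j, `[chart_map c q 0 j - rho,
    chart_map c q 0 j + rho]%classic (y 0 j)].
  have K0r y : K0 y -> `|y - chart_map c q| < r.
    move=> Ky; apply: rV_norm_lt => // j; apply: le_lt_trans tr.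
    have := Ky j; rewrite /= in_itv /= => yj.
    by rewrite !mxE ler_norml -/rho; itv_lra.
  have cK0 : compact K0.
    apply: (@rV_compact R n (fun j => `[chart_map c q 0 j - rho,
      chart_map c q 0 j + rho]%classic)) => j; exact: segment_compact.
  have cK : compact (param c @` K0).
    apply: continuous_compact => //; apply: continuous_in_subspaceT => y.
    rewrite inE => /K0r/ballP[p [cp -> _]]; exact: param_continuous.
  have clK : closed (param c @` K0).
    by apply: compact_closed => //; exact: manifold_hausdorff.
  have GK u : 0 <= u < s -> (param c @` K0) (tag (G u)).
    move=> us; have uT : 0 <= u <= t by itv_lra.
    have Hu v : 0 <= v <= u -> chart_ball (tag (G v)).
      by move=> vu; apply: Hs; itv_lra.
    have [cu _] := Hs u us.
    exists (chart_map c (tag (G u))); last by rewrite chartK.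
    move=> j; rewrite /= in_itv /=.
    have := @flow_displacement u uT Hu u j; rewrite lexx andbT.
    move=> /(_ (andP us).1); rewrite ler_norml => dj.
    have : n%:R * B * u <= rho.
      by rewrite /rho; apply: ler_wpM2l; [exact: mulr_ge0|itv_lra].
    by move=> ?; itv_lra.
  have : (param c @` K0) (tag (G s)).
    have [cG _] := FG' st.
    apply: (@closed_cvg _ _ s^'- _ (fun u => tag (G u)) (param c @` K0)) => //.
      near=> u; apply: GK; apply/andP; split; last by near: u; exact: nbhs_left_lt.
      by near: u; apply: nbhs_left_ge.
    by apply: cvg_at_left_filter; exact: cG.
  move=> [y /K0r yr <-]; have [p [cp yp _]] := ballP yr.
  by rewrite yp chartK //; split => //; rewrite -yp.
move=> st Hs; have st' : 0 <= s <= t by itv_lra.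
have [cG _] := FG' st'.
have oN : open (dom c `&` chart_map c @^-1` (ball (chart_map c q) r)).
  by apply: chart_preimage_open => //; exact: ball_open.
have : nbhs (tag (G s)) (dom c `&` chart_map c @^-1` (ball (chart_map c q) r)).
  apply: open_nbhs_nbhs; split => //; have [cs1 cs2] := Hs.
  by split => //=; rewrite -ball_normE /= distrC.
move=> /cG /nbhs_ballP[d d0 dP]; exists d => // u us.
have [|cu bu] := dP u; first by rewrite /= -ball_normE /= ltr_norml; itv_lra.
by split => //; move: bu; rewrite -ball_normE /= distrC.
Unshelve. all: by end_near. Qed.

End Stay.

Section Expansion.
Variable phi : M -> R.

(** The coefficients of the second derivative of phi along the flow, as a
    quadratic function of the momenta. *)
Definition flow_hessian (j m : 'I_n) p : R :=
  (if (m < k)%N then X j p (fun r => X m r phi) : R else 0) +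
  \sum_(i < n | (i < k)%N) cs j i m p * (X i p phi : R).

Lemma flow_hessian_smooth p j m : U p -> smooth_at p phi -> smooth_at p (flow_hessian j m).
Proof.
move=> Up sp; apply: smooth_atD.
  case: (m < k)%N; last exact: smooth_at_cst.
  by apply: (frame_smooth hC rX) => //; exact: (frame_smooth hC rX).
apply: smooth_at_sum => i _; apply: smooth_atM; first exact: rf_smooth rX _ _ _ _ Up.
exact: (frame_smooth hC rX).
Qed.

(** Taylor's formula for phi along the projected curve. The constants do not
    depend on the covector: the horizontal momenta are at most 1, and by Gronwall
    the squared size of all the momenta is multiplied by at most a constant, since
    their speed is proportional to their size. The third derivative is quadratic in
    the momenta once one horizontal factor is bounded by 1, so that second moments
    suffice to integrate the error. *)
Lemma flow_expansion q : U q -> smooth_at q phi ->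
  exists (t0 K : R), [/\ 0 < t0, 0 <= K & forall (l : cotangent q) (t e : R) G,
    \sum_(j < n | (j < k)%N) l (X j q) * l (X j q) = 1 -> 0 <= t <= t0 -> 0 < e ->
    (forall s, - e < s < t + e -> flow_at S G s) -> G 0 = Tagged cotangent l ->
    `|phi (tag (G t)) - phi q - t * (\sum_(i < n | (i < k)%N) l (X i q) * (X i q phi : R)) -
      t ^+ 2 / 2 * \sum_(j < n | (j < k)%N) \sum_m
         flow_hessian j m q * (l (X j q) * l (X m q))| <=
    K * (\sum_m l (X m q) * l (X m q)) * t ^+ 3].
Proof.
move=> Uq sphi; have [c Ac cq] := atlas_cover q.
have oU := rf_open rX.
have [B1 B10 N1] := @near_bounded _ _ _ ('I_n * 'I_n)%type
  (fun ij p => X ij.1 p (coordf c ij.2)) q (fun ij => frame_smooth hC rX _ Uq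
     (smooth_at_coord _ Ac cq)).
have [B2 B20 N2] := @near_bounded _ _ _ ('I_n * 'I_n * 'I_n)%type
  (fun ijl => cs ijl.1.1 ijl.1.2 ijl.2) q (fun ijl => rf_smooth rX _ _ _ Uq).
have [B3 B30 N3] := @near_bounded _ _ _ ('I_n * 'I_n)%type
  (fun jm => flow_hessian jm.1 jm.2) q (fun jm => flow_hessian_smooth _ _ Uq sphi).
have [B4 B40 N4] := @near_bounded _ _ _ ('I_n * 'I_n * 'I_n)%type
  (fun ljm p => X ljm.1.1 p (flow_hessian ljm.1.2 ljm.2)) q
  (fun ljm => frame_smooth hC rX _ Uq (flow_hessian_smooth _ _ Uq sphi)).
pose B := B1 + B2 + B3 + B4.
have B0 : 0 <= B by rewrite /B !addr_ge0.
have NP : \forall p \near q, [/\ U p, smooth_at p phi,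
    forall i j, `|X i p (coordf c j) : R| <= B, forall i j m, `|cs i j m p| <= B &
    (forall j m, `|flow_hessian j m p| <= B) /\
     forall i j m, `|X i p (flow_hessian j m) : R| <= B].
  have N5 : \near q, U q by apply: open_nbhs_nbhs.
  have N6 := smooth_at_near sphi.
  near=> p; split; [by near: p|by near: p|move=> i j|move=> i j m|split=> [j m|i j m]].
  - apply: (@le_trans _ _ B1); last by rewrite /B; lra.
    by move: (i, j) => ij; have := near N1 p _ (i, j); apply.
  - apply: (@le_trans _ _ B2); last by rewrite /B; lra.
    by have := near N2 p _ (i, j, m); apply.
  - apply: (@le_trans _ _ B3); last by rewrite /B; lra.
    by have := near N3 p _ (j, m); apply.
  - apply: (@le_trans _ _ B4); last by rewrite /B; lra.
    by have := near N4 p _ (i, j, m); apply.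
have [r r0 rP] := near_chart_ball Ac cq NP.
have ballP y : `|y - chart_map c q| < r -> exists p, [/\ dom c p, y = chart_map c p &
    U p /\ forall i j, `|X i p (coordf c j) : R| <= B].
  by move=> /rP[p [cp yp [? ? ? ? _]]]; exists p.
have bP p : chart_ball q c r p -> [/\ U p, smooth_at p phi, forall i j m, `|cs i j m p| <= B &
    (forall j m, `|flow_hessian j m p| <= B) /\
     forall i j m, `|X i p (flow_hessian j m) : R| <= B].
  move=> [cp /rP[p' [cp' E [? ? _ ? ?]]]].
  by have -> : p = p' by rewrite -(chartK Ac cp) E chartK.
pose nn : R := n%:R; have nn0 : 0 <= nn by rewrite ler0n.
pose t0 : R := Num.min 1 (r / (nn * B + 1)).
have nB1 : 0 < nn * B + 1 by rewrite ltr_wpDl // mulr_ge0.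
have t00 : 0 < t0 by rewrite lt_min ltr01 divr_gt0.
(* cc is the growth rate of the squared size of the momenta, and K1 bounds the two
   groups of terms of the third derivative f3. *)
pose cc := 2 * (nn * (nn * B)).
pose K1 := nn * (nn * (2 * (B * (nn * (nn * B))) + nn * B)).
have K10 : 0 <= K1 by rewrite /K1 !(mulr_ge0, addr_ge0).
exists t0, (K1 * expR cc); split => //; first by rewrite mulr_ge0 // expR_ge0.
move=> l t e G l1 /andP[tge tle] e0 FG G0.
have t1 : t <= 1 by apply: le_trans tle _; rewrite ge_min lexx.
have tr : nn * B * t < r.
  apply: (@le_lt_trans _ _ (nn * B * (r / (nn * B + 1)))).
    apply: ler_wpM2l; first exact: mulr_ge0.
    by apply: le_trans tle _; rewrite ge_min lexx orbT.
  by rewrite mulrA ltr_pdivrMr // mulrC ltr_pM2l // ltrDl.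
have GB s : 0 <= s <= t -> chart_ball q c r (tag (G s)).
  by move=> st; exact: (flow_stays Ac cq r0 B0 ballP l1 tge tr e0 FG G0).
have FG' s : 0 <= s <= t -> flow_at S G s.
  by move=> /andP[s0 st]; apply: FG; itv_lra.
have tt : 0 <= t <= t by rewrite tge lexx.
pose h j := momentum (X j) G.
pose dh j s := \sum_(i < n | (i < k)%N) h i s * \sum_m cs i j m (tag (G s)) * h m s.
have h0 j : h j 0 = l (X j q) by rewrite /h (momentum0 G0).
have hle1 s (j : 'I_n) : 0 <= s <= t -> (j < k)%N -> `|h j s| <= 1.
  move=> st jk; exact: (horizontal_momentum_le1 Ac ballP l1 e0 FG G0 tt GB st jk).
have Dh j s : 0 <= s <= t -> is_derive (s : R^o) 1 (h j : R^o -> R^o) (dh j s).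
  move=> st; have [Us _ _ _] := bP _ (GB s st).
  exact: (flow_frame_momentum hC rX (FG' s st) Us).
pose N s := \sum_m h m s * h m s.
have Nge s m : h m s * h m s <= N s.
  by rewrite /N (bigD1 m) //= lerDl sumr_ge0 // => i _; rewrite -expr2 sqr_ge0.
have dhle j s b : 0 <= s <= t -> 0 <= b -> (forall m, `|h m s| <= b) ->
    `|dh j s| <= nn * (nn * (B * b)).
  move=> st b0 hb; have [_ _ Bs _] := bP _ (GB s st).
  apply: norm_sum_le => [|i ik]; first by rewrite !mulr_ge0.
  rewrite normrM -[leRHS]mul1r; apply: ler_pM => //; first exact: hle1.
  apply: norm_sum_le => [|m _]; first by rewrite mulr_ge0.
  by rewrite normrM; apply: ler_pM.
have NT s : 0 <= s <= t -> N s <= N 0 * expR cc.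
  move=> st; have sge : 0 <= s by case/andP: st.
  apply: (@le_trans _ _ (N 0 * expR (cc * s))); last first.
    apply: ler_wpM2l; first by apply: sumr_ge0 => i _; rewrite -expr2 sqr_ge0.
    rewrite ler_expR -[leRHS]mulr1; apply: ler_wpM2l; first by rewrite /cc !mulr_ge0.
    by itv_lra.
  apply: (@gronwall _ N (fun u => \sum_m (h m u * dh m u + h m u * dh m u)) s cc sge) => u us;
    have ut : 0 <= u <= t by itv_lra.
    by apply: is_derive_big_sum => m _; exact: is_derive_mul (Dh m u ut) (Dh m u ut).
  have [_ _ Bs _] := bP _ (GB u ut).
  have E m : h m u * dh m u <= nn * \sum_a B * ((h m u * h m u + h a u * h a u) / 2).
    apply: le_trans (ler_norm _) _; rewrite /dh [X in `|X|]mulr_sumr.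
    apply: norm_sum_le => [|i ik].
      by apply: sumr_ge0 => a _; rewrite mulr_ge0 // divr_ge0 // addr_ge0 // -expr2 sqr_ge0.
    rewrite mulrCA normrM -[leRHS]mul1r; apply: ler_pM => //; first exact: hle1.
    rewrite mulr_sumr (le_trans (ler_norm_sum _ _ _)) //; apply: ler_sum => a _.
    rewrite mulrCA normrM; apply: ler_pM => //.
    have := sqr_ge0 (h m u - h a u); have := sqr_ge0 (h m u + h a u).
    by rewrite ler_norml; nra.
  apply: (@le_trans _ _ (\sum_m 2 * (nn * \sum_a B * ((h m u * h m u + h a u * h a u) / 2)))).
    by apply: ler_sum => m _; move: (E m); lra.
  rewrite -mulr_sumr -mulr_sumr /cc -!mulrA; apply: ler_wpM2l => //; apply: ler_wpM2l => //.
  under eq_bigr do rewrite -mulr_sumr -mulr_suml big_split /= sumr_const card_ord.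
  rewrite -mulr_sumr -mulr_suml big_split /= sumr_const card_ord -/(N u).
  rewrite sumrMnl -/(N u) [nn * _]mulrCA; apply: ler_wpM2l => //.
  by rewrite -[N u *+ n]mulr_natl -/nn; lra.
have D1 s : 0 <= s <= t -> is_derive (s : R^o) 1 (fun s => phi (tag (G s)) : R^o)
    (\sum_(i < n | (i < k)%N) h i s * (X i (tag (G s)) phi : R)).
  move=> st; have [Us sp _ _] := bP _ (GB s st).
  exact: (flow_function hC rX (FG' s st) Us sp).
pose f2 s := \sum_(j < n | (j < k)%N) \sum_m flow_hessian j m (tag (G s)) * (h j s * h m s).
have D2 s : 0 <= s <= t -> is_derive (s : R^o) 1
    (fun s => \sum_(i < n | (i < k)%N) h i s * (X i (tag (G s)) phi : R) : R^o) (f2 s).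
  move=> st; have [Us sp _ _] := bP _ (GB s st).
  have sX i : smooth_at (tag (G s)) (fun r => X i r phi) by exact: (frame_smooth hC rX).
  have H : is_derive (s : R^o) 1
      (fun s => \sum_(i < n | (i < k)%N) h i s * (X i (tag (G s)) phi : R) : R^o)
      (\sum_(i < n | (i < k)%N) (h i s * (\sum_(j < n | (j < k)%N) h j s *
          (X j (tag (G s)) (fun r => X i r phi) : R)) + (X i (tag (G s)) phi : R) * dh i s)).
    apply: is_derive_big_sum => i _.
    exact: is_derive_mul (Dh i s st) (flow_function hC rX (FG' s st) Us (sX i)).
  apply: (is_derive_conv H); rewrite big_split /=.
  under [X in _ + X]eq_bigr do rewrite mulr_sumr.
  under [X in X + _]eq_bigr do rewrite mulr_sumr.
  rewrite exchange_big /= [X in _ + X]exchange_big /= -big_split /=.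
  apply: eq_bigr => j _; rewrite /flow_hessian.
  under [RHS]eq_bigr do rewrite mulrDl.
  rewrite big_split /=; congr (_ + _).
    rewrite big_mkcond /=; apply: eq_bigr => m _.
    by case: ifP => _; rewrite ?mul0r // mulrA mulrC [h m s * _]mulrC.
  under eq_bigr do rewrite mulrCA mulr_sumr mulr_sumr.
  rewrite exchange_big /=; apply: eq_bigr => m _; rewrite mulr_suml.
  by apply: eq_bigr => i _; ring.
pose f3 s := \sum_(j < n | (j < k)%N) \sum_m (flow_hessian j m (tag (G s)) *
    (h j s * dh m s + h m s * dh j s) + h j s * h m s *
    (\sum_(i < n | (i < k)%N) h i s * (X i (tag (G s)) (flow_hessian j m) : R))).
have D3 s : 0 <= s <= t -> is_derive (s : R^o) 1 (f2 : R^o -> R^o) (f3 s).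
  move=> st; have [Us sp _ _] := bP _ (GB s st).
  apply: is_derive_big_sum => j _; apply: is_derive_big_sum => m _.
  exact: is_derive_mul (flow_function hC rX (FG' s st) Us (flow_hessian_smooth j m Us sp))
    (is_derive_mul (Dh j s st) (Dh m s st)).
have N01 : 1 <= N 0.
  rewrite -l1 /N [leRHS](big_hor_ver (k := k)) /=.
  have -> : \sum_(i < n | (i < k)%N) h i 0 * h i 0 =
      \sum_(i < n | (i < k)%N) l (X i q) * l (X i q).
    by apply: eq_bigr => i _; rewrite h0.
  by rewrite lerDl sumr_ge0 // => i _; rewrite -expr2 sqr_ge0.
pose Q2 := N 0 * expR cc; pose Q := Num.sqrt Q2.
have cc0 : 0 <= cc by rewrite /cc !mulr_ge0.
have Q21 : 1 <= Q2.
  rewrite /Q2 -[1]mulr1; apply: ler_pM => //.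
  by rewrite (le_trans _ (expR_ge1Dx _)) // lerDl.
have QQ : Q * Q = Q2 by rewrite -expr2 sqr_sqrtr // (le_trans _ Q21).
have Q0 : 0 <= Q by exact: sqrtr_ge0.
have Q1 : 1 <= Q by rewrite -(@sqrtr1 R); exact: ler_wsqrtr.
have hQ m s : 0 <= s <= t -> `|h m s| <= Q.
  move=> st; rewrite -(@ler_pXn2r _ 2) ?nnegrE // real_normK ?num_real // !expr2 QQ.
  exact: le_trans (Nge s m) (NT s st).
have f3le s : 0 <= s <= t -> `|f3 s| <= K1 * Q2.
  move=> st; have [_ _ _ [Bh BX]] := bP _ (GB s st).
  rewrite /K1 -!mulrA.
  have z0 : 0 <= (2 * (B * (nn * (nn * B))) + nn * B) * Q2.
    by rewrite mulr_ge0 // ?(le_trans _ Q21) // !(addr_ge0, mulr_ge0).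
  apply: norm_sum_le => [|j jk]; first by rewrite mulr_ge0.
  apply: norm_sum_le => // m _.
  have dQ i : `|dh i s| <= nn * (nn * (B * Q)) by apply: dhle => // a; exact: hQ.
  have d0 : 0 <= nn * (nn * (B * Q)) by rewrite !mulr_ge0.
  rewrite [leRHS]mulrDl; apply: le_trans (ler_normD _ _) _; apply: lerD.
    rewrite normrM.
    have -> : 2 * (B * (nn * (nn * B))) * Q2 =
      B * (Q * (nn * (nn * (B * Q))) + Q * (nn * (nn * (B * Q)))) by rewrite -QQ; ring.
    apply: ler_pM => //; apply: le_trans (ler_normD _ _) _.
    by apply: lerD; rewrite normrM; apply: ler_pM => //; exact: hQ.
  rewrite normrM.
  have -> : nn * B * Q2 = 1 * Q * (Q * (nn * B)) by rewrite -QQ; ring.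
  apply: ler_pM => //.
    by rewrite normrM; apply: ler_pM => //; [exact: hle1|exact: hQ].
  apply: (@le_trans _ _ (nn * B)); last by rewrite ler_peMl // mulr_ge0.
  apply: norm_sum_le => // i ik; rewrite normrM -[leRHS]mul1r.
  by apply: ler_pM => //; exact: hle1.
have := taylor3_bound tge D1 D2 D3 f3le.
have tag0 : tag (G 0) = q by rewrite G0.
have -> : \sum_(i < n | (i < k)%N) h i 0 * (X i (tag (G 0)) phi : R) =
    \sum_(i < n | (i < k)%N) l (X i q) * (X i q phi : R).
  by apply: eq_bigr => i _; rewrite h0 tag0.
have -> : f2 0 = \sum_(j < n | (j < k)%N) \sum_m
    flow_hessian j m q * (l (X j q) * l (X m q)).
  by apply: eq_bigr => j _; apply: eq_bigr => m _; rewrite !h0 tag0.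
have -> : K1 * Q2 = K1 * expR cc * \sum_m l (X m q) * l (X m q).
  rewrite /Q2 mulrCA mulrC; congr (_ * _).
  by apply: eq_bigr => m _; rewrite h0.
by rewrite tag0.
Unshelve. all: by end_near. Qed.

End Expansion.
End FlowExpansion.

(** * Existence of solutions of Lipschitz differential equations *)

Section Clamp.
Context {R : realType}.

Definition clamp (a b x : R) : R := Num.max a (Num.min b x).

Lemma clamp_itv a b x : a <= b -> a <= clamp a b x <= b.
Proof.
by move=> ab; rewrite /clamp le_max lexx /= ge_max ab ge_min lexx.
Qed.

Lemma clamp_id a b x : a <= x <= b -> clamp a b x = x.
Proof. by move=> /andP[ax xb]; rewrite /clamp min_r // max_r. Qed.

Lemma clamp_lipschitz a b x y : `|clamp a b x - clamp a b y| <= `|x - y|.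
Proof.
wlog xy : x y / x <= y => [H|].
  have [|yx] := leP x y; first exact: H.
  by rewrite distrC [leRHS]distrC; apply: H; exact: ltW.
have yx0 : 0 <= y - x by rewrite subr_ge0.
rewrite [`|x - y|]distrC [`|clamp a b x - _|]distrC (ger0_norm yx0).
have m : clamp a b x <= clamp a b y.
  rewrite /clamp ge_max le_max lexx /= le_max; apply/orP; right.
  by rewrite le_min ge_min lexx /= ge_min xy orbT.
rewrite ger0_norm ?subr_ge0 // /clamp.
case: (leP a (Num.min b y)); case: (leP a (Num.min b x)); case: (leP b y); case: (leP b x);
  by move=> *; lra.
Qed.

End Clamp.

Section Primitive.
Context {R : realType}.

Lemma derive_ge0_ndecr (f df : R -> R) (T : R) : 0 <= T ->
  (forall u, 0 <= u <= T -> is_derive (u : R^o) 1 (f : R^o -> R^o) (df u)) ->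
  (forall u, 0 <= u <= T -> 0 <= df u) -> f 0 <= f T.
Proof.
move=> T0 Df df0.
have [u||u uT E] := @MVT_segment R f df 0 T T0.
- by rewrite in_itv /= => /andP[u0 uT]; apply: Df; rewrite !ltW.
- apply: continuous_in_subspaceT => u; rewrite inE /= in_itv /= => uP.
  by apply: differentiable_continuous; apply/derivable1_diffP; have [] := Df _ uP.
by rewrite -subr_ge0 E subr0 mulr_ge0 // df0.
Qed.

(** Comparison with an exponential, the weight that makes the Picard operator a
    contraction on an interval of any length. *)
Lemma exp_compare (G g : R -> R) (T a b : R) : 0 < b -> 0 <= a -> G 0 = 0 ->
  (forall s, `|s| < T -> is_derive (s : R^o) 1 (G : R^o -> R^o) (g s)) ->
  (forall s, `|s| < T -> `|g s| <= a * expR (b * `|s|)) ->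
  forall s, `|s| < T -> `|G s| <= a / b * expR (b * `|s|).
Proof.
move=> b0 a0.
have De (c u : R) : is_derive (u : R^o) 1 (fun u : R^o => c * expR (b * u) : R^o)
    (c * (b * expR (b * u))).
  have H : is_derive (u : R^o) 1 (fun u : R^o => b * u : R^o) b.
    apply: (is_derive_conv (is_derive_mul (is_derive_cst (b : R^o) (u : R^o) 1)
      (is_derive_id (u : R^o) 1))).
    by rewrite mulr0 addr0 mulr1.
  have H2 : is_derive (u : R^o) 1 (fun u : R^o => expR (b * u) : R^o) (b * expR (b * u)).
    apply: (is_derive_conv (@is_derive1_comp R expR (fun u : R^o => b * u) u _ _
      (is_derive_expR _) H)).
    by rewrite -[LHS]/(expR (b * u) * b) mulrC.
  apply: (is_derive_conv (is_derive_mul (is_derive_cst (c : R^o) (u : R^o) 1) H2)).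
  by rewrite mulr0 addr0.
have pos (H h : R -> R) : H 0 = 0 ->
    (forall s, `|s| < T -> is_derive (s : R^o) 1 (H : R^o -> R^o) (h s)) ->
    (forall s, `|s| < T -> `|h s| <= a * expR (b * `|s|)) ->
    forall s, 0 <= s < T -> H s <= a / b * expR (b * s).
  move=> H0 DH hle s /andP[s0 sT].
  have uT u : 0 <= u <= s -> `|u| < T.
    by move=> /andP[u0 us]; rewrite ger0_norm // (le_lt_trans us).
  rewrite -subr_ge0.
  apply: (@le_trans _ _ (a / b * expR (b * 0) - H 0)).
    by rewrite H0 subr0 mulr_ge0 ?expR_ge0 // divr_ge0 // ltW.
  apply: (@derive_ge0_ndecr (fun u => a / b * expR (b * u) - H u)
    (fun u => a / b * (b * expR (b * u)) - h u) s s0) => u us.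
    exact: (is_deriveB (De _ u) (DH u (uT u us))).
  rewrite mulrA divfK ?gt_eqF // subr_ge0 (le_trans (ler_norm _)) //.
  by rewrite (le_trans (hle u (uT u us))) // ger0_norm //; case/andP: us.
have pos2 (H h : R -> R) : H 0 = 0 ->
    (forall s, `|s| < T -> is_derive (s : R^o) 1 (H : R^o -> R^o) (h s)) ->
    (forall s, `|s| < T -> `|h s| <= a * expR (b * `|s|)) ->
    forall s, 0 <= s < T -> `|H s| <= a / b * expR (b * s).
  move=> H0 DH hle s sT; rewrite ler_norml (pos H h) // andbT lerNl.
  apply: (pos (fun s => - H s) (fun s => - h s)) => // [|u uT|u uT].
  - by rewrite H0 oppr0.
  - exact: (is_deriveN (DH u uT)).
  - by rewrite normrN; exact: hle.
move=> G0 DG gle s sT; have [s0|s0] := leP 0 s.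
  by rewrite (ger0_norm s0); apply: (pos2 G g) => //; rewrite s0 /= -(ger0_norm s0).
rewrite (ltr0_norm s0) -[in leLHS](opprK s).
apply: (pos2 (fun s => G (- s)) (fun s => - g (- s))) => // [|u uT|u uT|].
- by rewrite oppr0.
- have uT' : `|- u| < T by rewrite normrN.
  have H : is_derive (u : R^o) 1 (fun u : R^o => - u : R^o) (- 1).
    exact: (is_deriveN (is_derive_id (u : R^o) 1)).
  apply: (is_derive_conv (@is_derive1_comp R G (fun u : R^o => - u) u _ _
    (DG (- u) uT') H)).
  by rewrite -[LHS]/(g (- u) * - 1) mulrN1.
- by rewrite normrN -[`|u|]normrN; apply: gle; rewrite normrN.
- by rewrite oppr_ge0 ltW //= -(ltr0_norm s0).
Qed.

(** The primitive is frozen outside [-T, T], so that the Lipschitz bound is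
    global. *)
Lemma exists_primitive (g : R -> R) (T B : R) : 0 < T -> continuous g ->
  (forall s, `|g s| <= B) -> exists G : R -> R, [/\ G 0 = 0,
    forall s, `|s| < T -> is_derive (s : R^o) 1 (G : R^o -> R^o) (g s) &
    forall s t, `|G s - G t| <= B * `|s - t|].
Proof.
move=> T0 cg gB; have B0 : 0 <= B := le_trans (normr_ge0 _) (gB 0).
pose F x : R := \int[lebesgue_measure]_(t in `[- (2 * T), x]) g t.
have DF x : `|x| < 2 * T -> is_derive (x : R^o) 1 (F : R^o -> R^o) (g x).
  rewrite ltr_norml => /andP[x1 x2].
  have ig : lebesgue_measure.-integrable `[- (2 * T), 2 * T] (EFin \o g).
    apply: continuous_compact_integrable; first exact: segment_compact.
    exact: continuous_subspaceT.
  have [d e] := continuous_FTC1_closed x2 ig x1 (cg x).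
  have e' : 'D_1 (F : R^o -> R^o) (x : R^o) = g x by rewrite -e derive1E.
  exact: (DeriveDef d e').
pose G0 x := F x - F 0.
have DG x : `|x| < 2 * T -> is_derive (x : R^o) 1 (G0 : R^o -> R^o) (g x).
  move=> xT; apply: (is_derive_conv (is_deriveB (DF x xT) (is_derive_cst (F 0 : R^o) _ _))).
  by rewrite subr0.
have TT : - T <= T by rewrite ge0_cp // ltW.
have inT x : - T <= x <= T -> `|x| < 2 * T.
  by move=> /andP[x1 x2]; rewrite ltr_norml; apply/andP; split; lra.
exists (fun x => G0 (clamp (- T) T x)); split.
- by rewrite clamp_id ?/G0 ?subrr // oppr_le0 ltW ?T0 //= ltW.
- move=> s sT.
  apply: (near_eq_is_derive (f := G0 : R^o -> R^o)); last first.
    by apply: DG; rewrite (lt_trans sT) // ltr_pMl // ltr1n.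
  have : \forall u \near s, `|u| < T.
    by have /cvgr_lt := @norm_continuous _ R^o s; apply.
  apply: filterS => u; rewrite ltr_norml => /andP[u1 u2].
  by rewrite clamp_id // !ltW.
- move=> s t; apply: (@le_trans _ _ (B * `|clamp (- T) T s - clamp (- T) T t|)); last first.
    by apply: ler_wpM2l => //; exact: clamp_lipschitz.
  have := clamp_itv s TT; have := clamp_itv t TT.
  move: (clamp _ _ s) (clamp _ _ t) => a b aT bT.
  wlog ab : a b aT bT / b <= a => [H|].
    have [|/ltW] := leP b a; first exact: H.
    by rewrite distrC [`|a - b|]distrC; exact: H.
  have [x||x xab ->] := @MVT_segment R G0 g b a ab.
  - rewrite in_itv /= => /andP[x1 x2]; apply: DG; apply: inT; apply/andP; split; itv_lra.
  - apply: continuous_in_subspaceT => x; rewrite inE /= in_itv /= => xP.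
    apply: differentiable_continuous; apply/derivable1_diffP.
    have xT : `|x| < 2 * T by apply: inT; itv_lra.
    by have [] := DG x xT.
  - by rewrite normrM; apply: ler_pM.
Qed.

End Primitive.

Section Picard.
Context {R : realType} {N : nat}.
Variables (F : 'rV[R]_N -> 'rV[R]_N) (z0 : 'rV[R]_N) (T L B : R).
Hypotheses (T0 : 0 < T) (L0 : 0 <= L) (B0 : 0 <= B).
Hypothesis FB : forall z i, `|F z 0 i| <= B.
Hypothesis FL : forall z z' i, `|F z 0 i - F z' 0 i| <= L * `|z - z'|.

Let lip (v : R -> 'rV[R]_N) := forall i s t, `|v s 0 i - v t 0 i| <= B * `|s - t|.

Let rV_norm_le (y : 'rV[R]_N) (r : R) : 0 <= r -> (forall j, `|y 0 j| <= r) -> `|y| <= r.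
Proof.
move=> r0 yr; rewrite [leLHS]/Num.Def.normr /= mx_normrE; apply: bigmax_le => // -[i j] _.
by rewrite (ord1 i).
Qed.

Let picard_step (v v' : R -> 'rV[R]_N) := [/\ v' 0 = z0, lip v' &
  forall s i, `|s| < T -> is_derive (s : R^o) 1 (fun s : R^o => v' s 0 i : R^o) (F (v s) 0 i)].

Let exists_picard_step v : lip v -> exists v', picard_step v v'.
Proof.
move=> lv.
have cF i : continuous (fun s => F (v s) 0 i).
  move=> s; apply/cvgrPdist_lt => e e0.
  have LB1 : 0 < L * B + 1 by rewrite ltr_wpDl // mulr_ge0.
  apply/nbhs_ballP; exists (e / (L * B + 1)); first by rewrite /= divr_gt0.
  move=> t; rewrite /ball_ /= => st.
  apply: (@le_lt_trans _ _ (L * (B * `|s - t|))).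
    apply: le_trans (FL _ _ _) _; apply: ler_wpM2l => //.
    apply: rV_norm_le => [|j]; first by rewrite mulr_ge0.
    by rewrite !mxE; exact: lv.
  rewrite mulrA; apply: (@le_lt_trans _ _ ((L * B + 1) * `|s - t|)).
    by apply: ler_wpM2r => //; rewrite lerDl.
  by rewrite -ltr_pdivlMl // mulrC.
have /choice[G GP] i := exists_primitive T0 (cF i) (fun s => FB (v s) i).
exists (fun s => \row_i (z0 0 i + G i s)); split.
- by apply/rowP => i; rewrite !mxE; have [-> _ _] := GP i; rewrite addr0.
- move=> i s t; rewrite !mxE opprD addrACA subrr add0r.
  by have [_ _ +] := GP i; apply.
- move=> s i sT; have [_ /(_ s sT) D _] := GP i.
  have -> : (fun s : R^o => (\row_i (z0 0 i + G i s)) 0 i : R^o) =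
      (fun s : R^o => z0 0 i + G i s : R^o) by apply/funext => u; rewrite mxE.
  apply: (is_derive_conv (is_deriveD (is_derive_cst (z0 0 i : R^o) _ _) D)).
  by rewrite add0r.
Qed.

(** Successive approximations contract by the factor 1/2 in the sup norm weighted
    by exp (- 2 (L + 1) |s|). The length of the interval is thus unrelated to L,
    which matters because the existence time of the Hamiltonian flow must be
    uniform over covectors although the Lipschitz constants are not. *)
Lemma picard : exists u : R -> 'rV[R]_N, u 0 = z0 /\
  forall s i, `|s| < T / 2 ->
    is_derive (s : R^o) 1 (fun s : R^o => u s 0 i : R^o) (F (u s) 0 i).
Proof.
have T_gt0 := T0.
have h0 m : 0 <= 2^-1 ^+ m :> R by rewrite exprn_ge0 // invr_ge0.
have /choice[Phi PhiP] (v : {v | lip v}) : exists w : {v | lip v},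
    picard_step (sval v) (sval w).
  have [v' vP] := exists_picard_step (svalP v).
  by have [_ lv' _] := vP; exists (exist _ v' lv').
have lip0 : lip (fun=> z0) by move=> i s t; rewrite subrr normr0 mulr_ge0.
pose w n := iter n Phi (exist _ _ lip0); pose u n : R -> 'rV[R]_N := sval (w n).
have uS n : picard_step (u n) (u n.+1) by exact: PhiP.
have lu n : lip (u n) by exact: svalP.
have u0 n : u n 0 = z0 by case: n => // n; have [-> _ _] := uS n.
pose L' := L + 1; have L'0 : 0 < L' by rewrite ltr_wpDl.
pose b := 2 * L'; have b0 : 0 < b by rewrite mulr_gt0.
pose K := B * T.
have K0 : 0 <= K by rewrite mulr_ge0 // ltW.
have du n s : `|s| < T -> `|u n.+1 s - u n s| <= K * 2^-1 ^+ n * expR (b * `|s|).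
  elim: n s => [|n IH] s sT.
    rewrite expr0 mulr1; apply: (@le_trans _ _ K).
      apply: rV_norm_le => // j; rewrite !mxE.
      have -> : u 0%N s 0 j = u 1%N 0 0 j by rewrite u0.
      apply: le_trans (lu 1%N j s 0) _; rewrite subr0; apply: ler_wpM2l => //.
      exact: ltW.
    rewrite -[leLHS]mulr1; apply: ler_wpM2l => //.
    by rewrite -[leLHS]expR0 ler_expR mulr_ge0 // ltW.
  apply: rV_norm_le => [|j]; first exact: mulr_ge0 (mulr_ge0 K0 (h0 _)) (expR_ge0 _).
  rewrite !mxE.
  have a0 : 0 <= L' * (K * 2^-1 ^+ n) := mulr_ge0 (ltW L'0) (mulr_ge0 K0 (h0 n)).
  have := @exp_compare _ (fun s => u n.+2 s 0 j - u n.+1 s 0 j)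
    (fun s => F (u n.+1 s) 0 j - F (u n s) 0 j) T (L' * (K * 2^-1 ^+ n)) b b0 a0.
  have -> : L' * (K * 2^-1 ^+ n) / b = K * 2^-1 ^+ n.+1.
    by rewrite exprS /b; field; rewrite gt_eqF.
  apply => // [|{}s {}sT|{}s {}sT].
  - by rewrite !u0 subrr.
  - have [_ _ D2] := uS n.+1; have [_ _ D1] := uS n.
    exact: (is_deriveB (D2 s j sT) (D1 s j sT)).
  - apply: le_trans (FL _ _ _) _; rewrite -mulrA; apply: ler_pM => //.
      by rewrite lerDl.
    exact: IH.
pose W := expR (b * T).
have W0 : 0 <= W by exact: expR_ge0.
have KW0 : 0 <= 2 * (K * W) by rewrite mulr_ge0 // mulr_ge0.
have du' n s : `|s| < T -> `|u n.+1 s - u n s| <= K * W * 2^-1 ^+ n.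
  move=> sT; apply: le_trans (du n s sT) _; rewrite mulrAC; apply: ler_wpM2r.
    exact: h0.
  apply: ler_wpM2l => //; rewrite ler_expR; apply: ler_wpM2l; exact: ltW.
have dum n m s : `|s| < T -> `|u (n + m)%N s - u n s| <= 2 * (K * W) * 2^-1 ^+ n.
  move=> sT; apply: (@le_trans _ _ (2 * (K * W) * 2^-1 ^+ n * (1 - 2^-1 ^+ m))).
    elim: m => [|m IH]; first by rewrite addn0 subrr normr0 expr0 subrr mulr0.
    rewrite addnS -(subrKA (u (n + m)%N s)); apply: le_trans (ler_normD _ _) _.
    have := du' (n + m)%N s sT; move: IH; rewrite exprD exprS; set x := 2^-1 ^+ n.
    set y := 2^-1 ^+ m; set z := K * W; move=> IH H; apply: le_trans (lerD H IH) _.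
    lra.
  rewrite -[leRHS]mulr1; apply: ler_wpM2l; first exact: mulr_ge0 KW0 (h0 _).
  by rewrite gerBl h0.
pose cl := clamp (- (T / 2)) (T / 2).
have T2 : - (T / 2) <= T / 2 by lra.
have clT s : `|cl s| < T.
  by have := clamp_itv s T2; rewrite -/cl => /andP[? ?]; rewrite ltr_norml; apply/andP; split; lra.
have cvg_u s i : cvg ((fun n => u n (cl s) 0 i) @ \oo).
  apply: cauchy_cvg; apply: cauchy_exP => e e0.
  have : (fun n => 2 * (K * W) * 2^-1 ^+ n) @ \oo --> (0 : R).
    rewrite -[X in _ --> X](mulr0 (2 * (K * W))); apply: cvgMr.
    by apply: cvg_expr; rewrite ger0_norm // invf_lt1 // ltr1n.
  move=> /cvgrPdist_lt/(_ e e0)[n _ /(_ n (leqnn n))].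
  rewrite sub0r normrN => nP; exists (u n (cl s) 0 i).
  exists n => // m /= nm; rewrite -ball_normE /= distrC.
  apply: le_lt_trans nP; rewrite [leRHS]ger0_norm; last exact: mulr_ge0 KW0 (h0 _).
  apply: le_trans (dum n (m - n)%N (cl s) (clT s)); rewrite subnKC //.
  have := rV_norm_coord (u m (cl s) - u n (cl s)) i.
  by rewrite !mxE.
pose v s : 'rV[R]_N := \row_i lim ((fun n => u n (cl s) 0 i) @ \oo).
have vlim s i : (fun n => u n (cl s) 0 i) @ \oo --> v s 0 i by rewrite mxE; exact: cvg_u.
have vdist n s : `|v s - u n (cl s)| <= 2 * (K * W) * 2^-1 ^+ n.
  apply: rV_norm_le => [|j]; first exact: mulr_ge0 KW0 (h0 _).
  rewrite !mxE.
  have H : (fun m => `|u m (cl s) 0 j - u n (cl s) 0 j|) @ \oo -->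
      `|v s 0 j - u n (cl s) 0 j|.
    by apply: cvg_norm; apply: cvgB => //; exact: cvg_cst.
  have -> : lim ((fun n => u n (cl s) 0 j) @ \oo) = v s 0 j by rewrite mxE.
  rewrite -(cvg_lim (@Rhausdorff R) H); apply: limr_le; first exact: (cvgP _ H).
  exists n => // m /= nm.
  apply: le_trans (dum n (m - n)%N (cl s) (clT s)); rewrite subnKC //.
  have := rV_norm_coord (u m (cl s) - u n (cl s)) j.
  by rewrite !mxE.
have lv : lip v.
  move=> i s t.
  have H : (fun m => `|u m (cl s) 0 i - u m (cl t) 0 i|) @ \oo --> `|v s 0 i - v t 0 i|.
    by apply: cvg_norm; apply: cvgB.
  rewrite -(cvg_lim (@Rhausdorff R) H); apply: limr_le; first exact: (cvgP _ H).
  exists 0%N => // m _ /=.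
  apply: le_trans (lu m i _ _) _; apply: ler_wpM2l => //; exact: clamp_lipschitz.
have [v' [v'0 _ Dv']] := exists_picard_step lv.
have vv' s : `|s| < T / 2 -> v s = v' s.
  move=> sT; apply/rowP => i.
  have cs : cl s = s.
    by apply: clamp_id; move: sT; rewrite ltr_norml => /andP[? ?]; rewrite !ltW.
  have := vlim s i; rewrite cs => ul.
  suff : (fun n => u n.+1 s 0 i) @ \oo --> v' s 0 i.
    move=> H; move: ul; rewrite -(cvg_shiftS (fun n => u n s 0 i)) => ul.
    by rewrite -(cvg_lim (@Rhausdorff R) ul); exact: (cvg_lim (@Rhausdorff R) H).
  apply/cvgrPdist_lt => e e0.
  pose K2 := L' * (2 * (K * W)) / 1 * expR (1 * (T / 2)).
  have : (fun n => K2 * 2^-1 ^+ n) @ \oo --> (0 : R).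
    rewrite -[X in _ --> X](mulr0 K2); apply: cvgMr.
    by apply: cvg_expr; rewrite ger0_norm // invf_lt1 // ltr1n.
  move=> /cvgrPdist_lt/(_ e e0); apply: filterS => m.
  rewrite sub0r normrN => mP; apply: le_lt_trans mP; apply: le_trans (ler_norm _).
  have a0 : 0 <= L' * (2 * (K * W)) * 2^-1 ^+ m :=
    mulr_ge0 (mulr_ge0 (ltW L'0) KW0) (h0 m).
  have := @exp_compare _ (fun s => v' s 0 i - u m.+1 s 0 i)
    (fun s => F (v s) 0 i - F (u m s) 0 i) (T / 2) (L' * (2 * (K * W)) * 2^-1 ^+ m) 1
    ltr01 a0.
  move=> H; apply: le_trans (H _ _ _ s sT) _.
  - by rewrite v'0 u0 subrr.
  - move=> {H}s' s'T; have s'T2 : `|s'| < T by apply: lt_trans s'T _; lra.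
    have [_ _ D1] := uS m; exact: (is_deriveB (Dv' s' i s'T2) (D1 s' i s'T2)).
  - move=> {H}s' s'T; apply: le_trans (FL _ _ _) _.
    have cs' : cl s' = s'.
      by apply: clamp_id; move: s'T; rewrite ltr_norml => /andP[? ?]; rewrite !ltW.
    rewrite -[leLHS]mulr1; apply: ler_pM => //; first by rewrite mulr_ge0.
      rewrite -mulrA; apply: ler_pM => //; first by rewrite lerDl.
      by have := vdist m s'; rewrite cs'.
    by rewrite -[leLHS]expR0 ler_expR mul1r.
  rewrite /K2 !divr1 [leRHS]mulrAC; apply: ler_wpM2l; first exact: a0.
  by rewrite ler_expR !mul1r; exact: ltW.
exists v'; split=> // s i sT.
have sT2 : `|s| < T by apply: lt_trans sT _; lra.
by rewrite -(vv' s sT); exact: Dv'.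
Qed.

End Picard.

(** * Existence of the Hamiltonian flow, uniformly on unit covectors *)

Section Covector.
Context {R : realType} {n : nat} {M : manifold R n}.
Local Notation coordf c i := (fun r : M => chart_map c r 0 i).

(** The value 0 off the tangent space is the normalization of cotangent vectors. *)
Definition covector_fun (c : @chart R n M) (q : M) (p : 'rV[R]_n) (v : tvec M) : R^o :=
  if `[< tangent q v >] then \sum_i p 0 i * (v (coordf c i) : R) else 0.

Lemma covector_fun_cotangent c q p : covector_fun c q p \in cotangent_pred q.
Proof.
apply/asboolP; split=> [a u v tu tv|v tv]; rewrite /covector_fun; last by case: asboolP.
rewrite !asboolT //; last exact: tangent_lin.
rewrite mulr_sumr -big_split /=; apply: eq_bigr => i _.
by rewrite -[(a *: u + v) _]/(a * u _ + v _) mulrDr mulrCA.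
Qed.

Definition covector c q p : cotangent q := Cotangent (covector_fun_cotangent c q p).

Lemma covectorE c q p v : tangent q v ->
  covector c q p v = \sum_i p 0 i * (v (coordf c i) : R).
Proof. by move=> tv; rewrite /= /covector_fun asboolT. Qed.

Lemma covector_coord c q p i : atlas c -> dom c q ->
  covector c q p (coord_vec c i q) = p 0 i.
Proof.
move=> Ac cq; rewrite covectorE; last exact: tangent_coord_vec.
rewrite (bigD1 i) //= coord_vec_coord // eqxx mulr1 big1 ?addr0 // => j ji.
by rewrite coord_vec_coord // eq_sym (negbTE ji) mulr0.
Qed.

Lemma covectorK c q (l : cotangent q) : atlas c -> dom c q ->
  covector c q (\row_i l (coord_vec c i q)) = l.
Proof.
move=> Ac cq; apply/val_inj; apply/funext => v; have [tv|ntv] := pselect (tangent q v).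
  rewrite -[val _ v]/(covector c q (\row_i l (coord_vec c i q)) v) covectorE //.
  rewrite [RHS](tangent_vectorE Ac cq tv (cotangent_linear l)).
  by apply: eq_bigr => i _; rewrite mxE.
have /asboolP[_ l0] := cov_cotangent l.
by rewrite -[RHS]/(cov l v) l0 //= /covector_fun asboolF.
Qed.

End Covector.

Section BoxLemmas.
Context {R : realType}.

(** The mean value bound on u |-> f (u s). *)
Lemma derive_bound_dist2 (f df : R -> R) (s K : R) :
  (forall u, `|u| <= `|s| -> is_derive (u : R^o) 1 (f : R^o -> R^o) (df u)) ->
  (forall u, `|u| <= `|s| -> `|df u| <= K) -> `|f s - f 0| <= K * `|s|.
Proof.
move=> Df Kf.
have us u : 0 <= u <= 1 -> `|u * s| <= `|s|.
  by move=> /andP[u0 u1]; rewrite normrM (ger0_norm u0) ler_piMl.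
have := @derive_bound_dist _ (fun u => f (u * s)) (fun u => df (u * s) * s) 1 (K * `|s|) ler01.
rewrite mul1r mul0r mulr1; apply => u u01.
  have H : is_derive (u : R^o) 1 (fun u : R^o => u * s : R^o) s.
    apply: (is_derive_conv (is_derive_mul (is_derive_id (u : R^o) 1)
      (is_derive_cst (s : R^o) (u : R^o) 1))).
    by rewrite mulr0 add0r mulr1.
  exact: (@is_derive1_comp R f (fun u : R^o => u * s) u _ _ (Df _ (us u u01)) H).
by rewrite normrM ler_wpM2r //; apply: Kf; exact: us.
Qed.

Lemma derive0_constant2 (f : R -> R) (s : R) :
  (forall u, `|u| <= `|s| -> is_derive (u : R^o) 1 (f : R^o -> R^o) 0) -> f s = f 0.
Proof.
move=> Df; apply/eqP; rewrite -subr_eq0 -normr_le0 -[leRHS](mul0r `|s|).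
by apply: (derive_bound_dist2 Df) => u _; rewrite normr0.
Qed.

Context {N : nat}.

Definition box (z rad : 'rV[R]_N) : set 'rV[R]_N :=
  [set y | forall a, z 0 a - rad 0 a <= y 0 a <= z 0 a + rad 0 a].

Definition clamp_box (z rad y : 'rV[R]_N) : 'rV[R]_N :=
  \row_a clamp (z 0 a - rad 0 a) (z 0 a + rad 0 a) (y 0 a).

Lemma box_compact z rad : compact (box z rad).
Proof.
have -> : box z rad = [set y | forall a, `[z 0 a - rad 0 a, z 0 a + rad 0 a]%classic (y 0 a)].
  by apply/seteqP; split=> y H a; have := H a; rewrite /= in_itv.
apply: (@rV_compact R N (fun a => `[z 0 a - rad 0 a, z 0 a + rad 0 a]%classic)) => a.
exact: segment_compact.
Qed.

Lemma clamp_box_mem (z rad y : 'rV[R]_N) :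
  (forall a, 0 <= rad 0 a) -> box z rad (clamp_box z rad y).
Proof. by move=> rad0 a; rewrite mxE; apply: clamp_itv; have := rad0 a; lra. Qed.

Lemma clamp_box_id z rad y : box z rad y -> clamp_box z rad y = y.
Proof. by move=> by_; apply/rowP => a; rewrite mxE clamp_id. Qed.

Lemma clamp_box_lipschitz z rad y y' :
  `|clamp_box z rad y - clamp_box z rad y'| <= `|y - y'|.
Proof.
rewrite [leLHS]/Num.Def.normr /= mx_normrE; apply: bigmax_le => // -[i a] _.
rewrite (ord1 i) !mxE; apply: le_trans (clamp_lipschitz _ _ _ _) _.
by have := rV_norm_coord (y - y') a; rewrite !mxE.
Qed.

Lemma compact_bound (K : set 'rV[R]_N) (f : 'rV[R]_N -> R^o) : compact K ->
  (forall y, K y -> {for y, continuous f}) ->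
  exists2 b : R, 0 <= b & forall y, K y -> `|f y| <= b.
Proof.
move=> cK cf; have [K0|/eqP/set0P[y0 Ky0]] := pselect (K = set0).
  by exists 0 => // y; rewrite K0.
have cnf : {within K, continuous (fun y => `|f y| : R)}.
  apply: continuous_in_subspaceT => y; rewrite inE => Ky.
  by apply: continuous_comp; [exact: cf|exact: norm_continuous].
have [y Ky yP] := @EVT_max_rV R N (fun y => `|f y| : R) K (ex_intro _ y0 Ky0) cK cnf.
by exists `|f y| => // z Kz; apply: yP; rewrite inE.
Qed.

(** The box is compact, which bounds f and its partial derivatives, and convex. *)
Lemma smoothV_box (O : set 'rV[R]_N) (f : 'rV[R]_N -> R^o) z rad :
  smoothV O f -> box z rad `<=` O ->
  exists2 b : R, 0 <= b & (forall y, box z rad y -> `|f y| <= b) /\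
    forall y y', box z rad y -> box z rad y' -> `|f y - f y'| <= b * `|y - y'|.
Proof.
move=> sf bO; have cb := @box_compact z rad.
have [b b0 bP] : exists2 b : R, 0 <= b & forall y, box z rad y -> `|f y| <= b.
  by apply: compact_bound => // y /bO; exact: smoothV_continuous.
have /choice[d dP] a : exists d : R, 0 <= d /\
    forall y, box z rad y -> `|'D_(delta_mx 0 a) f y| <= d.
  have [d d0 dP] := @compact_bound _ ('D_(delta_mx 0 a) f) cb
    (fun y by_ => smoothV_continuous (smoothV_derive _ sf) (bO y by_)).
  by exists d.
pose d1 := \sum_a d a.
have d10 : 0 <= d1 by apply: sumr_ge0 => a _; have [] := dP a.
exists (b + N%:R * d1); first by rewrite addr_ge0 // mulr_ge0.
split=> [y by_|y y' by_ by'].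
  by apply: le_trans (bP y by_) _; rewrite lerDl mulr_ge0.
have H := @smoothV_lipschitz _ _ O (box z rad) f d1 sf bO.
apply: (@le_trans _ _ (N%:R * d1 * `|y - y'|)).
  apply: H => // [x1 x2 t K1 K2 t01 a|x1 a K1].
    by rewrite !mxE; have := K1 a; have := K2 a; move: t01 => /andP[? ?] /andP[? ?] /andP[? ?];
      apply/andP; split; nra.
  have [_ dPa] := dP a; apply: le_trans (dPa _ K1) _.
  by rewrite /d1 (bigD1 a) //= lerDl sumr_ge0 // => a' _; have [] := dP a'.
by apply: ler_wpM2r => //; rewrite lerDr.
Qed.

End BoxLemmas.

Section FlowExistence.
Context {R : realType} {n k : nat} {M : manifold R n}.
Variable S : sub_riemannian k M.
Variable C : M -> set (tvec M).
Hypothesis hC : complement S C.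
Variables (U : set M) (X : 'I_n -> M -> tvec M) (cs : 'I_n -> 'I_n -> 'I_n -> M -> R).
Hypothesis rX : regular_frame S C U X cs.
Implicit Types (p q : M) (z : 'rV[R]_(n + n)).
Local Notation coordf c i := (fun r : M => chart_map c r 0 i).

Variable c : @chart R n M.
Hypothesis Ac : atlas c.

Definition field_coord (j i : 'I_n) (x : 'rV[R]_n) : R^o := X j (param c x) (coordf c i).
Definition position z : 'rV[R]_n := \row_i z 0 (lshift n i).
Definition momenta z : 'rV[R]_n := \row_i z 0 (rshift n i).
Definition hor_momentum (j : 'I_n) z : R := \sum_i z 0 (rshift n i) * field_coord j i (position z).
Definition hamilton_dp (i : 'I_n) z : R :=
  \sum_(j < n | (j < k)%N) hor_momentum j z * field_coord j i (position z).
Definition hamilton_dx (i : 'I_n) z : R :=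
  \sum_(j < n | (j < k)%N) hor_momentum j z *
    \sum_m z 0 (rshift n m) * 'D_(delta_mx 0 i) (field_coord j m) (position z).
(** The Hamiltonian field is multiplied by 2 / (1 + 2 H). This factor is 1 on unit
    covectors, is conserved together with H, and keeps the horizontal speed
    bounded over all covectors. *)
Definition slow z : R := 2 / (1 + \sum_(j < n | (j < k)%N) hor_momentum j z * hor_momentum j z).
Definition slow_field z : 'rV[R]_(n + n) :=
  row_mx (\row_i (slow z * hamilton_dp i z)) (\row_i (- (slow z * hamilton_dx i z))).

Definition chart_region : set 'rV[R]_n := chart_map c @` (dom c `&` U).
Definition phase_region : set 'rV[R]_(n + n) := [set z | chart_region (position z)].

Let oU : open U := rf_open rX.
Let vX i : vector_field U (X i) := adapted_field hC (rf_adapted rX) i.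

Lemma chart_region_open : open chart_region.
Proof. exact: chart_image_open. Qed.

Lemma continuous_position : continuous position.
Proof.
move=> z; apply: differentiable_continuous; apply: differentiable_row => i.
have -> : (fun y => position y 0 i : R^o) = (fun y => y 0 (lshift n i) : R^o).
  by apply/funext => y; rewrite mxE.
exact: differentiable_coord.
Qed.

Lemma phase_region_open : open phase_region.
Proof. by apply: open_comp; [move=> z _; exact: continuous_position|exact: chart_region_open]. Qed.

Lemma field_coord_smooth j i : smoothV chart_region (field_coord j i).
Proof.
have H : smooth_on (dom c `&` U) (fun r => X j r (coordf c i)).
  apply: smooth_onP => p [cp Up]; apply: vector_field_smooth (vX j) Up _ => //.
  exact: smooth_at_coord.
apply: smoothV_subset (H c Ac) => _ [p [cp Up] <-].
by exists p.
Qed.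

Lemma smooth_position (f : 'rV[R]_n -> R^o) : smoothV chart_region f ->
  smoothV phase_region (fun z => f (position z)).
Proof.
move=> sf; apply: (smoothV_comp phase_region_open chart_region_open _ sf) => // i.
apply: (smoothV_ext phase_region_open _ (smoothV_coord _ (lshift n i))) => z _.
by rewrite mxE.
Qed.

Lemma hor_momentum_smooth j : smoothV phase_region (hor_momentum j).
Proof.
have oP := phase_region_open.
apply: smoothV_sum => // i _; apply: smoothVM => //; first exact: smoothV_coord.
exact: smooth_position (field_coord_smooth j i).
Qed.

Lemma slow_denom_gt0 z : 0 < 1 + \sum_(j < n | (j < k)%N) hor_momentum j z * hor_momentum j z.
Proof. by rewrite ltr_pwDl // sumr_ge0 // => j _; rewrite -expr2 sqr_ge0. Qed.

Lemma slow_field_smooth a : smoothV phase_region (fun z => slow_field z 0 a).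
Proof.
have oP := phase_region_open.
have ss : smoothV phase_region slow.
  apply: smoothVM => //; first exact: smoothV_cst.
  apply: smoothVV => // [z _|]; first by rewrite gt_eqF // slow_denom_gt0.
  apply: smoothVD => //; first exact: smoothV_cst.
  by apply: smoothV_sum => // j _; apply: smoothVM => //; exact: hor_momentum_smooth.
case: (split_ordP a) => i ->.
  apply: (@smoothV_ext _ _ _ (fun z => slow z * hamilton_dp i z)) => // [z _|].
    by rewrite row_mxEl mxE.
  apply: smoothVM => //; apply: smoothV_sum => // j _; apply: smoothVM => //.
    exact: hor_momentum_smooth.
  exact: smooth_position (field_coord_smooth j i).
apply: (@smoothV_ext _ _ _ (fun z => - 1 * (slow z * hamilton_dx i z))) => // [z _|].
  by rewrite row_mxEr mxE mulN1r.
apply: smoothVM => //; first exact: smoothV_cst.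
apply: smoothVM => //; apply: smoothV_sum => // j _; apply: smoothVM => //.
  exact: hor_momentum_smooth.
apply: smoothV_sum => // m _; apply: smoothVM => //; first exact: smoothV_coord.
exact: smooth_position (smoothV_derive _ (field_coord_smooth j m)).
Qed.

Lemma slow_momentum_le1 z (j : 'I_n) : (j < k)%N -> `|slow z * hor_momentum j z| <= 1.
Proof.
move=> jk; rewrite /slow mulrAC normrM normfV (gtr0_norm (slow_denom_gt0 z)).
rewrite ler_pdivrMr ?slow_denom_gt0 // mul1r.
rewrite (bigD1 j) //=; set S1 := \sum_(i | _) _.
have S0 : 0 <= S1 by apply: sumr_ge0 => i _; rewrite -expr2 sqr_ge0.
move: (hor_momentum j z) => h; rewrite ler_norml; apply/andP; split.
  have := sqr_ge0 (h + 1); rewrite expr2; lra.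
have := sqr_ge0 (h - 1); rewrite expr2; lra.
Qed.

(** The bound on the speed of the position is independent of the momentum, and the
    bound on that of the momentum is proportional to its size; this makes the
    existence time uniform. *)
Lemma slow_field_bounds z (B P : R) : 0 <= B -> 0 <= P ->
  (forall (j i m : 'I_n), `|field_coord j m (position z) : R| <= B /\
     `|'D_(delta_mx 0 i) (field_coord j m) (position z) : R| <= B) ->
  (forall m, `|z 0 (rshift n m)| <= P) ->
  forall i, `|slow_field z 0 (lshift n i)| <= n%:R * B /\
    `|slow_field z 0 (rshift n i)| <= n%:R * (n%:R * (P * B)).
Proof.
move=> B0 P0 HB HP i; rewrite row_mxEl row_mxEr !mxE normrN; split.
  rewrite mulr_sumr; apply: norm_sum_le => // j jk; rewrite mulrA normrM -[B]mul1r.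
  by apply: ler_pM => //; [exact: slow_momentum_le1|have [] := HB j i i].
rewrite mulr_sumr; apply: norm_sum_le => [|j jk]; first by rewrite !mulr_ge0.
rewrite mulrA normrM -[leRHS]mul1r; apply: ler_pM => //; first exact: slow_momentum_le1.
apply: norm_sum_le => [|m _]; first by rewrite mulr_ge0.
by rewrite normrM; apply: ler_pM => //; have [] := HB j i m.
Qed.

Section Solution.
Variables (u : R -> 'rV[R]_(n + n)) (t0 : R).
Hypothesis Du : forall s a, `|s| < t0 ->
  is_derive (s : R^o) 1 (fun s : R^o => u s 0 a : R^o) (slow_field (u s) 0 a).
Hypothesis uO : forall s, `|s| < t0 -> phase_region (u s).
Hypothesis u1 : \sum_(j < n | (j < k)%N) hor_momentum j (u 0) * hor_momentum j (u 0) = 1.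

Lemma solution_position s i : `|s| < t0 -> is_derive (s : R^o) 1
  (fun s : R^o => position (u s) 0 i : R^o) (slow (u s) * hamilton_dp i (u s)).
Proof.
move=> st; have -> : (fun s : R^o => position (u s) 0 i : R^o) =
  (fun s : R^o => u s 0 (lshift n i) : R^o) by apply/funext => v; rewrite mxE.
by apply: (is_derive_conv (Du _ st)); rewrite row_mxEl mxE.
Qed.

Lemma solution_momentum s i : `|s| < t0 -> is_derive (s : R^o) 1
  (fun s : R^o => u s 0 (rshift n i) : R^o) (- (slow (u s) * hamilton_dx i (u s))).
Proof. by move=> st; apply: (is_derive_conv (Du _ st)); rewrite row_mxEr mxE. Qed.

Lemma solution_hor_momentum s j : `|s| < t0 -> is_derive (s : R^o) 1
  (fun s : R^o => hor_momentum j (u s) : R^o)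
  (slow (u s) * \sum_m (u s 0 (rshift n m) * (\sum_i hamilton_dp i (u s) *
      'D_(delta_mx 0 i) (field_coord j m) (position (u s))) -
    hamilton_dx m (u s) * field_coord j m (position (u s)))).
Proof.
move=> st.
have H : is_derive (s : R^o) 1 (fun s : R^o => hor_momentum j (u s) : R^o)
  (\sum_m (u s 0 (rshift n m) * (\sum_i (slow (u s) * hamilton_dp i (u s)) *
      'D_(delta_mx 0 i) (field_coord j m) (position (u s))) +
    field_coord j m (position (u s)) * - (slow (u s) * hamilton_dx m (u s)))).
  apply: is_derive_big_sum => m _.
  have Hf : is_derive (s : R^o) 1 (fun s : R^o => field_coord j m (position (u s)) : R^o)
    (\sum_i (slow (u s) * hamilton_dp i (u s)) *
      'D_(delta_mx 0 i) (field_coord j m) (position (u s))).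
    apply: (is_derive_curve (f := field_coord j m)).
      exact: smoothV_differentiable (field_coord_smooth j m) (uO st).
    by move=> i; exact: solution_position.
  exact: is_derive_mul (solution_momentum m st) Hf.
apply: (is_derive_conv H); rewrite mulr_sumr; apply: eq_bigr => m _.
rewrite mulrBr; congr (_ + _); last by rewrite mulrN mulrC mulrA.
rewrite mulrCA; congr (_ * _); rewrite mulr_sumr; apply: eq_bigr => i _.
by rewrite mulrA.
Qed.

(** The slowed field is a multiple of the Hamiltonian field, hence conserves H; the
    curve solves Hamilton's equations because its factor remains 1. *)
Lemma solution_slow1 s : `|s| < t0 -> slow (u s) = 1.
Proof.
move=> st; pose E s := \sum_(j < n | (j < k)%N) hor_momentum j (u s) * hor_momentum j (u s).
suff -> : slow (u s) = 2 / (1 + 1) by rewrite -[1 + 1]/2 divff.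
congr (_ / (1 + _)); rewrite -[RHS]u1 -[LHS]/(E s) -[RHS]/(E 0).
apply: derive0_constant2 => v vs; have vt : `|v| < t0 by exact: le_lt_trans vs st.
pose dh j := slow (u v) * \sum_m (u v 0 (rshift n m) * (\sum_i hamilton_dp i (u v) *
      'D_(delta_mx 0 i) (field_coord j m) (position (u v))) -
    hamilton_dx m (u v) * field_coord j m (position (u v))).
have H : is_derive (v : R^o) 1 (E : R^o -> R^o)
    (\sum_(j < n | (j < k)%N) (hor_momentum j (u v) * dh j + hor_momentum j (u v) * dh j)).
  apply: is_derive_big_sum => j _.
  exact: is_derive_mul (solution_hor_momentum j vt) (solution_hor_momentum j vt).
apply: (is_derive_conv H); rewrite big_split /=.
suff -> : \sum_(j < n | (j < k)%N) hor_momentum j (u v) * dh j = 0 by rewrite addr0.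
transitivity (slow (u v) * (\sum_i hamilton_dp i (u v) * hamilton_dx i (u v) -
    \sum_m hamilton_dx m (u v) * hamilton_dp m (u v))); last first.
  rewrite (_ : \sum_i hamilton_dp i (u v) * _ = \sum_m hamilton_dx m (u v) * hamilton_dp m (u v)).
    by rewrite subrr mulr0.
  by apply: eq_bigr => i _; rewrite mulrC.
rewrite /dh; under eq_bigr do rewrite mulrCA.
rewrite -mulr_sumr; congr (_ * _).
under eq_bigr do rewrite sumrB mulrBr.
rewrite sumrB; congr (_ - _).
  under eq_bigr do (under eq_bigr do rewrite mulr_sumr; rewrite exchange_big mulr_sumr).
  rewrite exchange_big /=; apply: eq_bigr => i _; rewrite /hamilton_dx mulr_sumr.
  apply: eq_bigr => j _; rewrite mulrCA; congr (_ * _); rewrite mulr_sumr.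
  by apply: eq_bigr => m _; rewrite mulrCA.
under eq_bigr do rewrite mulr_sumr.
rewrite exchange_big /=; apply: eq_bigr => m _; rewrite /hamilton_dp mulr_sumr.
by apply: eq_bigr => j _; rewrite mulrCA.
Qed.

Definition solution_curve (s : R) : @cotangent_bundle R n M :=
  Tagged cotangent (covector c (param c (position (u s))) (momenta (u s))).

Lemma solution_flow s : `|s| < t0 -> flow_at S solution_curve s.
Proof.
move=> st; have [p [cp Up] px] := uO st.
have pE : param c (position (u s)) = p by rewrite -px chartK.
have cq : dom c (tag (solution_curve s)) by rewrite /= pE.
have Uq : U (tag (solution_curve s)) by rewrite /= pE.
have cx : {for s, continuous (fun s => position (u s))}.
  have : derivable ((fun s => position (u s)) : R^o -> 'rV[R]_n) s 1.
    by apply/derivable_mxP => i j; rewrite ord1; have [] := solution_position j st.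
  by move=> /derivable1_diffP /differentiable_continuous.
split.
  apply: continuous_comp; first exact: cx.
  by rewrite -px; exact: param_continuous.
have Ns : \forall v \near s, chart_region (position (u v)).
  have : nbhs (position (u s)) chart_region.
    by apply: open_nbhs_nbhs; split; [exact: chart_region_open|exact: uO].
  by move=> /cx.
exists c; split => //= i.
have hE j : momentum (X j) solution_curve s = hor_momentum j (u s).
  transitivity (covector c (param c (position (u s))) (momenta (u s))
    (X j (param c (position (u s))))); first by [].
  rewrite covectorE; last by have [tX _] := vX j; exact: tX.
  by apply: eq_bigr => m _; rewrite mxE.
have cE v i' : dom c (param c (position (u v))) ->
    tagged (solution_curve v) (coord_vec c i' (tag (solution_curve v))) = u v 0 (rshift n i').
  move=> cv; transitivity (covector c (param c (position (u v))) (momenta (u v))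
    (coord_vec c i' (param c (position (u v))))); first by [].
  by rewrite covector_coord // mxE.
have := flow_derivatives hC rX Uq Ac cq i; rewrite /= => -[-> ->].
split.
  apply: (near_eq_is_derive (f := fun v : R^o => position (u v) 0 i : R^o)).
    by apply: filterS Ns => v [r [cr Ur] <-]; rewrite chartK.
  apply: (is_derive_conv (solution_position i st)).
  by rewrite (solution_slow1 st) mul1r; apply: eq_bigr => j _; rewrite hE.
apply: (near_eq_is_derive (f := fun v : R^o => u v 0 (rshift n i) : R^o)).
  apply: filterS Ns => v [r [cr Ur] rv].
  by apply/esym/cE; rewrite -rv chartK.
apply: (is_derive_conv (solution_momentum i st)).
rewrite (solution_slow1 st) mul1r; congr (- _); apply: eq_bigr => j _; rewrite hE.
congr (_ * _); apply: eq_bigr => m _.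
rewrite -[X in X * _](cE s m cq).
congr (_ * _); rewrite coord_vecE; last first.
  by apply: vector_field_smooth (vX j) Uq _ => //; exact: smooth_at_coord.
by rewrite -px chartK.
Qed.

End Solution.

(** The slowed field is composed with the projection onto a box around the initial
    point, of fixed size for the position and of size 1 + |p0| for the momentum.
    The result is bounded and Lipschitz, so Picard's theorem applies, and by the
    speed bounds the solution stays in the box for a time independent of p0; until
    then the projection does nothing. *)
Lemma exists_chart_flow q : dom c q -> U q -> exists2 t0 : R, 0 < t0 &
  forall l : cotangent q, \sum_(j < n | (j < k)%N) l (X j q) * l (X j q) = 1 ->
  exists G : R -> @cotangent_bundle R n M, G 0 = Tagged cotangent l /\
    forall s, `|s| < t0 -> flow_at S G s.
Proof.
move=> cq Uq; pose x0 := chart_map c q.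
have Ox0 : chart_region x0 by exists q.
have /nbhs_ballP[r1 r10 r1P] : nbhs x0 chart_region.
  by apply: open_nbhs_nbhs; split; [exact: chart_region_open|].
pose r := r1 / 2; have r0 : 0 < r by rewrite /r divr_gt0.
have r_lt : r < r1 by rewrite /r; move: r10 => /=; lra.
pose xbox := box x0 (const_mx r).
have xboxO y : xbox y -> chart_region y.
  move=> xy; apply: r1P; rewrite -ball_normE /= distrC; apply: rV_norm_lt => // j.
  have := xy j; rewrite !mxE => xyj; apply: le_lt_trans r_lt.
  by rewrite ler_norml; move: xyj => /andP[? ?]; apply/andP; split; lra.
have cxb : compact xbox by exact: box_compact.
have /choice[b bP] (m : 'I_n * 'I_n * 'I_n) : exists b : R, 0 <= b /\ forall y, xbox y ->
    `|field_coord m.1.1 m.2 y : R| <= b /\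
    `|'D_(delta_mx 0 m.1.2) (field_coord m.1.1 m.2) y : R| <= b.
  have [b1 b10 b1P] := compact_bound cxb (fun y xy => smoothV_continuous
    (field_coord_smooth m.1.1 m.2) (xboxO y xy)).
  have [b2 b20 b2P] := compact_bound cxb (fun y xy => smoothV_continuous
    (smoothV_derive (delta_mx 0 m.1.2) (field_coord_smooth m.1.1 m.2)) (xboxO y xy)).
  exists (b1 + b2); split; first exact: addr_ge0.
  move=> y xy; split.
    by apply: le_trans (b1P y xy) _; rewrite lerDl.
  by apply: le_trans (b2P y xy) _; rewrite lerDr.
pose B := 1 + \sum_m b m.
have B0 : 0 < B by rewrite ltr_pwDl // sumr_ge0 // => m _; have [] := bP m.
have BP y j i m : xbox y -> `|field_coord j m y : R| <= B /\
    `|'D_(delta_mx 0 i) (field_coord j m) y : R| <= B.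
  move=> xy; have [_ H] := bP (j, i, m); have [H1 H2] := H y xy.
  have bB : b (j, i, m) <= B.
    rewrite /B (bigD1 (j, i, m)) //= addrCA lerDl addr_ge0 // sumr_ge0 // => m' _.
    by have [] := bP m'.
  by split; [exact: le_trans H1 bB|exact: le_trans H2 bB].
have n0 : 0 <= n%:R :> R by [].
pose t0 := Num.min (r / (1 + n%:R * B)) (1 / (1 + n%:R * (n%:R * (2 * B)))).
have d10 : 0 < 1 + n%:R * B by rewrite ltr_pwDl // mulr_ge0 // ltW.
have d20 : 0 < 1 + n%:R * (n%:R * (2 * B)) by rewrite ltr_pwDl // !mulr_ge0 // ltW.
have t00 : 0 < t0 by rewrite lt_min !divr_gt0.
exists t0 => // l l1.
pose p0 : 'rV[R]_n := \row_i l (coord_vec c i q).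
pose P := 1 + `|p0|; have P0 : 0 < P by rewrite ltr_pwDl.
pose z0 := row_mx x0 p0 : 'rV[R]_(n + n).
pose rad : 'rV[R]_(n + n) := row_mx (const_mx r) (const_mx P).
have rad0 a : 0 <= rad 0 a.
  by case: (split_ordP a) => i ->; rewrite ?row_mxEl ?row_mxEr mxE ltW.
have posb y : box z0 rad y -> xbox (position y).
  by move=> yb i; have := yb (lshift n i); rewrite !row_mxEl !mxE.
have boxO : box z0 rad `<=` phase_region by move=> y /posb/xboxO.
have momb y m : box z0 rad y -> `|y 0 (rshift n m)| <= 2 * P.
  move=> yb; have := yb (rshift n m); rewrite !row_mxEr !mxE.
  have : `|p0 0 m| <= `|p0| by exact: rV_norm_coord.
  rewrite mxE !ler_norml /P => /andP[? ?] /andP[? ?].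
  by have := normr_ge0 p0; move=> ?; apply/andP; split; lra.
pose F y := slow_field (clamp_box z0 rad y).
have inb y : box z0 rad (clamp_box z0 rad y) by exact: clamp_box_mem.
have FB y i : `|F y 0 (lshift n i)| <= n%:R * B /\
    `|F y 0 (rshift n i)| <= n%:R * (n%:R * (2 * P * B)).
  apply: slow_field_bounds => [||j i' m|m]; [exact: ltW|by rewrite mulr_ge0 // ltW| |].
    exact: BP (posb _ (inb y)).
  exact: momb.
have /choice[Lc LcP] a : exists d : R, 0 <= d /\ forall y y', box z0 rad y -> box z0 rad y' ->
    `|slow_field y 0 a - slow_field y' 0 a| <= d * `|y - y'|.
  by have [d d0 [_ dP]] := smoothV_box (slow_field_smooth a) boxO; exists d.
pose Bp := n%:R * B; pose Bm := n%:R * (n%:R * (2 * P * B)).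
have Bp0 : 0 <= Bp by rewrite mulr_ge0 // ltW.
have Bm0 : 0 <= Bm.
  do 2 apply: mulr_ge0 => //.
  by apply: mulr_ge0; [rewrite mulr_ge0 // ltW|exact: ltW].
have L0 : 0 <= \sum_a Lc a by apply: sumr_ge0 => a _; have [] := LcP a.
have FBB y a : `|F y 0 a| <= Bp + Bm.
  case: (split_ordP a) => i ->; have [H1 H2] := FB y i.
    by apply: le_trans H1 _; rewrite lerDl.
  by apply: le_trans H2 _; rewrite lerDr.
have FL y y' a : `|F y 0 a - F y' 0 a| <= (\sum_a Lc a) * `|y - y'|.
  have [La0 LaP] := LcP a; apply: le_trans (LaP _ _ (inb y) (inb y')) _.
  apply: ler_pM => //; last exact: clamp_box_lipschitz.
  by rewrite (bigD1 a) //= lerDl sumr_ge0 // => a' _; have [] := LcP a'.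
have T0 : 0 < 2 * t0 by rewrite mulr_gt0.
have [u [u0 Du]] := picard z0 T0 L0 (addr_ge0 Bp0 Bm0) FBB FL.
have t2 : 2 * t0 / 2 = t0 by rewrite mulrAC divff // mul1r.
rewrite t2 in Du.
have tr : Bp * t0 <= r.
  have : t0 <= r / (1 + Bp) by rewrite ge_min lexx.
  by rewrite ler_pdivlMr // mulrDr mulr1; lra.
have tP : Bm * t0 <= P.
  have : t0 <= 1 / (1 + n%:R * (n%:R * (2 * B))) by rewrite ge_min lexx orbT.
  rewrite ler_pdivlMr // mulrDr mulr1 => tle.
  have -> : Bm * t0 = P * (t0 * (n%:R * (n%:R * (2 * B)))) by rewrite /Bm; ring.
  by rewrite -[leRHS]mulr1; apply: ler_wpM2l; [exact: ltW|lra].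
have ub s : `|s| < t0 -> box z0 rad (u s).
  move=> st a.
  have K d : (forall y, `|F y 0 a| <= d) -> 0 <= d -> `|u s 0 a - z0 0 a| <= d * t0.
    move=> Fd d0; rewrite -u0; apply: (@le_trans _ _ (d * `|s|)).
      apply: (@derive_bound_dist2 _ (fun s => u s 0 a) (fun s => F (u s) 0 a)) => // v vs.
      by apply: Du; exact: le_lt_trans vs st.
    by apply: ler_wpM2l => //; exact: ltW.
  have : `|u s 0 a - z0 0 a| <= rad 0 a.
    case: (split_ordP a) K => i -> K.
      have -> : rad 0 (lshift n i) = r by rewrite /rad row_mxEl mxE.
      by apply: le_trans tr; apply: K => // y; have [] := FB y i.
    have -> : rad 0 (rshift n i) = P by rewrite /rad row_mxEr mxE.
    by apply: le_trans tP; apply: K => // y; have [] := FB y i.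
  by rewrite ler_norml => /andP[? ?]; apply/andP; split; lra.
(* Inside the box the solution follows the slowed field itself. *)
have Du' s a : `|s| < t0 ->
    is_derive (s : R^o) 1 (fun s : R^o => u s 0 a : R^o) (slow_field (u s) 0 a).
  move=> st; apply: (is_derive_conv (Du _ _ st)).
  by rewrite /F clamp_box_id //; exact: ub.
have uO s : `|s| < t0 -> phase_region (u s) by move=> /ub/boxO.
have pz : position z0 = x0 by apply/rowP => i; rewrite mxE row_mxEl.
have px : param c x0 = q by exact: chartK.
have u1 : \sum_(j < n | (j < k)%N) hor_momentum j (u 0) * hor_momentum j (u 0) = 1.
  rewrite -[RHS]l1 u0; apply: eq_bigr => j _.
  suff -> : hor_momentum j z0 = l (X j q) by [].
  have [tX _] := vX j.
  rewrite (tangent_vectorE Ac cq (tX q Uq) (cotangent_linear l)).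
  by apply: eq_bigr => m _; rewrite /field_coord pz px row_mxEr mxE.
exists (solution_curve u); split; last by move=> s; exact: solution_flow.
rewrite /solution_curve u0 pz.
have -> : momenta z0 = p0 by apply/rowP => i; rewrite mxE row_mxEr.
rewrite px; congr (Tagged _ _); exact: covectorK.
Qed.
End FlowExistence.

Lemma exists_flow {R : realType} {n k : nat} {M : manifold R n} (S : sub_riemannian k M)
    (C : M -> set (tvec M)) (U : set M) (X : 'I_n -> M -> tvec M)
    (cs : 'I_n -> 'I_n -> 'I_n -> M -> R) (q : M) :
  complement S C -> regular_frame S C U X cs -> U q -> exists2 t0 : R, 0 < t0 &
  forall l : cotangent q, \sum_(j < n | (j < k)%N) l (X j q) * l (X j q) = 1 ->
  exists G : R -> @cotangent_bundle R n M, G 0 = Tagged cotangent l /\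
    forall s, `|s| < t0 -> flow_at S G s.
Proof.
move=> hC rX Uq; have [c Ac cq] := atlas_cover q.
exact: (exists_chart_flow hC rX Ac cq Uq).
Qed.

Section SrExp.
Context {R : realType} {n k : nat} {M : manifold R n}.
Variable S : sub_riemannian k M.
Variable C : M -> set (tvec M).
Hypothesis hC : complement S C.
Variables (U : set M) (X : 'I_n -> M -> tvec M) (cs : 'I_n -> 'I_n -> 'I_n -> M -> R).
Hypothesis rX : regular_frame S C U X cs.

(** Integral curves up to time t exist by exists_flow, and flow_expansion holds for
    whichever of them sr_exp selects. *)
Lemma sr_exp_expansion (q : M) (phi : M -> R) : U q -> smooth_at q phi ->
  exists t0 K : R, [/\ 0 < t0, 0 <= K & forall (l : cotangent q) (t : R),
    \sum_(j < n | (j < k)%N) l (X j q) * l (X j q) = 1 -> 0 < t < t0 ->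
    `|phi (sr_exp S t l) - phi q - t * \sum_(i < n | (i < k)%N) l (X i q) * X i q phi -
      t ^+ 2 / 2 * \sum_(j < n | (j < k)%N) \sum_m flow_hessian (k := k) X cs phi j m q *
        (l (X j q) * l (X m q))| <=
    K * (\sum_m l (X m q) * l (X m q)) * t ^+ 3].
Proof.
move=> Uq sphi; have [t0 [K [t00 K0 H]]] := flow_expansion hC rX Uq sphi.
have [t1 t10 Ht] := exists_flow hC rX Uq.
exists (Num.min t0 (t1 / 2)), K; split => //; first by rewrite lt_min t00 divr_gt0.
move=> l t l1 /andP[tgt0]; rewrite lt_min => /andP[tt0 tt1].
rewrite /sr_exp; set Q := (X in xget q X).
have Q0 : exists p, Q p.
  have [G [G0 Gf]] := Ht l l1; exists (tag (G t)), (t1 / 2); split; first by rewrite divr_gt0.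
  exists G; split => // s; rewrite /= in_itv /= => /andP[s1 s2].
  by apply: Gf; rewrite ltr_norml; apply/andP; split; lra.
have [e [e0 [G [Gi G0 <-]]]] := xgetPex q Q0.
apply: (H l t e G) => //; first by rewrite !ltW.
Qed.

End SrExp.

(** * Comparison of integrals *)

Section HasIntegral.
Context {d : measure_display} {T : measurableType d} {R : realType}.
Variable mu : {measure set T -> \bar R}.
Implicit Types (f g : T -> R) (a b : R).

(** Integrability and value are bundled so that they propagate together. *)
Definition has_integral f a :=
  mu.-integrable setT (EFin \o f) /\ \int[mu]_x f x = a.

Lemma has_integral_ext f g a : (forall x, f x = g x) -> has_integral f a -> has_integral g a.
Proof. by move=> /funext ->. Qed.

Lemma has_integralD f g a b : has_integral f a -> has_integral g b ->
  has_integral (fun x => f x + g x) (a + b).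
Proof.
move=> [fi <-] [gi <-]; split; last by rewrite RintegralD.
rewrite (_ : EFin \o _ = (EFin \o f) \+ (EFin \o g))%E; first exact: integrableD.
exact/funext.
Qed.

Lemma has_integralZ f a c : has_integral f a -> has_integral (fun x => c * f x) (c * a).
Proof.
move=> [fi <-]; split; last by rewrite RintegralZl.
rewrite (_ : EFin \o _ = (fun x => c%:E * (EFin \o f) x))%E; first exact: integrableZl.
exact/funext.
Qed.

Lemma has_integralB f g a b : has_integral f a -> has_integral g b ->
  has_integral (fun x => f x - g x) (a - b).
Proof.
move=> fa gb; rewrite -[- b]mulN1r.
apply: has_integral_ext (has_integralD fa (has_integralZ (-1) gb)) => x.
by rewrite mulN1r.
Qed.

Lemma has_integral0 : has_integral (fun=> 0) 0.
Proof. by split; [exact: integrable0|rewrite Rintegral_cst // mul0r]. Qed.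

Lemma has_integral_sum (I : Type) (s : seq I) (P : pred I) (f : I -> T -> R) (a : I -> R) :
  (forall i, P i -> has_integral (f i) (a i)) ->
  has_integral (fun x => \sum_(i <- s | P i) f i x) (\sum_(i <- s | P i) a i).
Proof.
move=> fa; elim: s => [|i s IH].
  by rewrite big_nil; apply: has_integral_ext has_integral0 => x; rewrite big_nil.
rewrite big_cons; case: ifP => Pi.
  apply: has_integral_ext (has_integralD (fa i Pi) IH) => x.
  by rewrite big_cons Pi.
by apply: has_integral_ext IH => x; rewrite big_cons Pi.
Qed.

Lemma measurable_has_integral f a : has_integral f a -> measurable_fun setT f.
Proof. by move=> [/measurable_int/measurable_EFinP]. Qed.

Lemma le_has_integral f g a : measurable_fun setT f -> (forall x, `|f x| <= g x) ->
  has_integral g a -> exists b, has_integral f b.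
Proof.
move=> mf fg [gi _]; exists (\int[mu]_x f x); split => //.
apply: le_integrable gi => //; first exact/measurable_EFinP.
by move=> x _; rewrite /= lee_fin (le_trans (fg x)) // ler_norm.
Qed.

Section LowerIntegral.
Import HBNNSimple.
Variables (N : set T).
Hypotheses (mN : measurable N) (N0 : mu N = 0%E).
Variables (f u : T -> \bar R).
Hypotheses (f0 : forall x, (0 <= f x)%E) (u0 : forall x, (0 <= u x)%E).
Hypothesis mu_ : measurable_fun setT u.

(** The integral of a nonnegative function, measurable or not, is the supremum of
    the integrals of the simple functions below it. *)
Lemma lower_integral_le : (forall x, ~ N x -> (f x <= u x)%E) ->
  (\int[mu]_x f x <= \int[mu]_x u x)%E.
Proof.
move=> fu; rewrite (ge0_integralTE mu f0); apply: ge_ereal_sup => _ [h hf <-].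
rewrite -integralT_nnsfun; apply: ae_ge0_le_integral => //.
- by move=> x _; rewrite lee_fin.
- exact/measurable_EFinP.
exists N; split => // x /= Hx; apply: contrapT => Nx; apply: Hx => _.
exact: le_trans (hf x) (fu x Nx).
Qed.

Lemma lower_integral_ge : (forall x, ~ N x -> (u x <= f x)%E) ->
  (\int[mu]_x u x <= \int[mu]_x f x)%E.
Proof.
move=> uf; rewrite (ge0_negligible_integral mN) // setTD integral_mkcond.
have r0 x : (0 <= (u \_ (~` N)) x)%E by rewrite patchE; case: ifP.
rewrite (ge0_integralTE mu r0) (ge0_integralTE mu f0); apply: ge_ereal_sup => _ [h hf <-].
apply: ereal_sup_ubound; exists h => // x; apply: le_trans (hf x) _.
rewrite patchE; case: ifPn => //; rewrite inE; exact: uf.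
Qed.

End LowerIntegral.

(** The integral of f is squeezed between those of g - E and g + E. This is meant
    for sr_exp, which is defined by choice and possibly not measurable. *)
Lemma has_integral_dist (N : set T) f g E a b : measurable N -> mu N = 0%E ->
  has_integral g a -> has_integral E b -> (forall x, ~ N x -> `|f x - g x| <= E x) ->
  `|\int[mu]_x f x - a| <= b.
Proof.
move=> mN N0 ga Eb fg.
have [li la] := has_integralB ga Eb; have [ui ub] := has_integralD ga Eb.
have ml := measurable_int _ li; have mu_ := measurable_int _ ui.
have le1 x : ~ N x -> g x - E x <= f x <= g x + E x.
  by move=> /fg; rewrite ler_norml => /andP[? ?]; apply/andP; split; lra.
pose L := EFin \o (fun x => g x - E x); pose V := EFin \o (fun x => g x + E x).
pose F := EFin \o f.
have pL := lower_integral_ge mN N0 (f := F^\+%E) (u := L^\+%E) (funepos_ge0 _) (funepos_ge0 _)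
  (measurable_funepos ml).
have pV := lower_integral_le mN N0 (f := F^\+%E) (u := V^\+%E) (funepos_ge0 _) (funepos_ge0 _)
  (measurable_funepos mu_).
have nL := lower_integral_le mN N0 (f := F^\-%E) (u := L^\-%E) (funeneg_ge0 _) (funeneg_ge0 _)
  (measurable_funeneg ml).
have nV := lower_integral_ge mN N0 (f := F^\-%E) (u := V^\-%E) (funeneg_ge0 _) (funeneg_ge0 _)
  (measurable_funeneg mu_).
have max_mono (x y : \bar R) : (x <= y)%E -> (maxe x 0 <= maxe y 0)%E.
  by move=> xy; rewrite ge_max !le_max xy lexx orbT.
have {}pL : (\int[mu]_x L^\+ x <= \int[mu]_x F^\+ x)%E.
  by apply: pL => x /le1/andP[? _]; rewrite !funeposE; apply: max_mono; rewrite lee_fin.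
have {}pV : (\int[mu]_x F^\+ x <= \int[mu]_x V^\+ x)%E.
  by apply: pV => x /le1/andP[_ ?]; rewrite !funeposE; apply: max_mono; rewrite lee_fin.
have {}nL : (\int[mu]_x F^\- x <= \int[mu]_x L^\- x)%E.
  by apply: nL => x /le1/andP[? _]; rewrite !funenegE; apply: max_mono; rewrite lee_fin lerN2.
have {}nV : (\int[mu]_x V^\- x <= \int[mu]_x F^\- x)%E.
  by apply: nV => x /le1/andP[_ ?]; rewrite !funenegE; apply: max_mono; rewrite lee_fin lerN2.
have LF : (\int[mu]_x L x <= \int[mu]_x F x)%E.
  by rewrite integralE [leRHS]integralE; exact: leeB.
have FV : (\int[mu]_x F x <= \int[mu]_x V x)%E.
  by rewrite integralE [leRHS]integralE; exact: leeB.
have fL := integrable_fin_num measurableT li; have fV := integrable_fin_num measurableT ui.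
have fF : (\int[mu]_x F x)%E \is a fin_num.
  rewrite fin_numElt (lt_le_trans _ LF) /= ?(le_lt_trans FV) //.
    by rewrite ltey_eq fV.
  by rewrite ltNye_eq fL.
have rL : a - b <= \int[mu]_x f x by rewrite -la fine_le.
have rV : \int[mu]_x f x <= a + b by rewrite -ub fine_le.
by rewrite ler_norml; apply/andP; split; lra.
Qed.

End HasIntegral.

Section Probabilities.
Context {d : measure_display} {T : measurableType d} {R : realType}.
Variable P : probability T R.

Lemma has_integral_cst c : has_integral P (fun=> c) c.
Proof.
split; first exact: finite_measure_integrable_cst.
by rewrite Rintegral_cst //= probability_setT mulr1.
Qed.

Lemma has_integral_bounded (f : T -> R) (A : set T) c : measurable A -> P A = 1%E ->
  measurable_fun setT f -> (forall x, A x -> `|f x| <= c) -> exists b, has_integral P f b.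
Proof.
move=> mA PA mf fc; exists (\int[P]_x f x); split => //; apply/integrableP; split.
  exact/measurable_EFinP.
have c1 (x : T) : (0 <= (`|c|)%:E)%E by rewrite lee_fin.
have PN : P (~` A) = 0%E by rewrite probability_setC // PA subee.
apply: (@le_lt_trans _ _ (\int[P]_x (`|c|)%:E)%E); last first.
  by rewrite integral_cst //= probability_setT mule1 ltry.
apply: ae_ge0_le_integral => //.
  by apply: measurableT_comp => //; exact/measurable_EFinP.
exists (~` A); split; [exact: measurableC|exact: PN|].
move=> x /= Hx Ax; apply: Hx => _; rewrite lee_fin; apply: le_trans (fc x Ax) _.
exact: ler_norm.
Qed.

Lemma has_integral_ae_eq (f g : T -> R) (A : set T) a : measurable A -> P A = 1%E ->
  measurable_fun setT f -> (forall x, A x -> f x = g x) -> has_integral P g a ->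
  has_integral P f a.
Proof.
move=> mA PA mf fg gi.
have PN : P (~` A) = 0%E by rewrite probability_setC // PA subee.
have mNA : measurable (~` A) by exact: measurableC.
have fgN x : ~ (~` A) x -> `|f x - g x| <= 0.
  by move=> /contrapT Ax; rewrite fg // subrr normr0.
have v := has_integral_dist mNA PN gi (has_integral0 P) fgN.
split; last by apply/eqP; rewrite -subr_eq0 -normr_le0.
case: gi => /integrableP[mg gi] _; apply/integrableP; split; first exact/measurable_EFinP.
apply: le_lt_trans gi; apply: ae_ge0_le_integral => //.
- by apply: measurableT_comp => //; exact/measurable_EFinP.
- exact: measurableT_comp.
by exists (~` A); split => // x /= Hx Ax; apply: Hx => _; rewrite fg.
Qed.

Lemma has_integral_invariant (F : T -> T) (f : T -> R) a : measurable_fun setT F ->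
  (forall B, measurable B -> P (F @^-1` B) = P B) ->
  has_integral P f a -> has_integral P (f \o F) a.
Proof.
move=> mF FP [fi fa].
have mf := measurable_int _ fi.
have mfF : measurable_fun setT ((EFin \o f) \o F) by exact: measurableT_comp.
have inv (g : T -> \bar R) : (\int[pushforward P F]_x g x = \int[P]_x g x)%E.
  by apply: eq_measure_integral => B mB _; rewrite -[RHS]FP.
have ifF : P.-integrable setT ((EFin \o f) \o F).
  apply/integrableP; split => //.
  have := @ge0_integral_pushforward _ _ _ _ R F mF P setT (abse \o (EFin \o f)) measurableT.
  rewrite inv preimage_setT /comp => <- //; first by case/integrableP: fi.
  by apply: measurableT_comp.
split => //; rewrite -fa /Rintegral; congr fine; rewrite -[RHS]inv.
by rewrite (integral_pushforward mF mf) // preimage_setT.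
Qed.

End Probabilities.

Section Product.
Context {d1 d2 : measure_display} {T1 : measurableType d1} {T2 : measurableType d2}.
Context {R : realType} (P1 : probability T1 R) (P2 : probability T2 R).

(** Fubini. Constant factors give the integrals of functions of one variable. *)
Lemma has_integral_prod (f1 : T1 -> R) (f2 : T2 -> R) a1 a2 :
  has_integral P1 f1 a1 -> has_integral P2 f2 a2 ->
  has_integral (P1 \x P2)%E (fun z => f1 z.1 * f2 z.2) (a1 * a2).
Proof.
move=> h1 h2; have m1 := measurable_has_integral h1; have m2 := measurable_has_integral h2.
case: h1 h2 => i1 <- [i2 <-].
have mf : measurable_fun setT (EFin \o (fun z : T1 * T2 => f1 z.1 * f2 z.2)).
  apply/measurable_EFinP; apply: measurable_funM; apply: measurableT_comp => //.
have /integrableP[_ l1] := i1; have /integrableP[_ l2] := i2.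
have c2 : (\int[P2]_y `|(f2 y)%:E| = (\int[P2]_y `|f2 y|)%:E)%E.
  by rewrite /Rintegral fineK // ge0_fin_numE //; exact: integral_ge0.
have i12 : ((P1 \x P2)%E).-integrable setT (EFin \o (fun z : T1 * T2 => f1 z.1 * f2 z.2)).
  apply/integrable12ltyP => //.
  rewrite (_ : (\int[P1]_x _)%E = (\int[P1]_x ((\int[P2]_y `|f2 y|)%:E * `|(f1 x)%:E|))%E).
    rewrite ge0_integralZl //; first last.
    - by rewrite lee_fin; apply: Rintegral_ge0.
    - by apply: measurableT_comp => //; exact/measurable_EFinP.
    by rewrite lte_mul_pinfty // ?lee_fin ?Rintegral_ge0.
  apply: eq_integral => x _; rewrite -c2 muleC -ge0_integralZl //; last first.
    by apply: measurableT_comp => //; exact/measurable_EFinP.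
  by apply: eq_integral => y _; rewrite /= normrM.
split => //; rewrite /Rintegral -integral12_prod_meas1 //.
rewrite -[RHS]RintegralZr // /Rintegral; congr fine; apply: eq_integral => x _.
rewrite /fubini_F -/(Rintegral P2 setT f2) -RintegralZl //.
rewrite /Rintegral fineK //; apply: (integrable_fin_num measurableT).
exact: (integrableZl measurableT (f1 x) i2).
Qed.

End Product.

(** * Frames of the cotangent space *)

Lemma measurable_sum_cond d (T : measurableType d) (R : realType) (I : Type) (s : seq I)
    (P : pred I) (h : I -> T -> R) : (forall i, P i -> measurable_fun setT (h i)) ->
  measurable_fun setT (fun x => \sum_(i <- s | P i) h i x).
Proof.
move=> mh; elim: s => [|i s IH].
  rewrite (_ : (fun x : T => _) = fun=> 0); first exact: measurable_cst.
  by apply/funext => x; rewrite big_nil.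
case: (boolP (P i)) => Pi.
  rewrite (_ : (fun x : T => _) = fun x => h i x + \sum_(i <- s | P i) h i x).
    by apply: measurable_funD => //; exact: mh.
  by apply/funext => x; rewrite big_cons Pi.
rewrite (_ : (fun x : T => _) = fun x => \sum_(i <- s | P i) h i x) //.
by apply/funext => x; rewrite big_cons (negbTE Pi).
Qed.

Section CotangentFrame.
Context {R : realType} {n k : nat} {M : manifold R n}.
Variable S : sub_riemannian k M.
Variable C : M -> set (tvec M).
Hypothesis hC : complement S C.
Variables (U : set M) (X : 'I_n -> M -> tvec M) (q : M).
Hypotheses (aX : adapted_frame S C U X) (Uq : U q).
Local Notation D := (Defs.distribution S).
Local Notation e i := (X i q).
Implicit Types (l m : cotangent q).

Lemma cov_sum (I : Type) (r : seq I) (P : pred I) (a : I -> R) (F : I -> cotangent q) v :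
  (\sum_(i <- r | P i) a i *: F i : cotangent q) v = \sum_(i <- r | P i) a i * F i v.
Proof.
elim: r => [|i r IH]; first by rewrite !big_nil.
by rewrite !big_cons; case: (P i) => //; rewrite -IH.
Qed.

Lemma frame_tangent i : tangent q (e i).
Proof. by have [vX _] := adapted_tangent_frame hC aX; have [tX _] := vX i isT; exact: tX. Qed.

Lemma frame_decomposition v : tangent q v -> exists a : 'I_n -> R, v = \sum_i a i *: e i.
Proof.
have [_ /(_ q Uq)[sp _]] := adapted_tangent_frame hC aX.
by move=> /sp.
Qed.

Lemma exists_dual_frame : exists d : 'I_n -> cotangent q, forall i j, d i (e j) = (i == j)%:R.
Proof.
have /choice[a aP] v : exists a : 'I_n -> R, tangent q v -> v = \sum_i a i *: e i.
  have [/frame_decomposition[a ->]|ntv] := pselect (tangent q v); first by exists a.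
  by exists (fun=> 0).
have fr := adapted_tangent_frame hC aX.
have au v b : tangent q v -> v = \sum_i b i *: e i -> forall i, a v i = b i.
  by move=> tv vb i; apply: (frame_coefficients_unique fr Uq) i; rewrite -vb -aP.
have dP i : ((fun v => if `[< tangent q v >] then a v i else 0) : tvec M -> R^o)
    \in @cotangent_pred R n M q.
  apply/asboolP; split=> [b u v tu tv|v ntv]; last by rewrite asboolF.
  have tuv : tangent q (b *: u + v) by exact: tangent_lin.
  rewrite !asboolT //; apply: (au (b *: u + v) (fun j => b * a u j + a v j)) => //.
  rewrite {1}(aP u tu) {1}(aP v tv) scaler_sumr -big_split /=; apply: eq_bigr => j _.
  by rewrite scalerDl scalerA.
exists (fun i => Cotangent (dP i)) => i j; rewrite /= asboolT; last exact: frame_tangent.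
have := au (X j q) (fun m : 'I_n => (m == j)%:R : R) (frame_tangent j); apply.
rewrite (bigD1 j) //= eqxx scale1r big1 ?addr0 // => m /negbTE ->; exact: scale0r.
Qed.

Lemma complement_annihilatorP l :
  annihilator C l <-> forall i : 'I_n, (k <= i)%N -> l (e i) = 0.
Proof.
split=> [h i ki|h v Cv]; first by apply: h; exact: (adapted_complement aX).
have [_ [_ /(_ q Uq)[sp _]] _] := aX; have [a ->] := (sp v).1 Cv.
rewrite (_ : l _ = \sum_(i < n | (k <= i)%N) a i * l (e i)).
  by rewrite big1 // => i /h ->; rewrite mulr0.
by apply: tangent_linear_sum => [|i _]; [exact: cotangent_linear|exact: frame_tangent].
Qed.

Lemma distribution_annihilatorP l :
  annihilator D l <-> forall i : 'I_n, (i < k)%N -> l (e i) = 0.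
Proof.
split=> [h i ki|h v Dv]; first by apply: h; exact: (adapted_distribution aX).
have [[_ /(_ q Uq)[sp _]] _ _] := aX; have [a ->] := (sp v).1 Dv.
rewrite (_ : l _ = \sum_(i < n | (i < k)%N) a i * l (e i)).
  by rewrite big1 // => i /h ->; rewrite mulr0.
by apply: tangent_linear_sum => [|i _]; [exact: cotangent_linear|exact: frame_tangent].
Qed.

Lemma hamiltonian_frameE l :
  hamiltonian S q l = 2^-1 * \sum_(j < n | (j < k)%N) l (e j) * l (e j).
Proof.
rewrite (hamiltonianE (adapted_orthonormal_basis aX Uq) (cotangent_linear l)) (big_hor S).
by congr (_ * _); apply: eq_bigr => j _; rewrite expr2.
Qed.

Lemma unit_sphereP l : unit_sphere S C l <->
  (forall i : 'I_n, (k <= i)%N -> l (e i) = 0) /\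
  \sum_(j < n | (j < k)%N) l (e j) * l (e j) = 1.
Proof.
rewrite -complement_annihilatorP /unit_sphere /= hamiltonian_frameE.
by rewrite mulrA divff // mul1r.
Qed.

Lemma measurable_eval v : measurable_fun [set: cotangentB q]
  (fun l : cotangentB q => (l : cotangent q) v : R).
Proof.
move=> _ B mB; rewrite setTI; apply: sub_sigma_algebra.
by exists v, B.
Qed.

Lemma measurable_annihilator (P : pred 'I_n) :
  measurable ([set l | forall i, P i -> (l : cotangent q) (e i) = 0] : set (cotangentB q)).
Proof.
rewrite (_ : [set l | _] =
  \bigcap_(i in [set i | P i]) (fun l : cotangentB q => (l : cotangent q) (e i) : R) @^-1` [set 0]).
  apply: fin_bigcap_measurable => // i _; rewrite -[X in measurable X]setTI.
  by apply: measurable_eval => //; exact: measurable_set1.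
by apply/seteqP; split.
Qed.

Lemma measurable_unit_sphere : measurable (unit_sphere S C (q := q) : set (cotangentB q)).
Proof.
rewrite (_ : unit_sphere S C (q := q) =
  [set l : cotangentB q | forall i : 'I_n, (k <= i)%N -> (l : cotangent q) (e i) = 0] `&`
  (fun l : cotangentB q => \sum_(j < n | (j < k)%N) (l : cotangent q) (e j) * (l : cotangent q) (e j) : R)
    @^-1` [set 1]); last by apply/seteqP; split=> l /unit_sphereP.
apply: measurableI; first exact: (measurable_annihilator (fun i : 'I_n => (k <= i)%N)).
rewrite -[X in measurable X]setTI.
suff : measurable_fun [set: cotangentB q] (fun l : cotangentB q =>
    \sum_(j < n | (j < k)%N) (l : cotangent q) (e j) * (l : cotangent q) (e j) : R).
  by apply => //; exact: measurable_set1.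
apply: measurable_sum_cond => j _.
by apply: measurable_funM; exact: measurable_eval.
Qed.

(** Sign changes and permutations of the horizontal covectors of the dual frame are
    isometries; invariance under them determines the first two moments. *)
Lemma frame_isometry (eps : 'I_n -> R) (s : {perm 'I_n}) :
  (forall i, eps i * eps i = 1) -> (forall i, (s i < k)%N = (i < k)%N) ->
  exists F : {linear cotangent q -> cotangent q},
    [/\ forall l i, F l (e i) = eps i * l (e (s i)),
        measurable_fun [set: cotangentB q] (F : cotangentB q -> cotangentB q) &
        forall l, annihilator C l ->
          annihilator C (F l) /\ hamiltonian S q (F l) = hamiltonian S q l].
Proof.
move=> eps1 sk; have [d dP] := exists_dual_frame.
pose F l : cotangent q := \sum_i (eps i * l (e (s i))) *: d i.
have Flin : linear F.
  move=> a l m; rewrite /F scaler_sumr -big_split /=; apply: eq_bigr => i _.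
  transitivity ((eps i * (a * l (e (s i)) + m (e (s i)))) *: d i); first by [].
  by rewrite mulrDr scalerDl scalerA mulrCA.
pose FL : {linear cotangent q -> cotangent q} := HB.pack F (GRing.isLinear.Build _ _ _ _ F Flin).
have FE l i : F l (e i) = eps i * l (e (s i)).
  rewrite /F cov_sum (bigD1 i) //= dP eqxx mulr1 big1 ?addr0 // => j ji.
  by rewrite dP (negbTE ji) mulr0.
exists FL; split => //.
- suff : measurable_fun [set: cotangentB q] (F : cotangentB q -> cotangentB q) by [].
  apply: (@measurability _ _ (cotangentB q) (cotangentB q) _ _ (@cotangent_cylinders R n M q)) => //.
  move=> _ [_ [v [B [mB ->]]] <-].
  have -> : setT `&` F @^-1` [set l : cotangent q | B (l v)] =
    setT `&` (fun l : cotangentB q => \sum_i (eps i * (l : cotangent q) (e (s i))) * d i v : R) @^-1` B.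
    by apply/seteqP; split=> l; rewrite /= /F cov_sum.
  suff : measurable_fun [set: cotangentB q] (fun l : cotangentB q =>
    \sum_i (eps i * (l : cotangent q) (e (s i))) * d i v : R) by apply.
  apply: measurable_sum => i; apply: measurable_funM => //; apply: measurable_funM => //.
  exact: measurable_eval.
- move=> l /complement_annihilatorP h; split.
    apply/complement_annihilatorP => i ki; rewrite FE h ?mulr0 //.
    by rewrite leqNgt sk -leqNgt.
  rewrite !hamiltonian_frameE; congr (_ * _).
  rewrite [RHS](reindex_inj (@perm_inj _ s)) /=; apply: eq_big => [i|i _]; first by rewrite sk.
  by rewrite FE mulrACA eps1 mul1r.
Qed.

End CotangentFrame.

(** * Moments and the microscopic Laplacian *)

Section Moments.
Context {R : realType} {n k : nat} {M : manifold R n}.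
Variable S : sub_riemannian k M.
Variable C : M -> set (tvec M).
Hypothesis hC : complement S C.
Variables (U : set M) (X : 'I_n -> M -> tvec M) (q : M).
Hypotheses (aX : adapted_frame S C U X) (Uq : U q).
Local Notation D := (Defs.distribution S).
Local Notation e i := (X i q).
Local Notation co l i := ((l : cotangent q) (X i q) : R).

Section Sphere.
Variable PS : probability (cotangentB q) R.
Hypothesis PS1 : PS (unit_sphere S C (q := q)) = 1%E.
Hypothesis PSinv : forall F : {linear cotangent q -> cotangent q},
  (forall l, annihilator C l -> annihilator C (F l) /\ hamiltonian S q (F l) = hamiltonian S q l) ->
  forall B : set (cotangentB q), measurable B -> PS (F @^-1` B) = PS B.

Lemma has_integral_unique d (T : measurableType d) (mu : {measure set T -> \bar R})
  (f : T -> R) a b : has_integral mu f a -> has_integral mu f b -> a = b.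
Proof. by move=> [_ <-] [_ <-]. Qed.

(** For k = 0 the unit sphere is empty, and cannot have measure 1. *)
Lemma sphere_rank_gt0 : (0 < k)%N.
Proof.
rewrite lt0n; apply/negP => /eqP k0.
suff s0 : unit_sphere S C (q := q) = set0 by move: PS1; rewrite s0 measure0 => /eqP; rewrite lt_eqF.
apply/seteqP; split=> // l /(unit_sphereP hC aX Uq)[_].
by rewrite big_pred0 => [/eqP|j]; rewrite ?k0 // eq_sym oner_eq0.
Qed.

Lemma sphere_coord_le1 (l : cotangent q) (j : 'I_n) : unit_sphere S C l -> (j < k)%N ->
  `|l (e j) : R| <= 1.
Proof.
move=> /(unit_sphereP hC aX Uq)[_ +] jk; rewrite (bigD1 (j : 'I_n)) //= => l1.
set S1 := (X in _ + X) in l1.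
have S0 : 0 <= S1 by apply: sumr_ge0 => i _; rewrite -expr2 sqr_ge0.
move: (l (e j) : R) S1 S0 l1 => x S1 S0 l1.
have := sqr_ge0 (x - 1); have := sqr_ge0 (x + 1).
by rewrite !expr2 ler_norml => ? ?; apply/andP; split; nra.
Qed.

Lemma sphere_integrable1 (j : 'I_n) : (j < k)%N -> exists a, has_integral PS (fun l => co l j) a.
Proof.
move=> jk; apply: (has_integral_bounded (measurable_unit_sphere hC aX Uq) PS1 (c := 1)).
  exact: measurable_eval.
by move=> l sl; exact: sphere_coord_le1.
Qed.

Lemma sphere_integrable2 (i j : 'I_n) : (i < k)%N -> (j < k)%N ->
  exists a, has_integral PS (fun l => co l i * co l j) a.
Proof.
move=> ik jk; apply: (has_integral_bounded (measurable_unit_sphere hC aX Uq) PS1 (c := 1)).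
  by apply: measurable_funM; exact: measurable_eval.
move=> l sl; rewrite normrM -[leRHS]mul1r.
by apply: ler_pM => //; exact: sphere_coord_le1.
Qed.

(** Invariance under the antipodal map. *)
Lemma sphere_moment1 (j : 'I_n) : (j < k)%N -> has_integral PS (fun l => co l j) 0.
Proof.
move=> jk; have [a ha] := sphere_integrable1 jk.
have N1 (i : 'I_n) : (- 1) * (- 1) = 1 :> R by rewrite mulrNN mulr1.
have [F [FE mF Fi]] := @frame_isometry _ _ _ _ S C hC U X q aX Uq (fun=> -1) 1%g
  N1 (fun i => congr1 (fun i : 'I_n => (i < k)%N) (perm1 i)).
have h1 := has_integral_invariant mF (PSinv Fi) ha.
have a0 : a = - 1 * a.
  apply: has_integral_unique h1 _; apply: has_integral_ext (has_integralZ (-1) ha) => l /=.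
  by rewrite FE perm1.
by clear N1; have E : (a : R) = 0 by [lra]; rewrite E in ha.
Qed.

(** The sign change of X_i kills the moment for j <> i, the transposition of X_i
    and X_j makes the diagonal moments equal, and their sum is the integral of
    2 H = 1. *)
Lemma sphere_moment2 (i j : 'I_n) : (i < k)%N -> (j < k)%N ->
  has_integral PS (fun l => co l i * co l j) ((i == j)%:R / k%:R).
Proof.
move=> ik jk; have [ij|ij] := eqVneq i j; last first.
  have [a ha] := sphere_integrable2 ik jk.
  pose eps m : R := if m == i then -1 else 1.
  have eps1 m : eps m * eps m = 1 by rewrite /eps; case: ifP => _; rewrite ?mulrNN mulr1.
  have [F [FE mF Fi]] := @frame_isometry _ _ _ _ S C hC U X q aX Uq eps 1%g eps1
    (fun i => congr1 (fun i : 'I_n => (i < k)%N) (perm1 i)).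
  have h1 := has_integral_invariant mF (PSinv Fi) ha.
  have h2 := has_integralZ (-1) ha.
  have a0 : a = - 1 * a.
    apply: has_integral_unique h1 _; apply: has_integral_ext h2 => l /=.
    by rewrite !FE !perm1 /eps eqxx eq_sym (negbTE ij) mul1r !mulN1r mulNr.
  by rewrite mul0r; have -> : 0 = a by lra.
rewrite -{}ij {j jk} mul1r.
have /choice[v vP] (j : 'I_n) : exists a, (j < k)%N -> has_integral PS (fun l => co l j * co l j) a.
  have [jk|jk] := boolP (j < k)%N; last by exists 0.
  by have [a ha] := sphere_integrable2 jk jk; exists a.
have vi (j : 'I_n) : (j < k)%N -> v j = v i.
  move=> jk.
  have sk m : (tperm i j m < k)%N = (m < k)%N by case: tpermP => [->|->|//]; rewrite ik jk.
  have [F [FE mF Fi]] := @frame_isometry _ _ _ _ S C hC U X q aX Uq (fun=> 1) (tperm i j)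
    (fun=> mulr1 1) sk.
  have h1 := has_integral_invariant mF (PSinv Fi) (vP i ik).
  apply: has_integral_unique (vP j jk) _; apply: has_integral_ext h1 => l /=.
  by rewrite !FE tpermL !mul1r.
have s1 : has_integral PS (fun l => \sum_(j < n | (j < k)%N) co l j * co l j) 1.
  apply: (has_integral_ae_eq (measurable_unit_sphere hC aX Uq) PS1 _ _ (has_integral_cst PS 1)).
    by apply: measurable_sum_cond => j _; apply: measurable_funM; exact: measurable_eval.
  by move=> l /(unit_sphereP hC aX Uq)[].
have : k%:R * v i = 1.
  apply: has_integral_unique s1.
  have -> : k%:R * v i = \sum_(j < n | (j < k)%N) v j.
    rewrite (eq_bigr (fun=> v i)) => [|j]; last exact: vi.
    by rewrite (big_hor S) sumr_const card_ord mulr_natl.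
  by apply: has_integral_sum => j; exact: vP.
have k0 : (k%:R : R) != 0 by rewrite pnatr_eq0 -lt0n sphere_rank_gt0.
move=> kv; have -> : k%:R^-1 = v i by apply: (mulfI k0); rewrite kv divff.
exact: vP.
Qed.

End Sphere.

Section Product.
Variables (PS PV : probability (cotangentB q) R).
Hypothesis PS1 : PS (unit_sphere S C (q := q)) = 1%E.
Hypothesis PSinv : forall F : {linear cotangent q -> cotangent q},
  (forall l, annihilator C l -> annihilator C (F l) /\ hamiltonian S q (F l) = hamiltonian S q l) ->
  forall B : set (cotangentB q), measurable B -> PS (F @^-1` B) = PS B.
Hypothesis PV1 : PV (annihilator D (q := q)) = 1%E.
Hypothesis PV2 : forall v, tangent q v ->
  PV.-integrable setT (fun l : cotangentB q => (((l : cotangent q) v : R) ^+ 2)%:E).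

Lemma vertical_moment2 i : exists a, has_integral PV (fun l => co l i * co l i) a.
Proof.
exists (\int[PV]_l (co l i * co l i)); split => //.
exact: PV2 (frame_tangent hC aX Uq i).
Qed.

Lemma vertical_moment1 i : exists a, has_integral PV (fun l => co l i) a.
Proof.
have [a ha] := vertical_moment2 i.
apply: (le_has_integral _ _ (has_integralD (has_integral_cst PV 1) ha)).
  exact: measurable_eval.
move=> l; move: (co l i) => x; have := sqr_ge0 (x - 1); have := sqr_ge0 (x + 1).
by rewrite !expr2 ler_norml => ? ?; apply/andP; split; nra.
Qed.

(** At order t^2 each term has a horizontal factor. The horizontal second moments
    are delta_ij / k, and the mixed ones vanish because the horizontal and vertical
    parts are independent and the former are centered. The vertical measure only
    enters the error, through its second moments. *)
Lemma integral_Cq_estimate : exists W : R, forall (f : cotangent q -> R) (A : 'I_n -> R)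
    (B : 'I_n -> 'I_n -> R) (K t : R),
  (forall l : cotangent q, \sum_(j < n | (j < k)%N) l (e j) * l (e j) = 1 ->
     `|f l - t * \sum_(i < n | (i < k)%N) l (e i) * A i -
       t ^+ 2 / 2 * \sum_(j < n | (j < k)%N) \sum_m B j m * (l (e j) * l (e m))| <=
     K * (\sum_m l (e m) * l (e m)) * t ^+ 3) ->
  `|\int[(PS \x PV)%E]_z f ((z.1 : cotangent q) + (z.2 : cotangent q)) -
    t ^+ 2 / 2 * (k%:R^-1 * \sum_(j < n | (j < k)%N) B j j)| <= K * W * t ^+ 3.
Proof.
have /choice[w wP] i := vertical_moment2 i.
have /choice[v vP] i := vertical_moment1 i.
pose P : probability _ R := (PS \x PV)%E.
have hor f a : has_integral PS f a -> has_integral P (fun z => f z.1) a.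
  move=> fa; rewrite -[a]mulr1.
  by apply: has_integral_ext (has_integral_prod fa (has_integral_cst PV 1)) => z; exact: mulr1.
have ver f a : has_integral PV f a -> has_integral P (fun z => f z.2) a.
  move=> fa; rewrite -[a]mul1r.
  by apply: has_integral_ext (has_integral_prod (has_integral_cst PS 1) fa) => z; exact: mul1r.
pose mom (j m : 'I_n) (z : cotangentB q * cotangentB q) : R :=
  if (m < k)%N then co z.1 j * co z.1 m else co z.1 j * co z.2 m.
have momP (j m : 'I_n) : (j < k)%N -> has_integral P (mom j m) ((j == m)%:R / k%:R).
  move=> jk; rewrite /mom; case: (boolP (m < k)%N) => mk.
    by apply: (hor (fun l => co l j * co l m)); exact: sphere_moment2.
  have -> : (j == m) = false by apply/eqP => jm; rewrite -jm jk in mk.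
  by have := has_integral_prod (sphere_moment1 PS1 PSinv jk) (vP m); rewrite !mul0r.
pose nrm (m : 'I_n) (z : cotangentB q * cotangentB q) : R :=
  if (m < k)%N then co z.1 m * co z.1 m else co z.2 m * co z.2 m.
have /choice[u uP] m : exists a, has_integral P (nrm m) a.
  rewrite /nrm; case: (boolP (m < k)%N) => mk.
    exists ((m == m)%:R / k%:R).
    by apply: (hor (fun l => co l m * co l m)); exact: sphere_moment2.
  by exists (w m); apply: (ver (fun l => co l m * co l m)); exact: wP.
(* The comparison functions are written with z.1 on horizontal arguments and z.2 on
   vertical ones; they agree with the sum z.1 + z.2 on a set of full measure. *)
exists (\sum_m u m) => f A B K t fP.
have hE : has_integral P (fun z => t ^+ 3 * (K * \sum_m nrm m z)) (t ^+ 3 * (K * \sum_m u m)).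
  by do 2 apply: has_integralZ; apply: has_integral_sum => m _; exact: uP.
have hA : has_integral P (fun z => t * \sum_(i < n | (i < k)%N) A i * co z.1 i)
    (t * \sum_(i < n | (i < k)%N) A i * 0).
  apply: has_integralZ; apply: has_integral_sum => i ik; apply: has_integralZ.
  by apply: (hor (fun l => co l i)); exact: sphere_moment1.
have hB : has_integral P
    (fun z => t ^+ 2 / 2 * \sum_(j < n | (j < k)%N) \sum_m B j m * mom j m z)
    (t ^+ 2 / 2 * \sum_(j < n | (j < k)%N) \sum_m B j m * ((j == m)%:R / k%:R)).
  apply: has_integralZ; apply: has_integral_sum => j jk; apply: has_integral_sum => m _.
  by apply: has_integralZ; exact: momP.
pose Z := unit_sphere S C (q := q) `*` annihilator D (q := q) : set (cotangentB q * cotangentB q).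
have mS := measurable_unit_sphere hC aX Uq.
have mA : measurable (annihilator D (q := q) : set (cotangentB q)).
  rewrite (_ : annihilator D (q := q) =
    [set l : cotangentB q | forall i : 'I_n, (i < k)%N -> (l : cotangent q) (e i) = 0]).
    exact: (@measurable_annihilator R n M X q (fun i : 'I_n => (i < k)%N)).
  by apply/seteqP; split=> l /(distribution_annihilatorP hC aX Uq).
have mZ : measurable Z by exact: measurableX.
have PZ : P Z = 1%E.
  transitivity (PS (unit_sphere S C (q := q)) * PV (annihilator D (q := q)))%E.
    exact: product_measure1E.
  by rewrite PS1 PV1 mule1.
have N0 : P (~` Z) = 0%E by rewrite probability_setC // PZ subee.
have mN : measurable (~` Z) by exact: measurableC.
have := has_integral_dist (f := fun z : cotangentB q * cotangentB q =>
  f ((z.1 : cotangent q) + (z.2 : cotangent q))) mN N0 (has_integralD hA hB) hE.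
have -> : t * (\sum_(i < n | (i < k)%N) A i * 0) +
    t ^+ 2 / 2 * (\sum_(j < n | (j < k)%N) \sum_m B j m * ((j == m)%:R / k%:R)) =
    t ^+ 2 / 2 * (k%:R^-1 * \sum_(j < n | (j < k)%N) B j j).
  rewrite big1 => [|i _]; last by rewrite mulr0.
  rewrite mulr0 add0r; congr (_ * _); rewrite mulr_sumr; apply: eq_bigr => j _.
  rewrite (bigD1 j) //= eqxx mul1r big1 ?addr0 1?mulrC // => m /negbTE mj.
  by rewrite eq_sym mj mul0r mulr0.
rewrite [K * _ * _]mulrC; apply => -[s l] /contrapT[/= Ss Al].
have [s0 s1] := (unit_sphereP hC aX Uq s).1 Ss.
have l0 := (distribution_annihilatorP hC aX Uq l).1 Al.
have sl i : (s + l : cotangent q) (e i) = if (i < k)%N then s (e i) else l (e i).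
  transitivity (s (e i) + l (e i) : R); first by [].
  by case: (ltnP i k) => ik; [rewrite l0 // addr0|rewrite s0 // add0r].
have h1 : \sum_(j < n | (j < k)%N) (s + l : cotangent q) (e j) * (s + l : cotangent q) (e j) = 1.
  by rewrite -[RHS]s1; apply: eq_bigr => j jk; rewrite sl jk.
have := fP _ h1; rewrite opprD addrA.
have -> : \sum_(i < n | (i < k)%N) (s + l : cotangent q) (e i) * A i =
    \sum_(i < n | (i < k)%N) A i * s (e i).
  by apply: eq_bigr => i ik; rewrite sl ik mulrC.
have -> : \sum_(j < n | (j < k)%N) \sum_m
      B j m * ((s + l : cotangent q) (e j) * (s + l : cotangent q) (e m)) =
    \sum_(j < n | (j < k)%N) \sum_m B j m * mom j m (s, l).
  apply: eq_bigr => j jk; apply: eq_bigr => m _; congr (_ * _).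
  by rewrite !sl jk /mom; case: ifP.
have -> : \sum_m (s + l : cotangent q) (e m) * (s + l : cotangent q) (e m) =
    \sum_m nrm m (s, l).
  by apply: eq_bigr => m _; rewrite !sl /nrm; case: ifP.
by rewrite [X in _ <= X -> _]mulrC.
Qed.

End Product.
End Moments.

Lemma quadratic_limit (R : realType) (F : R -> R) (c L K t0 : R) : 0 < t0 ->
  (forall t, 0 < t < t0 -> `|F t - t ^+ 2 * L| <= K * t ^+ 3) ->
  lim ((fun t : R => c / t ^+ 2 * F t) @ 0^'+) = c * L.
Proof.
move=> t00 FL; apply: cvg_lim => //; apply/cvgrPdist_le => eps eps0.
have b0 : 0 < 1 + `|c| * `|K| by rewrite ltr_pwDl // mulr_ge0.
near=> t.
have tp : 0 < t by near: t; exact: nbhs_right_gt.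
have tt0 : t < t0 by near: t; exact: nbhs_right_lt.
have te : t < eps / (1 + `|c| * `|K|) by near: t; apply: nbhs_right_lt; rewrite divr_gt0.
have t2 : t ^+ 2 != 0 by rewrite expf_neq0 // gt_eqF.
have -> : c * L - c / t ^+ 2 * F t = - (c / t ^+ 2 * (F t - t ^+ 2 * L)) by field.
rewrite normrN normrM normrM normfV (ger0_norm (exprn_ge0 2 (ltW tp))).
apply: (@le_trans _ _ (`|c| / t ^+ 2 * (`|K| * t ^+ 3))).
  apply: ler_wpM2l; first by rewrite divr_ge0 // exprn_ge0 // ltW.
  have tt : 0 < t < t0 by rewrite tp tt0.
  apply: le_trans (FL t tt) _; apply: ler_wpM2r; last exact: ler_norm.
  by rewrite exprn_ge0 // ltW.
have -> : `|c| / t ^+ 2 * (`|K| * t ^+ 3) = `|c| * `|K| * t by field.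
move: te; rewrite ltr_pdivlMr // => te.
by apply: le_trans (ltW te); rewrite mulrDr mulr1 [t * _]mulrC lerDr ltW.
Unshelve. all: by end_near.
Qed.

Section MicroLaplacian.
Context {R : realType} {n k : nat} {M : manifold R n}.
Variable S : sub_riemannian k M.
Variable C : M -> set (tvec M).
Hypothesis hC : complement S C.
Variables (muS muV : forall q : M, probability (cotangentB q) R).
Hypotheses (hS : uniform_on_sphere S C muS) (hV : admissible_vertical S muS muV).
Variables (U : set M) (X : 'I_n -> M -> tvec M) (cs : 'I_n -> 'I_n -> 'I_n -> M -> R).
Hypothesis rX : regular_frame S C U X cs.

(** Averaging kills the term of order t and replaces the quadratic form
    flow_hessian by its horizontal trace divided by k; this trace is the frame
    expression of the operator. *)
Lemma micro_laplacianE phi q : U q -> smooth_at q phi ->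
  micro_laplacian S muS muV phi q = micro_frame (k := k) X cs phi q.
Proof.
move=> Uq sphi; have [PS1 PSinv] := hS q; have [PV1 PV2 _] := hV.
have aX := rf_adapted rX.
have [t0 [K [t00 K0 H]]] := sr_exp_expansion hC rX Uq sphi.
have [W HW] := integral_Cq_estimate hC aX Uq PS1 PSinv (PV1 q) (PV2 q).
have k0 : (k%:R : R) != 0 by rewrite pnatr_eq0 -lt0n (sphere_rank_gt0 hC aX Uq PS1).
rewrite /micro_laplacian /integral_Cq.
rewrite (@quadratic_limit R _ _ (2^-1 * (k%:R^-1 * \sum_(j < n | (j < k)%N)
  flow_hessian (k := k) X cs phi j j q)) (K * W) t0) //; last first.
  move=> t tt; rewrite [X in _ - X]mulrA.
  apply: (HW (fun l => phi (sr_exp S t l) - phi q) (fun i => X i q phi)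
    (fun j m => flow_hessian (k := k) X cs phi j m q) K t) => l l1.
  exact: H.
have cancel_factors (s : R) : (2 * k)%:R * (2^-1 * (k%:R^-1 * s)) = s by rewrite natrM; field.
rewrite cancel_factors.
rewrite /micro_frame /flow_hessian big_split /=; congr (_ + _).
  by apply: eq_bigr => j ->.
by rewrite exchange_big /=; apply: eq_bigr => i _; rewrite mulr_suml.
Qed.

End MicroLaplacian.

(** * Principal symbols and comparison of the two Laplacians *)

Section FrameOperator.
Context {R : realType} {n k : nat} {M : manifold R n}.
Variable S : sub_riemannian k M.
Variable C : M -> set (tvec M).
Hypothesis hC : complement S C.
Implicit Types (q p : M) (phi : M -> R).
Local Notation coordf c i := (fun r : M => chart_map c r 0 i).

(** The common shape of the two Laplacians: a sum of squares and horizontal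
    first-order terms. *)
Definition frame_operator (X : 'I_n -> M -> tvec M) (b : 'I_n -> M -> R) phi q : R :=
  \sum_(i < n | (i < k)%N) (X i q (fun p => X i p phi) : R) +
  \sum_(i < n | (i < k)%N) b i q * (X i q phi : R).

Definition locally_frame_operator (P : (M -> R) -> M -> R) : Prop :=
  forall q, exists U X cs (b : 'I_n -> M -> R),
    [/\ U q, regular_frame S C U X cs, forall i p, U p -> smooth_at p (b i) &
        forall p phi, U p -> smooth_at p phi -> P phi p = frame_operator X b phi p].

(** The polarized carre du champ: for an operator with principal part
    sum X_l^2 and no zeroth order term it is the bilinear form
    sum (X_l f)(X_l g), whatever its first order part. *)
Definition carre_du_champ (P : (M -> R) -> M -> R) (f g : M -> R) q : R :=
  2^-1 * (P (fun p => f p * g p) q - f q * P g q - g q * P f q).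

Lemma carre_du_champC P f g q : carre_du_champ P f g q = carre_du_champ P g f q.
Proof.
rewrite /carre_du_champ (_ : (fun p => f p * g p) = (fun p => g p * f p)).
  by rewrite addrAC.
by apply/funext => p; rewrite mulrC.
Qed.

Section Local.
Variables (U : set M) (X : 'I_n -> M -> tvec M) (cs : 'I_n -> 'I_n -> 'I_n -> M -> R).
Variables (b : 'I_n -> M -> R) (P : (M -> R) -> M -> R).
Hypothesis rX : regular_frame S C U X cs.
Hypothesis sb : forall i p, U p -> smooth_at p (b i).
Hypothesis PE : forall p phi, U p -> smooth_at p phi -> P phi p = frame_operator X b phi p.

Let oU : open U := rf_open rX.
Let vX i : vector_field U (X i) := adapted_field hC (rf_adapted rX) i.
Let tX i q (Uq : U q) : tangent q (X i q) := vector_field_tangent (vX i) Uq.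

Lemma frame_operator_smooth q f : U q -> smooth_at q f -> smooth_at q (P f).
Proof.
move=> Uq sf; have NU : \near q, U q by exact: (open_nbhs_nbhs (conj oU Uq)).
have Nf := smooth_at_near sf.
apply: (@smooth_at_ext _ _ _ q (frame_operator X b f)).
  by near=> p; rewrite PE //; near: p.
apply: smooth_atD; apply: smooth_at_sum => i _.
  by do 2 apply: (frame_smooth hC rX _ Uq).
by apply: smooth_atM; [exact: sb|exact: (frame_smooth hC rX)].
Unshelve. all: by end_near.
Qed.

Lemma carre_du_champE q f g : U q -> smooth_at q f -> smooth_at q g ->
  carre_du_champ P f g q = \sum_(l < n | (l < k)%N) (X l q f : R) * (X l q g : R).
Proof.
move=> Uq sf sg; have NU : \near q, U q by exact: (open_nbhs_nbhs (conj oU Uq)).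
have Nf := smooth_at_near sf; have Ng := smooth_at_near sg.
have sfg : smooth_at q (fun p => f p * g p) by exact: smooth_atM.
have X2 l : X l q (fun p => X l p (fun r => f r * g r)) =
    f q * X l q (fun p => X l p g) + g q * X l q (fun p => X l p f) +
    2 * ((X l q f : R) * (X l q g : R)).
  rewrite (tangent_ext_fun (g := fun p => f p * X l p g + g p * X l p f) (tX l Uq)); last first.
    by near=> p; apply: tangentM; [apply: tX; near: p|near: p|near: p].
  have sXf := frame_smooth hC rX l Uq sf; have sXg := frame_smooth hC rX l Uq sg.
  rewrite (tangentD (tX l Uq)); try by apply: smooth_atM.
  by rewrite !(tangentM (tX l Uq)) //; ring.
have X1 l : X l q (fun r => f r * g r) = f q * X l q g + g q * X l q f.
  by rewrite (tangentM (tX l Uq)).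
rewrite /carre_du_champ !PE // /frame_operator.
under eq_bigr do rewrite X2; under [X in _ + X - _ - _]eq_bigr do rewrite X1 mulrDr.
rewrite !big_split /= -!mulr_sumr.
have E1 (h : M -> R) (a : R) : \sum_(l < n | (l < k)%N) b l q * (a * (X l q h : R)) =
    a * \sum_(l < n | (l < k)%N) b l q * (X l q h : R).
  by rewrite mulr_sumr; apply: eq_bigr => l _; rewrite mulrCA.
by rewrite !E1; field.
Unshelve. all: by end_near.
Qed.

(** The first-order part is the value of P on the coordinates, which are only
    smooth near q; this is legitimate because P is given by the frame formula on
    all germs. *)
Lemma frame_operator_expansion c q phi : atlas c -> dom c q -> U q -> smooth_at q phi ->
  P phi q =
    \sum_i \sum_j carre_du_champ P (coordf c i) (coordf c j) q *
      coord_vec c i q (fun p => coord_vec c j p phi) +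
    \sum_i P (coordf c i) q * coord_vec c i q phi + 0 * phi q.
Proof.
move=> Ac cq Uq sphi; have sx i : smooth_at q (coordf c i) by exact: smooth_at_coord.
rewrite mul0r addr0 PE // /frame_operator.
under eq_bigr do rewrite (vector_field_second_order oU (vX _) (vX _) Uq Ac cq sphi).
rewrite big_split /= -addrA; congr (_ + _).
  rewrite exchange_big /=; apply: eq_bigr => i _; rewrite exchange_big /=.
  by apply: eq_bigr => j _; rewrite carre_du_champE // mulr_suml.
rewrite exchange_big /=.
rewrite [X in _ + X](eq_bigr (fun l : 'I_n => \sum_i b l q *
    ((X l q (coordf c i) : R) * (coord_vec c i q phi : R)))) => [|l _]; last first.
  by rewrite {1}(tangent_coord Ac cq (tX l Uq)) tvec_combE mulr_sumr.
rewrite [X in _ + X]exchange_big /= -big_split /=; apply: eq_bigr => j _.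
rewrite -!mulr_suml PE // /frame_operator mulrDl; congr (_ + _).
by rewrite mulr_suml; apply: eq_bigr => l _; rewrite mulrA.
Qed.

(** Both sides are sum_(l < k) <l, X_l>^2. *)
Lemma carre_du_champ_symbol c q (l : cotangent q) : atlas c -> dom c q -> U q ->
  2 * hamiltonian S q l =
  \sum_i \sum_j carre_du_champ P (coordf c i) (coordf c j) q *
    l (coord_vec c i q) * l (coord_vec c j q).
Proof.
move=> Ac cq Uq; rewrite (hamiltonian_frameE (rf_adapted rX) Uq) mulrA divff // mul1r.
under eq_bigr do rewrite (tangent_vectorE Ac cq (tX _ Uq) (cotangent_linear l)) big_distrlr.
rewrite exchange_big /=; apply: eq_bigr => i _; rewrite exchange_big /=.
apply: eq_bigr => j _; rewrite carre_du_champE //; try exact: smooth_at_coord.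
by rewrite !mulr_suml; apply: eq_bigr => m _; ring.
Qed.

End Local.

Section Global.
Variable P : (M -> R) -> M -> R.
Hypothesis lP : locally_frame_operator P.

Lemma order2_frame_operator c : atlas c ->
  order2_expr P c (fun i j => carre_du_champ P (coordf c i) (coordf c j))
    (fun i => P (coordf c i)) (fun=> 0).
Proof.
move=> Ac; have oc := chart_open Ac.
have sP q f : smooth_at q f -> smooth_at q (P f).
  have [U [X [cs [b [Uq rX sb PE]]]]] := lP q.
  exact: (frame_operator_smooth rX sb PE Uq).
split.
- move=> i j; apply: smooth_onP => q cq.
  have sx m : smooth_at q (coordf c m) by exact: smooth_at_coord.
  apply: smooth_atM; first exact: smooth_at_cst.
  apply: smooth_atB; [apply: smooth_atB|]; [by apply: sP; exact: smooth_atM| |];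
    by apply: smooth_atM => //; exact: sP.
- by move=> i; apply: smooth_onP => q cq; apply: sP; exact: smooth_at_coord.
- by apply: smooth_onP => q cq; exact: smooth_at_cst.
- by move=> i j q; exact: carre_du_champC.
- move=> phi sphi q cq; have [U [X [cs [b [Uq rX sb PE]]]]] := lP q.
  by apply: (frame_operator_expansion rX PE Ac cq Uq (smooth_on_at openT I sphi)).
Qed.

Lemma principal_symbol_frame_operator :
  principal_symbol P (fun q (l : cotangent q) => 2 * hamiltonian S q l).
Proof.
move=> c Ac; do 3 eexists; split; first exact: order2_frame_operator.
move=> q l cq; have [U [X [cs [b [Uq rX sb PE]]]]] := lP q.
exact: (carre_du_champ_symbol rX PE l Ac cq Uq).
Qed.

Lemma no_zeroth_order_term_frame_operator : no_zeroth_order_term P.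
Proof. by move=> c Ac; do 2 eexists; exact: order2_frame_operator. Qed.

End Global.

Lemma structural_sum_smooth U X cs (A : pred 'I_n) i q : regular_frame S C U X cs -> U q ->
  smooth_at q (fun p => \sum_(j < n | A j) cs j i j p).
Proof. by move=> rX Uq; apply: smooth_at_sum => j _; exact: (rf_smooth rX). Qed.

Variable w : M -> ('I_n -> tvec M) -> R.
Hypothesis hw : volume_form w.

Lemma macro_frame_operator : locally_frame_operator (macro_laplacian S w).
Proof.
move=> q; have [U [X [cs [Uq rX]]]] := exists_regular_frame hC q.
have aX := rf_adapted rX; have fX := adapted_tangent_frame hC aX.
have oU := rf_open rX.
pose th p := ln `|w p (X^~ p)|.
have sth p : U p -> smooth_at p th.
  move=> Up; apply: smooth_at_ln_norm; last exact: (volume_frame_neq0 hw fX Up).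
  by apply: (volume_smooth hw oU _ Up) => i; exact: (adapted_field hC aX).
exists U, X, cs, (fun i p => \sum_(j < n | (j < k)%N) cs j i j p +
  (\sum_(j < n | (k <= j)%N) cs j i j p + X i p th)).
split => // [i p Up|p phi Up sphi].
  do 2 (apply: smooth_atD; first exact: structural_sum_smooth rX Up).
  exact: (frame_smooth hC rX _ Up (sth p Up)).
rewrite (macro_laplacianE hC rX hw Up sphi) /micro_frame /frame_operator -addrA; congr (_ + _).
under [RHS]eq_bigr do rewrite mulrDl mulrDl; rewrite !big_split /=; congr (_ + _).
rewrite /chi_frame (adapted_gradientE _ aX Up).
transitivity ((\sum_(i < n | (i < k)%N) \sum_(j < n | (k <= j)%N) cs j i j p *: X i p : tvec M) phi +
  (\sum_(i < n | (i < k)%N) (X i p th : R) *: X i p : tvec M) phi : R); first by [].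
congr (_ + _); last by rewrite tvec_combE.
rewrite tvec_sumE; apply: eq_bigr => i _; rewrite tvec_sumE mulr_suml.
by apply: eq_bigr => j _.
Qed.

Variables muS muV : forall q : M, probability (cotangentB q) R.
Hypotheses (hS : uniform_on_sphere S C muS) (hV : admissible_vertical S muS muV).

Lemma micro_frame_operator : locally_frame_operator (micro_laplacian S muS muV).
Proof.
move=> q; have [U [X [cs [Uq rX]]]] := exists_regular_frame hC q.
exists U, X, cs, (fun i p => \sum_(j < n | (j < k)%N) cs j i j p).
split => // [i p Up|p phi Up sphi]; first exact: structural_sum_smooth rX Up.
exact: (micro_laplacianE hC hS hV rX Up sphi).
Qed.

(** The given structural functions coincide on U with smooth ones, for which both
    operators have been computed. *)
Lemma laplacian_difference U X cs phi q : open U -> adapted_frame S C U X ->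
  structural_functions U X cs -> U q -> smooth_at q phi ->
  macro_laplacian S w phi q - micro_laplacian S muS muV phi q = chi_frame S w X cs q phi.
Proof.
move=> oU aX hcs Uq sphi; have [cs' rX] := adapted_regular_frame hC oU aX.
rewrite (macro_laplacianE hC rX hw Uq sphi) (micro_laplacianE hC hS hV rX Uq sphi).
rewrite [LHS]addrC addKr; congr (_ phi); rewrite /chi_frame; congr (_ + _).
apply: eq_bigr => i _; apply: eq_bigr => j _; congr (_ *: _).
exact: (structural_functions_unique (adapted_tangent_frame hC aX) (rf_structural rX) hcs).
Qed.

End FrameOperator.

Theorem theorem6 (R : realType) (n k : nat) (M : manifold R n)
    (S : sub_riemannian k M) (C : M -> set (tvec M))
    (w : M -> ('I_n -> tvec M) -> R)
    (muS muV : forall q : M, probability (cotangentB q) R)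
    (hC : complement S C) (hw : volume_form w)
    (hmuS : uniform_on_sphere S C muS)
    (hmuV : admissible_vertical S muS muV) :
  let L := micro_laplacian S muS muV in
  let Delta := macro_laplacian S w in
  [/\ exists sigma : forall q : M, cotangent q -> R,
        principal_symbol Delta sigma /\ principal_symbol L sigma,
      no_zeroth_order_term Delta /\ no_zeroth_order_term L,
      forall U X cs, open U -> adapted_frame S C U X ->
        structural_functions U X cs ->
        forall phi, smooth phi -> forall q, U q ->
          Delta phi q - L phi q = chi_frame S w X cs q phi &
      (forall phi, smooth phi -> L phi = Delta phi) <->
      (forall U X cs, open U -> adapted_frame S C U X ->
        structural_functions U X cs ->
        forall phi, smooth phi -> forall q, U q ->
          chi_frame S w X cs q phi = 0)].
Proof.
move=> L Delta.
have lD := macro_frame_operator hC hw; have lL := micro_frame_operator hC hmuS hmuV.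
have diff U X cs : open U -> adapted_frame S C U X -> structural_functions U X cs ->
    forall phi, smooth phi -> forall q, U q -> Delta phi q - L phi q = chi_frame S w X cs q phi.
  move=> oU aX hcs phi sphi q Uq.
  exact: (laplacian_difference hC hw hmuS hmuV oU aX hcs Uq (smooth_on_at openT _ sphi)).
split.
- exists (fun q (l : cotangent q) => 2 * hamiltonian S q l).
  by split; exact: (principal_symbol_frame_operator hC).
- by split; exact: (no_zeroth_order_term_frame_operator hC).
- exact: diff.
split=> [LD U X cs oU aX hcs phi sphi q Uq|chi0 phi sphi].
  by rewrite -(diff U X cs) // LD // subrr.
apply/funext => q; have [U [X [cs [Uq rX]]]] := exists_regular_frame hC q.
have := diff U X cs (rf_open rX) (rf_adapted rX) (rf_structural rX) phi sphi q Uq.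
rewrite (chi0 U X cs (rf_open rX) (rf_adapted rX) (rf_structural rX) phi sphi q Uq).
by move=> /eqP; rewrite subr_eq0 => /eqP.
Qed.
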